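(* Let $\{\mu_n\}_{n\geq 1}$ be a sequence of probability measures on $\mathbb{R}$, each with variance $1$ and mean $0$, such that for every $n\geq 1$ the measure $\mu_n$ is $n$-divisible with respect to free additive convolution $\boxplus$. Let $X_n$ be a random variable with distribution $\mu_n$. If $E[X_n^4]\rightarrow 2$ as $n\to\infty$, then $\mu_n$ converges in distribution (weakly) to $\mathcal{S}(0,1)$ as $n\to\infty$.
   Context: $\mathcal{S}(0,1)$ is the centered semicircle law with unit variance, i.e. the probability measure on $\mathbb{R}$ with density $\frac{1}{2\pi}\sqrt{4-s^2}\,\mathbf{1}_{(-2,2)}(s)$. Here $E[X_n^4]=\int_{\mathbb{R}}x^4\,\mu_n(dx)$. Free additive convolution: for a probability measure $\mu$ on $\mathbb{R}$ let $G_\mu(z)=\int_{\mathbb{R}}\frac{\mu(dx)}{z-x}$ for $z\in\mathbb{C}^+$ be its Cauchy transform and $F_\mu(z)=1/G_\mu(z)$. There are $\eta,M>0$ such that $F_\mu$ has a right inverse $F_\mu^{-1}$ on $\Gamma_{\eta,M}=\{z\in\mathbb{C}^+:|\mathrm{Re}(z)|<\eta\,\mathrm{Im}(z),\ |z|>M\}$ (the standard analytic one of Bercovici and Voiculescu), and the Voiculescu transform is $\phi_\mu(z)=F_\mu^{-1}(z)-z$. The free additive convolution $\mu_1\boxplus\mu_2$ is the probability measure on $\mathbb{R}$ with $\phi_{\mu_1\boxplus\mu_2}(z)=\phi_{\mu_1}(z)+\phi_{\mu_2}(z)$ on a common domain of this form; it corresponds to the distribution of the sum of two freely independent random variables with distributions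 $\mu_1,\mu_2$. A probability measure $\mu$ on $\mathbb{R}$ is $n$-divisible with respect to $\boxplus$ if $\mu=\rho^{\boxplus n}$ (the $n$-fold free convolution) for some probability measure $\rho$ on $\mathbb{R}$. *)

(* Defs.v *)
From HB Require Import structures.
From mathcomp Require Import all_boot all_order all_algebra complex.
From mathcomp Require Import all_classical all_reals all_analysis.
From mathcomp Require Import measurable_realfun.
From mathcomp Require Import ring lra.

Set Implicit Arguments.
Unset Strict Implicit.
Unset Printing Implicit Defensive.

Import Order.TTheory GRing.Theory Num.Theory.
Import numFieldNormedType.Exports.

Local Open Scope classical_set_scope.
Local Open Scope ring_scope.
Local Open Scope complex_scope.

Section free_convolution.
Context {R : realType}.
Local Notation C := R[i].
Local Notation law := (probability (measurableTypeR R) R).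
Implicit Types (mu nu rho : law) (eta M : R) (phi H : C -> C).

Definition upper_half_plane : set C := [set z | 0 < complex.Im z].

(* The integrand is bounded in [x] for [z] in the upper half-plane, so both
   integrals below converge; the value elsewhere is irrelevant. *)
Definition cauchy_transform mu (z : C) : C :=
  (\int[mu]_x complex.Re ((z - x%:C)^-1)) +i*
  (\int[mu]_x complex.Im ((z - x%:C)^-1)).

Definition F_transform mu (z : C) : C := (cauchy_transform mu z)^-1.

Definition Gamma eta M : set C :=
  [set z | [/\ upper_half_plane z,
    `|complex.Re z| < eta * complex.Im z & M%:C < `|z|]].

(* Analyticity alone does not single out the Bercovici-Voiculescu branch:
   for the symmetric Bernoulli law F(z) = z - 1/z, and both roots w of F(w) = z
   can lie in the upper half-plane.  The standard branch is the one with
   H(z) = z(1 + o(1)) as z tends to infinity inside the cone. *)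
Definition is_right_inverse_F mu eta M H :=
  [/\ forall z, Gamma eta M z -> upper_half_plane (H z),
      forall z, Gamma eta M z -> F_transform mu (H z) = z,
      forall z, Gamma eta M z -> derivable (H : C^o -> C^o) z 1 &
      forall e : R, 0 < e -> exists K : R, forall z, Gamma eta M z ->
        K%:C < `|z| -> `|H z / z - 1| < e%:C].

Definition is_voiculescu_transform mu eta M phi :=
  exists2 H, is_right_inverse_F mu eta M H &
    forall z, Gamma eta M z -> phi z = H z - z.

(* [is_free_conv mu1 mu2 nu]: nu is the free additive convolution of mu1 and
   mu2.  It determines nu up to its values on non-measurable sets. *)
Definition is_free_conv mu1 mu2 nu :=
  exists eta M phi1 phi2,
    [/\ 0 < eta, 0 < M,
        is_voiculescu_transform mu1 eta M phi1,
        is_voiculescu_transform mu2 eta M phi2 &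
        is_voiculescu_transform nu eta M (fun z => phi1 z + phi2 z)].

(* [is_free_power rho n nu]: nu is the n-fold free convolution of rho, n >= 1. *)
Inductive is_free_power rho : nat -> law -> Prop :=
| free_power1 nu :
    (forall A, measurable A -> nu A = rho A) -> is_free_power rho 1 nu
| free_powerS n nu nu' :
    is_free_power rho n nu -> is_free_conv nu rho nu' ->
    is_free_power rho n.+1 nu'.

Definition free_divisible (n : nat) mu := exists rho, is_free_power rho n mu.

End free_convolution.

Definition weak_cvg (R : realType)
    (mu : nat -> probability (measurableTypeR R) R)
    (nu : probability (measurableTypeR R) R) :=
  forall f : R -> R, continuous f -> bounded_fun f ->
    (\int[mu n]_x (f x)%:E @[n --> \oo] --> \int[nu]_x (f x)%:E)%E.

Section semicircle.
Variable R : realType.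
Local Notation leb := (@lebesgue_measure R).

Definition semicircle_pdf (s : R) : R :=
  (2 * pi)^-1 * Num.sqrt (4 - s ^+ 2) * \1_`]- 2, 2[%classic s.

Lemma semicircle_pdf_ge0 s : 0 <= semicircle_pdf s.
Proof. by rewrite !mulr_ge0 ?invr_ge0 ?mulr_ge0 ?pi_ge0 ?sqrtr_ge0. Qed.

Let continuous_sqrt : continuous (fun s : R => Num.sqrt (4 - s ^+ 2)).
Proof.
move=> s; apply: (@continuous_comp _ _ _ (fun s : R => 4 - s ^+ 2) Num.sqrt).
  by apply: cvgB; [exact: cvg_cst | exact: exprn_continuous].
exact: sqrt_continuous.
Qed.

Lemma measurable_semicircle_pdf : measurable_fun setT semicircle_pdf.
Proof.
apply: measurable_funM; last exact: measurable_indic.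
apply: measurable_funM => //.
exact: continuous_measurable_fun.
Qed.

Lemma integral_semicircle_pdf : (\int[leb]_s (semicircle_pdf s)%:E = 1)%E.
Proof.
have pi2 : - (pi / 2) < pi / 2 :> R by have := pi_gt0 R; lra.
pose F (t : R) : R := 2 * sin t.
have dF (t : R) : is_derive t 1 F (2 * cos t).
  by apply: is_derive_eq; rewrite ?scaler0 ?add0r ?addr0.
have F'E : F^`()%classic = fun t => 2 * cos t.
  by apply/funext => t; rewrite derive1E derive_val.
have cF' : continuous (fun t : R => 2 * cos t).
  by move=> t; apply: cvgM; [exact: cvg_cst | exact: continuous_cos].
have cF : continuous F.
  by move=> t; apply: cvgM; [exact: cvg_cst | exact: continuous_sin].
have Fb : F (pi / 2) = 2 by rewrite /F sin_pihalf mulr1.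
have Fa : F (- (pi / 2)) = - 2 by rewrite /F sinN sin_pihalf mulrN1.
have sq : (\int[leb]_(s in `[(- 2)%R, 2%R]) (Num.sqrt (4 - s ^+ 2))%:E =
    (2 * pi)%:E)%E.
  have -> : `[(- 2)%R, 2%R]%classic = `[F (- (pi / 2)), F (pi / 2)]%classic :> set R.
    by rewrite Fa Fb.
  rewrite integration_by_substitution_increasing//.
  - rewrite F'E.
    pose G (t : R) : R := 2 * t + 2 * (sin t * cos t).
    have dG (t : R) : is_derive t 1 G (4 * cos t ^+ 2).
      apply: is_derive_eq; rewrite /GRing.scale/=.
      have := cos2Dsin2 t; nra.
    have -> : (2 * pi = G (pi / 2) - G (- (pi / 2)))%R.
      by rewrite /G cosN sinN cos_pihalf; field.
    rewrite EFinB -(@continuous_FTC2 _ (fun t : R => 4 * cos t ^+ 2))//.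
    + apply: eq_integral => t; rewrite inE/= in_itv/= => tpi.
      rewrite /F fctE/=; congr EFin.
      have -> : 4 - (2 * sin t) ^+ 2 = (2 * cos t) ^+ 2.
        by have := cos2Dsin2 t; nra.
      rewrite sqrtr_sqr ger0_norm; first by ring.
      by rewrite mulr_ge0// cos_ge0_pihalf.
    + apply: continuous_subspaceT => t; apply: cvgM; first exact: cvg_cst.
      apply: (@continuous_comp _ _ _ (@cos R) (fun x => x ^+ 2)).
        exact: continuous_cos.
      exact: exprn_continuous.
    + have cG : continuous G.
        move=> t; apply: differentiable_continuous.
        by apply/derivable1_diffP; have [] := dG t.
      split.
      * by move=> t _; have [] := dG t.
      * exact/cvg_at_right_filter/cG.
      * exact/cvg_at_left_filter/cG.
    + by move=> t _; rewrite derive1E derive_val.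
  - by rewrite ltW.
  - move=> x y xI yI xy; rewrite /F ltr_pM2l// ltr_sin//.
  - by rewrite F'E => t _; exact: cF'.
  - by rewrite F'E; apply/cvg_ex; eexists; apply/cvg_at_right_filter/cF'.
  - by rewrite F'E; apply/cvg_ex; eexists; apply/cvg_at_left_filter/cF'.
  - split.
    + by move=> t _; have [] := dF t.
    + exact/cvg_at_right_filter/cF.
    + exact/cvg_at_left_filter/cF.
  - exact/continuous_subspaceT/continuous_sqrt.
have c0 : 0 <= (2 * pi)^-1 :> R by rewrite invr_ge0 mulr_ge0 ?pi_ge0.
transitivity ((2 * pi)^-1%:E *
    \int[leb]_(s in `[(- 2)%R, 2%R]) (Num.sqrt (4 - s ^+ 2))%:E)%E; last first.
  by rewrite sq -EFinM mulVf// gt_eqF// mulr_gt0 ?pi_gt0.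
have mS : measurable_fun (`[(- 2)%R, 2%R]%classic : set R)
    (fun s : R => (Num.sqrt (4 - s ^+ 2))%:E).
  apply/measurable_funTS/measurable_EFinP.
  exact: continuous_measurable_fun.
rewrite -ge0_integralZl//.
rewrite [RHS]integral_mkcond; apply: eq_integral => s _.
rewrite patchE mem_setE /semicircle_pdf indicE mem_setE !in_itv/= -EFinM.
have [s2|s2] := boolP (-2 < s < 2).
  by rewrite mulr1 ifT//; case/andP: s2 => ? ?; rewrite !ltW.
rewrite mulr0; case: ifPn => // s2'; rewrite ler0_sqrtr ?mulr0//.
by move: s2 s2'; rewrite negb_and -!leNgt => /orP[] ? /andP[? ?]; nra.
Qed.

(* The centered semicircle law of variance 1. *)
Definition semicircle_prob : set _ -> \bar R :=
  fun A => (\int[leb]_(s in A) (semicircle_pdf s)%:E)%E.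

Let semicircle0 : semicircle_prob set0 = 0%E.
Proof. by rewrite /semicircle_prob integral_set0. Qed.

Let semicircle_ge0 A : (0 <= semicircle_prob A)%E.
Proof. by apply: integral_ge0 => x _; rewrite lee_fin semicircle_pdf_ge0. Qed.

Let semicircle_sigma_additive : semi_sigma_additive semicircle_prob.
Proof.
move=> /= F mF tF mUF; rewrite /semicircle_prob; apply: cvg_toP.
  apply: ereal_nondecreasing_is_cvgn => m n mn.
  apply: lee_sum_nneg_natr => // k _ _.
  by apply: integral_ge0 => x _; rewrite lee_fin semicircle_pdf_ge0.
rewrite ge0_integral_bigcup//=.
- apply/measurable_funTS/measurable_EFinP; exact: measurable_semicircle_pdf.
- by move=> x _; rewrite lee_fin semicircle_pdf_ge0.
Qed.

HB.instance Definition _ := isMeasure.Build _ _ _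
  semicircle_prob semicircle0 semicircle_ge0 semicircle_sigma_additive.

Let semicircle_setT : semicircle_prob [set: _] = 1%E.
Proof. exact: integral_semicircle_pdf. Qed.

HB.instance Definition _ :=
  @Measure_isProbability.Build _ _ R semicircle_prob semicircle_setT.

End semicircle.

(* Main.v *)
(* Let [rho] be the [n]-th free convolution root of [mu = mu n], [G] the Cauchy
   transform and [F = 1 / G]. Dividing the Voiculescu transform by [n] gives
   [G_rho (om w) = G_mu w] with [om w = F_mu w + (w - F_mu w) / n], first far up the
   imaginary axis, then on the whole upper half-plane by analytic continuation.
   Expanding this identity at [w = i k], [k -> oo], gives the moments of [rho]:
   mean [0], second moment [1 / n] and [n m4(rho) <= m4(mu) - 2 + 2 / n]. By
   Cauchy-Schwarz [n \int |x| ^ 3 d rho -> 0], so a second-order expansion of [G_rho]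
   at the fixed point [om w] shows [F + 1 / F - w -> 0]. Hence [G_(mu n) w] tends to
   the root [q] of [q + 1 / q = w] in the lower half-plane, the Cauchy transform of
   the semicircle law. Weak convergence follows by Poisson smoothing: for
   [0 <= f <= M] continuous, [\int f d mu_n] is, up to a small error, at least the
   integral over [-2, 2] of [f] against the smoothed density [- Im G (t + i e) / pi].
   Applied to [M + f] and [M - f], this bounds the integrals from both sides. *)

Require Import Defs.
From mathcomp Require Import all_boot all_order all_algebra complex.
From mathcomp Require Import all_classical all_reals all_analysis.
From mathcomp Require Import measurable_realfun.
From mathcomp Require Import ring lra.

Set Implicit Arguments.
Unset Strict Implicit.
Unset Printing Implicit Defensive.

Import Order.TTheory GRing.Theory Num.Theory.
Import numFieldNormedType.Exports.

Local Open Scope classical_set_scope.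
Local Open Scope ring_scope.

Import Normc.
Local Open Scope complex_scope.

(** The root [rho] comes without any moments: [is_free_conv] only supplies right inverses of [F] on
    some cone, asymptotic to the identity. This asymptotic clause makes them unique far out, so that
    Voiculescu transforms can be added along the convolutions; the moments of [rho] must then be
    extracted from its Cauchy transform, by Fatou's lemma, at first as inequalities. For the fourth
    moment an inequality is enough. With mean 0 and variance 1, [m4(mu) - 2] is the fourth free
    cumulant, and the free cumulants of [rho] are those of [mu] divided by [n]; this predicts
    [n m4(rho) = m4(mu) - 2 + 2 / n], and the hypothesis on fourth moments says that this tends to
    0. The map [om] is the subordination function. It is used at points close to the real axis,
    while free convolution is specified only far away from it; this forces the continuation.
    Analyticity is expressed by majorant bounds on polynomial approximations, which compose
    directly. In the smoothing step, [f >= 0] makes the loss of everything outside [-2, 2] harmless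
    for a lower bound, and equality of total masses turns the two lower bounds into a limit. *)

Section complex_abs.
Context {R : realType}.
Local Notation C := R[i].
Implicit Types z w : C.

(** * Modulus, real and imaginary parts of complex numbers *)

Lemma lerX2 (x y : R) n : 0 <= x -> x <= y -> x ^+ n <= y ^+ n.
Proof. by move=> x0 xy; apply: lerXn2r => //; rewrite nnegrE// (le_trans x0). Qed.

Lemma lt_normc (a : R) z : (a%:C < `|z|) = (a < normc z).
Proof. exact: (@ltcR R a (normc z)). Qed.

Lemma normc_lt (a : R) z : (`|z| < a%:C) = (normc z < a).
Proof. exact: (@ltcR R (normc z) a). Qed.

Lemma normc_ge0 z : 0 <= normc z.
Proof. by case: z => a b; exact: sqrtr_ge0. Qed.

Lemma normc_gt0 z : (0 < normc z) = (z != 0).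
Proof.
rewrite lt_def normc_ge0 andbT; congr negb; apply/eqP/eqP => [|->].
  exact: eq0_normc.
exact: normc0.
Qed.

Lemma normcD z w : normc (z + w) <= normc z + normc w.
Proof. exact: (@le_normcD R z w). Qed.

Lemma normcN z : normc (- z) = normc z.
Proof. exact: (@complex.normcN R z). Qed.

Lemma normcB z w : normc (z - w) <= normc z + normc w.
Proof. by rewrite -(normcN w); exact: normcD. Qed.

Lemma normc_sub z w : normc (z - w) = normc (w - z).
Proof. by rewrite -normcN opprB. Qed.

Lemma normc_lb z w : normc z - normc w <= normc (z - w).
Proof. by rewrite lerBlDr; apply: le_trans (normcD _ _); rewrite subrK. Qed.

Lemma normcX z n : normc (z ^+ n) = normc z ^+ n.
Proof. by elim: n => [|n IH]; rewrite ?normc1// !exprS normcM IH. Qed.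

Lemma normc_real (x : R) : normc x%:C = `|x|.
Proof. by rewrite /= expr0n/= addr0 sqrtr_sqr. Qed.

Lemma normc_sqr z : normc z ^+ 2 = complex.Re z ^+ 2 + complex.Im z ^+ 2.
Proof. by case: z => a b /=; rewrite sqr_sqrtr// addr_ge0 ?sqr_ge0. Qed.

Lemma normc_Re z : `|complex.Re z| <= normc z.
Proof.
rewrite -(@ler_pXn2r _ 2)// ?nnegrE ?normc_ge0// normc_sqr real_normK ?num_real//.
by rewrite lerDl sqr_ge0.
Qed.

Lemma normc_Im z : `|complex.Im z| <= normc z.
Proof.
rewrite -(@ler_pXn2r _ 2)// ?nnegrE ?normc_ge0// normc_sqr real_normK ?num_real//.
by rewrite lerDr sqr_ge0.
Qed.

Lemma normc_ReIm z : normc z <= `|complex.Re z| + `|complex.Im z|.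
Proof.
rewrite -(@ler_pXn2r _ 2)// ?nnegrE ?normc_ge0 ?addr_ge0// normc_sqr.
have := normr_ge0 (complex.Re z); have := normr_ge0 (complex.Im z).
rewrite -(real_normK (num_real (complex.Re z))) -(real_normK (num_real (complex.Im z))).
by move: `|_| `|_| => a b; nra.
Qed.

Lemma cReD z w : complex.Re (z + w) = complex.Re z + complex.Re w.
Proof. by case: z w => ? ? []. Qed.
Lemma cImD z w : complex.Im (z + w) = complex.Im z + complex.Im w.
Proof. by case: z w => ? ? []. Qed.
Lemma cReN z : complex.Re (- z) = - complex.Re z.
Proof. by case: z. Qed.
Lemma cImN z : complex.Im (- z) = - complex.Im z.
Proof. by case: z. Qed.
Lemma cReM z w : complex.Re (z * w) =
  complex.Re z * complex.Re w - complex.Im z * complex.Im w.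
Proof. by case: z w => ? ? []. Qed.
Lemma cImM z w : complex.Im (z * w) =
  complex.Re z * complex.Im w + complex.Im z * complex.Re w.
Proof. by case: z w => ? ? []. Qed.
Lemma cReV z : complex.Re z^-1 = complex.Re z / normc z ^+ 2.
Proof. by rewrite normc_sqr; case: z. Qed.
Lemma cImV z : complex.Im z^-1 = - complex.Im z / normc z ^+ 2.
Proof. by rewrite normc_sqr mulNr; case: z. Qed.

Lemma cImMr (x : R) z : complex.Im (x%:C * z) = x * complex.Im z.
Proof. by case: z => a b /=; rewrite mul0r addr0. Qed.

Definition ReImE := (cReD, cImD, cReN, cImN, cReM, cImM).

Lemma complex_eq z w : complex.Re z = complex.Re w ->
  complex.Im z = complex.Im w -> z = w.
Proof. by case: z w => ? ? [? ?] /= -> ->. Qed.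

Lemma upper_neq0 z : 0 < complex.Im z -> z != 0.
Proof. by apply: contraTneq => ->; rewrite ltxx. Qed.

Lemma upper_sub_real z (x : R) : complex.Im (z - x%:C) = complex.Im z.
Proof. by rewrite !ReImE /= subr0. Qed.

Lemma upper_sub_neq0 z (x : R) : 0 < complex.Im z -> z - x%:C != 0.
Proof. by move=> z0; apply: upper_neq0; rewrite upper_sub_real. Qed.

Lemma normc_sub_real_ge z (x : R) : complex.Im z <= normc (z - x%:C).
Proof.
by apply: le_trans (normc_Im _); rewrite upper_sub_real ler_norm.
Qed.

End complex_abs.

(** * Integration of complex-valued functions *)

Section complex_integral.
Context {R : realType}.
Local Notation C := R[i].
Local Notation law := (probability (measurableTypeR R) R).
Implicit Types (mu : law) (f g : R -> C).

Definition cmeasurable f :=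
  measurable_fun setT (fun x => complex.Re (f x)) /\
  measurable_fun setT (fun x => complex.Im (f x)).

Lemma cmeasurable_cst (c : C) : cmeasurable (fun=> c).
Proof. by split; exact: measurable_cst. Qed.

Lemma cmeasurable_real (h : R -> R) : measurable_fun setT h ->
  cmeasurable (fun x => (h x)%:C).
Proof. by move=> mh; split => //=; exact: measurable_cst. Qed.

Lemma cmeasurableD f g : cmeasurable f -> cmeasurable g ->
  cmeasurable (fun x => f x + g x).
Proof.
move=> [rf If] [rg Ig]; split.
  by under eq_fun do rewrite cReD; exact: measurable_funD.
by under eq_fun do rewrite cImD; exact: measurable_funD.
Qed.

Lemma cmeasurableN f : cmeasurable f -> cmeasurable (fun x => - f x).
Proof.
move=> [rf If]; split.
  by under eq_fun do rewrite cReN; exact: measurableT_comp.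
by under eq_fun do rewrite cImN; exact: measurableT_comp.
Qed.

Lemma cmeasurableB f g : cmeasurable f -> cmeasurable g ->
  cmeasurable (fun x => f x - g x).
Proof. by move=> mf mg; apply: cmeasurableD => //; exact: cmeasurableN. Qed.

Lemma cmeasurableM f g : cmeasurable f -> cmeasurable g ->
  cmeasurable (fun x => f x * g x).
Proof.
move=> [rf If] [rg Ig]; split.
  by under eq_fun do rewrite cReM; apply: measurable_funB; exact: measurable_funM.
by under eq_fun do rewrite cImM; apply: measurable_funD; exact: measurable_funM.
Qed.

Lemma cmeasurableX f n : cmeasurable f -> cmeasurable (fun x => f x ^+ n).
Proof.
move=> mf; elim: n => [|n IH]; first exact: cmeasurable_cst.
by under eq_fun do rewrite exprS; exact: cmeasurableM.
Qed.

Lemma measurable_invr : measurable_fun [set: R] (fun x : R => x^-1).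
Proof.
rewrite -(setvU [set 0]); apply/measurable_funU => //; first exact: measurableC.
split; last exact: measurable_fun_set1.
apply: open_continuous_measurable_fun => [|x].
  by apply: closed_openC; exact: closed_eq.
by rewrite inE /= => /eqP x0; exact: inv_continuous.
Qed.

Lemma cmeasurableV f : cmeasurable f -> cmeasurable (fun x => (f x)^-1).
Proof.
move=> [rf If].
have mn : measurable_fun setT (fun x => (normc (f x) ^+ 2)^-1).
  under eq_fun do rewrite normc_sqr.
  apply: (measurableT_comp measurable_invr).
  by apply: measurable_funD; apply: measurable_funX.
split.
  by under eq_fun do rewrite cReV; exact: measurable_funM.
under eq_fun do rewrite cImV; apply: measurable_funM => //.
exact: measurableT_comp.
Qed.

Definition cintegrable mu f :=
  mu.-integrable setT (fun x => (complex.Re (f x))%:E) /\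
  mu.-integrable setT (fun x => (complex.Im (f x))%:E).

(** Integrating the two parts separately makes [cauchy_transform mu z] convertible to a [cint]. *)
Definition cint mu f : C :=
  (\int[mu]_x complex.Re (f x)) +i* (\int[mu]_x complex.Im (f x)).

Lemma le_cintegrable mu f (h : R -> R) : cmeasurable f ->
  mu.-integrable setT (fun x => (h x)%:E) ->
  (forall x, normc (f x) <= h x) -> cintegrable mu f.
Proof.
move=> [rf If] ih fh; split; apply: le_integrable ih => //=.
- exact/measurable_EFinP.
- move=> x _; rewrite lee_fin; apply: le_trans (normc_Re _) _.
  by apply: le_trans (fh x) _; exact: ler_norm.
- exact/measurable_EFinP.
- move=> x _; rewrite lee_fin; apply: le_trans (normc_Im _) _.
  by apply: le_trans (fh x) _; exact: ler_norm.
Qed.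

Lemma integrable_cst mu (r : R) : mu.-integrable setT (fun=> r%:E).
Proof. exact: finite_measure_integrable_cst. Qed.

Lemma integrable_scale mu (r : R) (h : R -> R) :
  mu.-integrable setT (fun x => (h x)%:E) ->
  mu.-integrable setT (fun x => (r * h x)%:E).
Proof. by move=> ih; under eq_fun do rewrite EFinM; exact: integrableZl. Qed.

Lemma integrable_add mu (h k : R -> R) :
  mu.-integrable setT (fun x => (h x)%:E) ->
  mu.-integrable setT (fun x => (k x)%:E) ->
  mu.-integrable setT (fun x => (h x + k x)%:E).
Proof. by move=> ih ik; under eq_fun do rewrite EFinD; exact: integrableD. Qed.

Lemma integrable_sub mu (h k : R -> R) :
  mu.-integrable setT (fun x => (h x)%:E) ->
  mu.-integrable setT (fun x => (k x)%:E) ->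
  mu.-integrable setT (fun x => (h x - k x)%:E).
Proof. by move=> ih ik; under eq_fun do rewrite EFinB; exact: integrableB. Qed.

Lemma integrable_measurable mu (h : R -> R) :
  mu.-integrable setT (fun x => (h x)%:E) -> measurable_fun setT h.
Proof. by move=> /integrableP[mh _]; exact/measurable_EFinP. Qed.

Lemma bounded_cintegrable mu f (M : R) : cmeasurable f ->
  (forall x, normc (f x) <= M) -> cintegrable mu f.
Proof. by move=> mf fM; exact: le_cintegrable (integrable_cst mu M) fM. Qed.

Lemma eq_cint mu f g : f =1 g -> cint mu f = cint mu g.
Proof. by move=> fg; congr cint; exact/funext. Qed.

Lemma cintD mu f g : cintegrable mu f -> cintegrable mu g ->
  cint mu (fun x => f x + g x) = cint mu f + cint mu g.
Proof.
move=> [rf If] [rg Ig]; apply: complex_eq; rewrite !ReImE /=.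
  by under eq_Rintegral do rewrite cReD; rewrite RintegralD.
by under eq_Rintegral do rewrite cImD; rewrite RintegralD.
Qed.

Lemma cintZ mu f (c : C) : cintegrable mu f ->
  cint mu (fun x => c * f x) = c * cint mu f.
Proof.
move=> [rf If]; apply: complex_eq; rewrite !ReImE /=.
  under eq_Rintegral do rewrite cReM; rewrite RintegralB ?RintegralZl//.
  - exact: (@integrableZl _ _ R mu setT measurableT (complex.Re c) _ rf).
  - exact: (@integrableZl _ _ R mu setT measurableT (complex.Im c) _ If).
under eq_Rintegral do rewrite cImM; rewrite RintegralD ?RintegralZl//.
- exact: (@integrableZl _ _ R mu setT measurableT (complex.Re c) _ If).
- exact: (@integrableZl _ _ R mu setT measurableT (complex.Im c) _ rf).
Qed.

Lemma cintegrableD mu f g : cintegrable mu f -> cintegrable mu g ->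
  cintegrable mu (fun x => f x + g x).
Proof.
move=> [rf If] [rg Ig]; split.
  by under eq_fun do rewrite cReD EFinD; exact: integrableD.
by under eq_fun do rewrite cImD EFinD; exact: integrableD.
Qed.

Lemma cintegrableZ mu f (c : C) : cintegrable mu f ->
  cintegrable mu (fun x => c * f x).
Proof.
move=> [rf If]; split.
  under eq_fun do rewrite cReM EFinB !EFinM.
  by apply: integrableB => //; exact: integrableZl.
under eq_fun do rewrite cImM EFinD !EFinM.
by apply: integrableD => //; exact: integrableZl.
Qed.

Lemma cintegrableB mu f g : cintegrable mu f -> cintegrable mu g ->
  cintegrable mu (fun x => f x - g x).
Proof.
move=> fi gi; have := cintegrableD fi (cintegrableZ (-1) gi).
by under eq_fun do rewrite mulN1r.
Qed.

Lemma cintB mu f g : cintegrable mu f -> cintegrable mu g ->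
  cint mu (fun x => f x - g x) = cint mu f - cint mu g.
Proof.
move=> fi gi; rewrite -[in RHS](mulN1r (cint mu g)) -(cintZ _ gi).
rewrite -(cintD fi (cintegrableZ (-1) gi)).
by apply: eq_cint => x; rewrite mulN1r.
Qed.

Lemma Rintegral_probability_cst mu (r : R) : \int[mu]_x r = r.
Proof.
rewrite Rintegral_cst// -[RHS]mulr1; congr (_ * _).
by have /(congr1 fine) := probability_setT mu.
Qed.

Lemma cint_cst mu (c : C) : cint mu (fun=> c) = c.
Proof. by rewrite /cint !Rintegral_probability_cst; case: c. Qed.

Lemma cintegrable_real mu (h : R -> R) :
  mu.-integrable setT (fun x => (h x)%:E) -> cintegrable mu (fun x => (h x)%:C).
Proof. by move=> ih; split => //=; exact: integrable_cst. Qed.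

Lemma cint_real mu (h : R -> R) : cint mu (fun x => (h x)%:C) = (\int[mu]_x h x)%:C.
Proof. by apply: complex_eq => //=; rewrite Rintegral_probability_cst. Qed.

Lemma Im_cint mu f : complex.Im (cint mu f) = \int[mu]_x complex.Im (f x).
Proof. by []. Qed.

(* The factor 2 comes from bounding the real and imaginary parts separately. *)
Lemma normc_cint_le mu f (h : R -> R) : cintegrable mu f ->
  mu.-integrable setT (fun x => (h x)%:E) ->
  (forall x, normc (f x) <= h x) -> normc (cint mu f) <= 2 * \int[mu]_x h x.
Proof.
move=> [rf If] ih fh; apply: le_trans (normc_ReIm _) _ => /=.
rewrite mulr2n mulrDl !mul1r; apply: lerD; apply: le_trans (le_normr_Rintegral _ _) _ => //.
  apply: le_Rintegral => //; first exact: integrable_norm.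
  by move=> x _; apply: le_trans (normc_Re _) (fh x).
apply: le_Rintegral => //; first exact: integrable_norm.
by move=> x _; apply: le_trans (normc_Im _) (fh x).
Qed.

End complex_integral.

(** * Asymptotics and injectivity of the Cauchy transform in a cone *)

Section cone_asymptotics.
Context {R : realType}.
Local Notation C := R[i].
Local Notation law := (probability (measurableTypeR R) R).
Implicit Types (mu : law) (z : C).

Lemma measurable_min_abs (K : R) :
  measurable_fun [set: R] (fun x : R => Num.min (`|x| / K) 1).
Proof.
by apply: measurable_minr => //; apply: measurable_funM => //; exact: measurableT_comp.
Qed.

Lemma integrable_min_abs mu (h : R -> R) (K : R) : 0 < K ->
  mu.-integrable setT (fun x => (h x)%:E) ->
  mu.-integrable setT (fun x => (h x * Num.min (`|x| / K) 1)%:E).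
Proof.
move=> K0 ih; apply: (le_integrable _ _ _ ih) => //=.
  apply/measurable_EFinP; apply: measurable_funM; last exact: measurable_min_abs.
  exact: integrable_measurable ih.
move=> x _; rewrite lee_fin normrM ler_piMr// ger0_norm.
  by rewrite ge_min lexx orbT.
by rewrite le_min ler01 andbT divr_ge0 // ltW.
Qed.

(** Dominated convergence along integers [K], extended to real [K] by monotonicity. The weight is
    the one that controls [z / (z - x) - 1] in a cone. *)
Lemma integral_min_abs_small mu (h : R -> R) (e : R) : (forall x, 0 <= h x) ->
  mu.-integrable setT (fun x => (h x)%:E) -> 0 < e ->
  exists2 K0, 0 < K0 & forall K, K0 <= K ->
    \int[mu]_x (h x * Num.min (`|x| / K) 1) < e.
Proof.
move=> h0 ih e0.
pose f k (x : R) := (h x * Num.min (`|x| / k.+1%:R) 1)%:E.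
have mh : measurable_fun setT h := integrable_measurable ih.
have mf k : measurable_fun setT (f k).
  by apply/measurable_EFinP/measurable_funM => //; exact: measurable_min_abs.
have f0 : {ae mu, forall x, setT x -> f ^~ x @ \oo --> (cst 0%E : R -> \bar R) x}.
  apply: aeW => x _; apply/fine_cvgP; split; first by near=> k.
  rewrite /f /comp /= -[0](mulr0 (h x)); apply: cvgM; first exact: cvg_cst.
  apply: (@squeeze_cvgr _ _ _ _ (cst 0) (fun k => `|x| * k.+1%:R^-1)).
  - near=> k; rewrite le_min ler01 andbT divr_ge0 //=.
    by rewrite ge_min lexx.
  - exact: cvg_cst.
  - rewrite -[X in _ --> X](mulr0 `|x|); apply: cvgM; first exact: cvg_cst.
    exact: cvg_harmonic.
have fh : {ae mu, forall x n, setT x -> (`|f n x| <= (h x)%:E)%E}.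
  apply: aeW => x n _; rewrite /f /= lee_fin.
  have m0 : 0 <= Num.min (`|x| / n.+1%:R) 1 by rewrite le_min ler01 andbT divr_ge0.
  by rewrite ger0_norm ?mulr_ge0// ler_piMr// ge_min lexx orbT.
have [_ _] := @dominated_convergence _ (measurableTypeR R) R mu _ measurableT _ _ _ mf
  (measurable_cst 0%E) f0 ih fh.
rewrite integral0 => /fine_cvgP[_] /cvgrPdist_lt/(_ _ e0)[N _ /(_ N (leqnn N))] /=.
rewrite sub0r normrN => lte; exists N.+1%:R => // K NK.
have K0 : 0 < K by exact: lt_le_trans NK.
apply: le_lt_trans (le_lt_trans (ler_norm _) lte).
apply: le_Rintegral => //; try exact: integrable_min_abs.
move=> x _; apply: ler_wpM2l => //; rewrite le_min !ge_min lexx orbT andbT.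
by apply/orP; left; apply: ler_wpM2l => //; rewrite lef_pV2 ?posrE.
Unshelve. all: by end_near. Qed.

(** An aperture condition like that of [Gamma], but in a form that survives small relative
    perturbations of [z] at the price of a smaller [k]. *)
Definition cone (k : R) : set C := [set z | z != 0 /\ k * normc z <= complex.Im z].

Lemma cone_upper k z : 0 < k -> cone k z -> 0 < complex.Im z.
Proof.
by move=> k0 [z0]; apply: lt_le_trans; rewrite mulr_gt0// normc_gt0.
Qed.

Lemma cone_ratio_le k z (x : R) : 0 < k -> cone k z ->
  normc (z / (z - x%:C)) <= k^-1.
Proof.
move=> k0 zk; have z0 := cone_upper k0 zk; case: zk => zn0 zk.
have d0 : 0 < normc (z - x%:C) by rewrite normc_gt0 upper_sub_neq0.
rewrite normcM normcV ler_pdivrMr// -ler_pdivrMl ?invrK ?invr_gt0//.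
by rewrite (le_trans zk)// normc_sub_real_ge.
Qed.

Lemma cone_ratio_sub1 k z (x : R) : 0 < k -> cone k z ->
  normc (z / (z - x%:C) - 1) <= (k^-1 + 1) * Num.min (`|x| / normc z) 1.
Proof.
move=> k0 zk; have z0 := cone_upper k0 zk; have zk' := zk; case: zk' => zn0 _.
have k1 : 0 < k^-1 by rewrite invr_gt0.
rewrite (minr_pMr _ _ (ltW (addr_gt0 k1 ltr01))) le_min; apply/andP; split; last first.
  by rewrite mulr1 (le_trans (normcB _ _))// normc1 lerD2r cone_ratio_le.
have -> : z / (z - x%:C) - 1 = z / (z - x%:C) * (x%:C / z).
  by field; rewrite zn0 upper_sub_neq0.
rewrite normcM (normcM x%:C) normcV normc_real; apply: ler_wpM2r.
  by rewrite divr_ge0 ?normc_ge0.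
by apply: le_trans (cone_ratio_le x k0 zk) _; rewrite lerDl.
Qed.

Lemma cmeasurable_resolvent z : cmeasurable (fun x : R => (z - x%:C)^-1).
Proof.
apply/cmeasurableV/cmeasurableB; first exact: cmeasurable_cst.
exact/cmeasurable_real/measurable_id.
Qed.

Lemma cintegrable_ratio mu (h : R -> R) z : 0 < complex.Im z ->
  mu.-integrable setT (fun x => (h x)%:E) ->
  cintegrable mu (fun x => (h x)%:C * (z / (z - x%:C))).
Proof.
move=> z0 ih.
have mh : measurable_fun setT h := integrable_measurable ih.
apply: (@le_cintegrable _ _ _ (fun x => (normc z / complex.Im z) * `|h x|)).
- apply: cmeasurableM; first exact: cmeasurable_real.
  by apply: cmeasurableM; [exact: cmeasurable_cst|exact: cmeasurable_resolvent].
- exact/integrable_scale/integrable_norm.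
- move=> x; rewrite normcM normc_real mulrC ler_wpM2r// normcM normcV.
  rewrite ler_wpM2l ?normc_ge0// lef_pV2 ?posrE ?normc_sub_real_ge//.
  by rewrite normc_gt0 upper_sub_neq0.
Qed.

(** In a cone the kernel [z / (z - x)] is bounded by [k^-1] uniformly in [x], so integrability of
    [h] alone suffices. With [h] a power of [x], this reads moments off the Cauchy transform. *)
Lemma cone_cvg mu (h : R -> R) (k e : R) :
  mu.-integrable setT (fun x => (h x)%:E) -> 0 < k -> 0 < e ->
  exists2 K, 0 < K & forall z, cone k z -> K <= normc z ->
    normc (cint mu (fun x => (h x)%:C * (z / (z - x%:C))) - (\int[mu]_x h x)%:C) < e.
Proof.
move=> ih k0 e0.
have inh : mu.-integrable setT (fun x => `|h x|%:E) by exact: integrable_norm.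
pose D := 2 * (k^-1 + 1).
have D0 : 0 < D by rewrite mulr_gt0// addr_gt0// invr_gt0.
have [|K K0 HK] := integral_min_abs_small (fun x => normr_ge0 (h x)) inh (e := e / D).
  by rewrite divr_gt0.
exists K => // z zk Kz; have z0 := cone_upper k0 zk.
have zn : 0 < normc z by exact: lt_le_trans K0 _.
rewrite -cint_real -cintB; last 2 first.
- exact: cintegrable_ratio.
- exact: cintegrable_real.
have i1 := cintegrable_ratio z0 ih; have i2 := cintegrable_real ih.
apply: le_lt_trans (normc_cint_le (cintegrableB i1 i2)
   (h := fun x => (k^-1 + 1) * (`|h x| * Num.min (`|x| / normc z) 1)) _ _) _.
- exact/integrable_scale/integrable_min_abs.
- move=> x; rewrite -{2}[(h x)%:C]mulr1 -mulrBr normcM normc_real mulrCA.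
  by rewrite ler_wpM2l// cone_ratio_sub1.
- rewrite RintegralZl//; last exact: integrable_min_abs.
  by rewrite mulrA -ltr_pdivlMl// mulrC HK.
Qed.

Lemma cauchyE mu z : cauchy_transform mu z = cint mu (fun x => (z - x%:C)^-1).
Proof. by []. Qed.

Lemma resolvent_le z (x : R) : 0 < complex.Im z ->
  normc (z - x%:C)^-1 <= (complex.Im z)^-1.
Proof.
move=> z0; rewrite normcV lef_pV2 ?posrE ?normc_sub_real_ge//.
by rewrite normc_gt0 upper_sub_neq0.
Qed.

Lemma cintegrable_resolvent mu z : 0 < complex.Im z ->
  cintegrable mu (fun x => (z - x%:C)^-1).
Proof.
move=> z0; apply: (@bounded_cintegrable _ _ _ (complex.Im z)^-1).
  exact: cmeasurable_resolvent.
by move=> x; exact: resolvent_le.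
Qed.

Lemma cauchy_cone mu (k e : R) : 0 < k -> 0 < e ->
  exists2 K, 0 < K & forall z, cone k z -> K <= normc z ->
    normc (z * cauchy_transform mu z - 1) < e.
Proof.
move=> k0 e0; have [K K0 HK] := cone_cvg (integrable_cst mu 1) k0 e0.
exists K => // z zk Kz; have := HK z zk Kz.
rewrite Rintegral_probability_cst cauchyE -cintZ//.
  by congr (normc (_ - _) < e); apply: eq_cint => x; rewrite mul1r.
exact/cintegrable_resolvent/(cone_upper k0 zk).
Qed.

(* [G z - G z' = (z' - z) \int 1 / ((z - x) (z' - x))], and the integral is
   asymptotic to [1 / (z z')] inside a cone. *)
Lemma cauchy_inj_cone mu (k : R) : 0 < k ->
  exists2 K, 0 < K & forall z z', cone k z -> cone k z' ->
    K <= normc z -> K <= normc z' ->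
    cauchy_transform mu z = cauchy_transform mu z' -> z = z'.
Proof.
move=> k0; pose D := k^-1 + 1.
have k1 : 0 < k^-1 by rewrite invr_gt0.
have D0 : 0 < D by rewrite addr_gt0.
(* Two error terms, each weighted by [D ^+ 2], and the factor 2 of [normc_cint_le]: with this
   threshold the total stays below 1. *)
have [|||K K0 HK] := integral_min_abs_small (mu := mu) (h := cst 1) (e := (4 * D ^+ 2)^-1).
- by move=> ?; exact: ler01.
- exact: integrable_cst.
- by rewrite invr_gt0 mulr_gt0// exprn_gt0.
exists K => // z z' zk zk' Kz Kz' GG.
have z0 := cone_upper k0 zk; have z0' := cone_upper k0 zk'.
have [zn0 _] := zk; have [zn0' _] := zk'.
pose a x : C := z / (z - x%:C); pose a' x : C := z' / (z' - x%:C).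
have ma w : cmeasurable (fun x : R => w / (w - x%:C)).
  by apply: cmeasurableM; [exact: cmeasurable_cst|exact: cmeasurable_resolvent].
have ia : cintegrable mu (fun x => a x * a' x).
  apply: (@bounded_cintegrable _ _ _ (k^-1 * k^-1)).
    by apply: cmeasurableM; exact: ma.
  move=> x; rewrite normcM ler_pM ?normc_ge0//; exact: cone_ratio_le.
have key : (z' - z) * cint mu (fun x => a x * a' x) = 0.
  rewrite -[RHS](mulr0 (z * z')) -[X in _ = _ * X](subrr (cauchy_transform mu z)).
  rewrite {2}GG !cauchyE -cintB; last 2 first.
  - exact: cintegrable_resolvent.
  - exact: cintegrable_resolvent.
  rewrite -!cintZ//; last by apply: cintegrableB; exact: cintegrable_resolvent.
  apply: eq_cint => x; rewrite /a /a'; field.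
  by rewrite !upper_sub_neq0.
apply/eqP; rewrite eq_sym -subr_eq0; apply/eqP.
move/eqP: key; rewrite mulf_eq0 => /orP[/eqP//|/eqP I0].
have i1 : cintegrable mu (fun=> 1) := cintegrable_real (integrable_cst mu 1).
have : normc (cint mu (fun x => a x * a' x) - cint mu (fun=> 1)) < 1.
  rewrite -cintB//.
  have im w : cone k w -> K <= normc w ->
    mu.-integrable setT (fun x => (1 * Num.min (`|x| / normc w) 1)%:E).
    move=> wk Kw; apply: integrable_min_abs; first exact: lt_le_trans K0 Kw.
    exact: integrable_cst.
  apply: le_lt_trans (normc_cint_le (cintegrableB ia i1)
    (h := fun x => D ^+ 2 * (1 * Num.min (`|x| / normc z) 1) +
                   D ^+ 2 * (1 * Num.min (`|x| / normc z') 1)) _ _) _.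
  - by apply: integrable_add; exact/integrable_scale/im.
  - move=> x.
    have -> : a x * a' x - 1 = (a x - 1) * a' x + (a' x - 1) by ring.
    have b1 := cone_ratio_sub1 x k0 zk; have b2 := cone_ratio_sub1 x k0 zk'.
    have b3 := cone_ratio_le x k0 zk'.
    rewrite -/(a x) -/D in b1; rewrite -/(a' x) -/D in b2 b3.
    apply: le_trans (normcD _ _) _; rewrite normcM !mul1r; apply: lerD.
      apply: le_trans (ler_pM _ _ b1 b3) _; rewrite ?normc_ge0//.
      rewrite expr2 mulrAC; apply: ler_wpM2r.
        by rewrite le_min ler01 andbT divr_ge0 ?normc_ge0.
      by apply: ler_wpM2l; [exact: ltW|rewrite /D lerDl].
    apply: le_trans b2 _; apply: ler_wpM2r.
      by rewrite le_min ler01 andbT divr_ge0 ?normc_ge0.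
    by rewrite expr2 ler_peMr ?(ltW D0)// /D lerDr ltW.
  - have HK1 := HK _ Kz; have HK2 := HK _ Kz'.
    rewrite RintegralD//; last 2 first.
    + exact/integrable_scale/im.
    + exact/integrable_scale/im.
    rewrite (RintegralZl _ measurableT (im _ zk Kz)).
    rewrite (RintegralZl _ measurableT (im _ zk' Kz')).
    rewrite -mulrDr mulrA -ltr_pdivlMl ?mulr_gt0 ?exprn_gt0// mulr1.
    have -> : (2 * D ^+ 2)^-1 = (4 * D ^+ 2)^-1 + (4 * D ^+ 2)^-1.
      by field; rewrite gt_eqF.
    by apply: ltrD.
by rewrite I0 cint_cst sub0r normcN normc1 ltxx.
Qed.

End cone_asymptotics.

(** * Right inverses of [F] and division of the Voiculescu transform by [n] *)

Section right_inverses.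
Context {R : realType}.
Local Notation C := R[i].
Local Notation law := (probability (measurableTypeR R) R).
Implicit Types (mu nu rho : law) (z : C).

Lemma cone_le (k k' : R) z : k' <= k -> cone k z -> cone k' z.
Proof.
move=> kk' [z0 zk]; split=> //; apply: le_trans zk.
by rewrite ler_wpM2r// normc_ge0.
Qed.

Lemma Gamma_le (eta eta' M M' : R) z : eta' <= eta -> M <= M' ->
  Gamma eta' M' z -> Gamma eta M z.
Proof.
move=> ee MM [z0 Re_z Mz]; split=> //.
  by apply: lt_le_trans Re_z _; rewrite ler_wpM2r// ltW.
by apply: le_lt_trans Mz; rewrite lecR.
Qed.

(** [|Re z| < eta Im z] gives [Im z >= k |z|] with [k = 1 / (1 + eta)]. A relative error below
    [k / 2] then leaves [Im (H z) >= (k / 2) |z|] and [|z| / 2 <= |H z| <= (3 / 2) |z|], whence the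
    aperture [k / 4] and the threshold [2 * K]. *)
Lemma right_inverse_cone mu (eta M : R) (H : C -> C) : 0 < eta ->
  is_right_inverse_F mu eta M H ->
  exists2 k, 0 < k & forall K, exists K', forall z, Gamma eta M z ->
    K' < normc z -> cone k (H z) /\ K <= normc (H z).
Proof.
move=> eta0 [_ _ _ Hz1]; pose k := (1 + eta)^-1.
have e1 : 0 < 1 + eta by rewrite addr_gt0.
have k0 : 0 < k by rewrite invr_gt0.
have k1 : k <= 1 by rewrite invf_le1// lerDl ltW.
have k2 : 0 < k / 2 by rewrite divr_gt0.
have [K1 HK1] := Hz1 _ k2.
exists (k / 4) => [|K]; first by rewrite divr_gt0.
exists (Num.max (Num.max K1 (2 * K)) 0) => z Gz; rewrite !gt_max => /andP[/andP[K1z Kz] z0].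
have {HK1} := HK1 z Gz; rewrite lt_normc normc_lt => /(_ K1z) Hz.
have zn0 : z != 0 by rewrite -normc_gt0.
have [Im0 Re_z _] := Gz; rewrite /upper_half_plane /= in Im0.
have kz : k * normc z <= complex.Im z.
  rewrite ler_pdivrMl//; apply: le_trans (normc_ReIm _) _.
  by rewrite (gtr0_norm Im0); nra.
have dz : normc (H z - z) <= k / 2 * normc z.
  have -> : H z - z = (H z / z - 1) * z by rewrite mulrBl mul1r divfK.
  by rewrite normcM ler_wpM2r// ltW.
have /ler_normlP[_ dI] := normc_Im (H z - z).
rewrite !ReImE in dI.
have l1 := normc_lb z (H z); rewrite normc_sub in l1.
have l2 := normcD (H z - z) z; rewrite subrK in l2.
have /ler_normlP[dI' _] := normc_Im (H z - z); rewrite !ReImE in dI'.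
have Hz0 : 0 < normc (H z) by nra.
by split; [split; [rewrite -normc_gt0|nra]|nra].
Qed.

Lemma F_transform_inj mu z w : F_transform mu z = F_transform mu w ->
  cauchy_transform mu z = cauchy_transform mu w.
Proof. exact: invr_inj. Qed.

(** Both values lie far out in a common cone, where [cauchy_inj_cone] makes [F] injective. It is the
    asymptotic clause of [is_right_inverse_F] that puts them there. *)
Lemma right_inverse_unique mu (eta M eta' M' : R) (H H' : C -> C) :
  0 < eta -> 0 < eta' ->
  is_right_inverse_F mu eta M H -> is_right_inverse_F mu eta' M' H' ->
  exists K, forall z, Gamma eta M z -> Gamma eta' M' z -> K < normc z -> H z = H' z.
Proof.
move=> e0 e0' rH rH'.
have [k k0 Hk] := right_inverse_cone e0 rH.
have [k' k0' Hk'] := right_inverse_cone e0' rH'.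
have m0 : 0 < Num.min k k' by rewrite lt_min k0.
have [K K0 inj] := cauchy_inj_cone mu m0.
have [K1 HK1] := Hk K; have [K2 HK2] := Hk' K.
exists (Num.max K1 K2) => z Gz Gz'; rewrite gt_max => /andP[Kz1 Kz2].
have [c1 n1] := HK1 z Gz Kz1; have [c2 n2] := HK2 z Gz' Kz2.
apply: inj => //.
- by apply: cone_le c1; rewrite ge_min lexx.
- by apply: cone_le c2; rewrite ge_min lexx orbT.
- apply: F_transform_inj.
  by have [_ -> // _ _] := rH; have [_ -> //] := rH'.
Qed.

Lemma eq_cauchy_transform mu nu : (forall A, measurable A -> mu A = nu A) ->
  cauchy_transform mu = cauchy_transform nu.
Proof.
move=> mn; apply/funext => z; apply: complex_eq; rewrite /cauchy_transform /=.
  by congr fine; apply: eq_measure_integral => A mA _; exact: mn.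
by congr fine; apply: eq_measure_integral => A mA _; exact: mn.
Qed.

Lemma eq_right_inverse mu nu (eta M : R) (H : C -> C) :
  (forall A, measurable A -> mu A = nu A) ->
  is_right_inverse_F mu eta M H -> is_right_inverse_F nu eta M H.
Proof.
move=> /eq_cauchy_transform mn [? HF ? ?]; split=> // z Gz.
by rewrite -[RHS](HF z Gz) /F_transform mn.
Qed.

(** Each [is_free_conv] brings its own cone and its own right inverses; [right_inverse_unique]
    identifies them far out, and the cone shrinks at every convolution. *)
Lemma free_power_right_inverse rho n nu : is_free_power rho n nu ->
  forall eta M H Hr, 0 < eta -> is_right_inverse_F nu eta M H ->
  is_right_inverse_F rho eta M Hr ->
  exists eta0 K, [/\ 0 < eta0, eta0 <= eta, M <= K &
    forall z, Gamma eta0 K z -> H z - z = n%:R * (Hr z - z)].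
Proof.
elim=> [{}nu nuE|{}n {}nu nu' pw IH convE] eta M H Hr eta0 rH rHr.
  have [K HK] := right_inverse_unique eta0 eta0 (eq_right_inverse nuE rH) rHr.
  exists eta, (Num.max M K); split=> //; first by rewrite le_max lexx.
  move=> z Gz; rewrite mul1r HK//; [| |case: Gz => _ _].
  - by apply: Gamma_le Gz; rewrite ?le_max lexx.
  - by apply: Gamma_le Gz; rewrite ?le_max lexx.
  - by rewrite lt_normc gt_max => /andP[].
case: convE => eta1 [M1 [phi1 [phi2 [e10 _ [H1 rH1 p1] [H2 rH2 p2] [H3 rH3 p3]]]]].
have [eta2 [M2 [e20 e21 M12 E12]]] := IH _ _ _ _ e10 rH1 rH2.
have [K3 HK3] := right_inverse_unique eta0 e10 rH rH3.
have [K4 HK4] := right_inverse_unique eta0 e10 rHr rH2.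
exists (Num.min eta eta2), (Num.max (Num.max M M2) (Num.max K3 K4)); split.
- by rewrite lt_min eta0.
- by rewrite ge_min lexx.
- by rewrite !le_max lexx.
move=> z Gz.
have G1 : Gamma eta M z by apply: Gamma_le Gz; rewrite ?ge_min ?le_max lexx.
have G2 : Gamma eta2 M2 z.
  by apply: Gamma_le Gz; rewrite ?ge_min ?le_max lexx ?orbT.
have G3 : Gamma eta1 M1 z by apply: Gamma_le G2.
have : Num.max (Num.max M M2) (Num.max K3 K4) < normc z.
  by case: Gz => _ _; rewrite lt_normc.
rewrite !gt_max => /andP[_ /andP[z3 z4]].
rewrite HK3// HK4// -p3// p1// p2// E12//.
by rewrite -[n.+1%:R]natr1; ring.
Qed.

Lemma F_transform_ray mu (eta K : R) : 0 < eta -> exists2 Y, 0 < Y &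
  forall y, Y < y -> Gamma eta K (F_transform mu (0 +i* y)).
Proof.
(* [F (i y) = i y (1 + d)] with [|d| <= 2 e]. The bound [1 / 4] keeps [Re (1 + d) >= 1 / 2], and
   [eta / 8] makes [|Re F| <= eta y / 4], less than [eta Im F]. *)
move=> eta0; pose e := Num.min (1 / 4) (eta / 8).
have e0 : 0 < e by rewrite lt_min !divr_gt0.
have e14 : e <= 1 / 4 by rewrite ge_min lexx.
have ee : e <= eta / 8 by rewrite ge_min lexx orbT.
have [Y Y0 HY] := cauchy_cone mu (@ltr01 R) e0.
exists (Num.max Y (2 * `|K|)) => [|y]; first by rewrite lt_max Y0.
rewrite gt_max => /andP[Yy Ky].
have y0 : 0 < y by exact: lt_trans Yy.
have ny : normc (0 +i* y) = y by rewrite /= expr0n add0r sqrtr_sqr gtr0_norm.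
have w0 : 0 +i* y != 0 by rewrite -normc_gt0 ny.
have := HY (0 +i* y); rewrite ny => /(_ _ (ltW Yy)) => /(_ (conj w0 _)).
rewrite ny mul1r => /(_ (lexx _)).
set q := _ * _ => q1.
have qn : 3 / 4 <= normc q.
  by have := normc_lb 1 q; rewrite normc1 normc_sub; lra.
have q0 : q != 0 by rewrite -normc_gt0; lra.
pose d := q^-1 - 1.
have dn : normc d <= 2 * e.
  have -> : d = (1 - q) / q by rewrite /d; field.
  rewrite normcM normcV normc_sub ler_pdivrMr ?normc_gt0//.
  by nra.
have FE : F_transform mu (0 +i* y) = (0 +i* y) * (1 + d).
  have -> : (0 +i* y) * (1 + d) = (0 +i* y) / q by rewrite /d addrC subrK.
  by rewrite /F_transform /q invfM mulVKf.
have /ler_normlP[d1 d2] := le_trans (normc_Re d) dn.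
have d3 := le_trans (normc_Im d) dn.
have ImF : complex.Im (F_transform mu (0 +i* y)) = y * (1 + complex.Re d).
  by rewrite FE !ReImE /=; ring.
have ReF : complex.Re (F_transform mu (0 +i* y)) = - y * complex.Im d.
  by rewrite FE !ReImE /=; ring.
split.
- have : 0 < complex.Im (F_transform mu (0 +i* y)) by rewrite ImF; nra.
  by [].
- rewrite ReF ImF normrM normrN (gtr0_norm y0).
  apply: (@le_lt_trans _ _ (y * (2 * e))); first by rewrite ler_wpM2l// ltW.
  rewrite (mulrCA eta) ltr_pM2l//.
  have h : 1 / 2 <= 1 + complex.Re d by lra.
  have := ler_wpM2l (ltW eta0) h; lra.
- rewrite lt_normc; apply: lt_le_trans (le_trans (ler_norm _) (normc_Im _)).
  rewrite ImF; have := ler_norm K; have h : 1 / 2 <= 1 + complex.Re d by lra.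
  by have := ler_wpM2l (ltW y0) h; lra.
Qed.

(* At [z = F mu w] the right inverse of [mu] returns [w], so dividing the
   Voiculescu transform by [n] moves [z] to the convex combination
   [z + (w - z) / n]. *)
Lemma free_power_ray rho n mu : (1 < n)%N -> is_free_power rho n mu ->
  exists Y, forall y, Y < y ->
    let w := 0 +i* y in let z := F_transform mu w in
    cauchy_transform rho (z + n%:R^-1 * (w - z)) = cauchy_transform mu w.
Proof.
(* For [1 < n] the last constructor is [free_powerS], whose witnesses include right inverses for
   [rho] and for [mu]; [free_power1] would supply none. *)
move=> n1 pw; move: n1 (pw); case: pw => // {}n nu {}mu _.
case=> eta [M [phi1 [phi2 [eta0 _ _ [Hr rHr _] [H rH _]]]]] n1 pw'.
have [eta1 [K1 [e10 e11 MK1 E]]] := free_power_right_inverse pw' eta0 rH rHr.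
have [k k0 Hk] := right_inverse_cone eta0 rH.
have m0 : 0 < Num.min k 1 by rewrite lt_min k0 ltr01.
have [K K0 inj] := cauchy_inj_cone mu m0.
have [K2 HK2] := Hk K.
have [Y Y0 HY] := F_transform_ray mu (Num.max K1 K2) e10.
exists (Num.max Y K) => y; rewrite gt_max => /andP[Yy Ky].
set w := _ +i* y; set z := F_transform mu w => /=.
have y0 : 0 < y by exact: lt_trans Yy.
have ny : normc w = y by rewrite /= expr0n add0r sqrtr_sqr gtr0_norm.
have Gz := HY y Yy; rewrite -/w -/z in Gz.
have G1 : Gamma eta1 K1 z by apply: Gamma_le Gz; rewrite ?le_max lexx.
have G2 : Gamma eta M z by apply: Gamma_le G1.
have zK2 : K2 < normc z.
  by case: Gz => _ _; rewrite lt_normc gt_max => /andP[].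
(* [H z] and [w] have the same image [z] under [F] and both lie far out in one cone, the imaginary
   axis having aperture 1. *)
have Hzw : H z = w.
  have [c1 n2] := HK2 z G2 zK2; apply: inj => //.
  - by apply: cone_le c1; rewrite ge_min lexx.
  - split; first by rewrite -normc_gt0 ny.
    by rewrite ny -[complex.Im w]/y ler_piMl ?ge_min ?lexx ?orbT// ltW.
  - by rewrite ny ltW.
  - by apply: F_transform_inj; have [_ -> //] := rH.
have n0 : n.+1%:R != 0 :> C by rewrite pnatr_eq0.
have := E z G1; rewrite Hzw => Ez.
have -> : z + n.+1%:R^-1 * (w - z) = Hr z by rewrite Ez mulKf// addrC subrK.
by apply: invr_inj; have [_ FH _ _] := rHr; rewrite -[LHS]/(F_transform _ _) FH.
Qed.

End right_inverses.

(** * Majorant norms of complex polynomials *)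

Section weighted_norm.
Context {R : realType}.
Local Notation C := R[i].
Implicit Types (P Q : {poly C}) (s t : R).

(** The weighted l^1 norm: the sum of [|P_k| s ^ k], a submultiplicative norm that dominates the sup
    norm on the disc of radius [s]. *)
Definition wnorm s P : R := (map_poly (@normc R) P).[s].

Lemma coef_normc P k : (map_poly (@normc R) P)`_k = normc P`_k.
Proof. by rewrite coef_map_id0// normc0. Qed.

Lemma le_horner (p q : {poly R}) s : 0 <= s -> (forall k, p`_k <= q`_k) ->
  p.[s] <= q.[s].
Proof.
move=> s0 pq; rewrite (@horner_coef_wide _ (maxn (size p) (size q)) p) ?leq_maxl//.
rewrite (@horner_coef_wide _ (maxn (size p) (size q)) q) ?leq_maxr//.
by apply: ler_sum => k _; rewrite ler_wpM2r// exprn_ge0.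
Qed.

Lemma wnorm_ge0 s P : 0 <= s -> 0 <= wnorm s P.
Proof.
move=> s0; rewrite -(horner0 s); apply: le_horner => // k.
by rewrite coef0 coef_normc normc_ge0.
Qed.

Lemma wnorm_le s t P : 0 <= s -> s <= t -> wnorm s P <= wnorm t P.
Proof.
move=> s0 st; rewrite /wnorm !horner_coef; apply: ler_sum => k _.
rewrite coef_normc ler_wpM2l ?normc_ge0//.
by apply: lerXn2r; rewrite ?nnegrE// (le_trans s0).
Qed.

Lemma wnormD s P Q : 0 <= s -> wnorm s (P + Q) <= wnorm s P + wnorm s Q.
Proof.
move=> s0; rewrite /wnorm -hornerD; apply: le_horner => // k.
by rewrite coefD !coef_normc coefD normcD.
Qed.

Lemma wnormM s P Q : 0 <= s -> wnorm s (P * Q) <= wnorm s P * wnorm s Q.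
Proof.
move=> s0; rewrite /wnorm -hornerM; apply: le_horner => // k.
rewrite coef_normc !coefM.
under [leRHS]eq_bigr do rewrite !coef_normc -normcM.
elim/big_ind2 : _ => [|x a y b xa yb|//]; first by rewrite normc0.
by apply: le_trans (normcD _ _) _; exact: lerD.
Qed.

Lemma wnormC s (c : C) : wnorm s c%:P = normc c.
Proof.
rewrite /wnorm (_ : map_poly _ _ = (normc c)%:P) ?hornerC//.
by apply/polyP => k; rewrite coef_normc !coefC; case: eqP => // _; rewrite normc0.
Qed.

Lemma wnormMXn s P n : wnorm s (P * 'X^n) = wnorm s P * s ^+ n.
Proof.
rewrite /wnorm (_ : map_poly _ _ = map_poly (@normc R) P * 'X^n).
  by rewrite hornerM hornerXn.
apply/polyP => k.
by rewrite coef_normc !coefMXn; case: ifP => _; rewrite ?normc0// coef_normc.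
Qed.

Lemma wnorm_horner s P (h : C) : normc h <= s -> normc P.[h] <= wnorm s P.
Proof.
move=> hs; apply: le_trans (wnorm_le P (normc_ge0 h) hs).
rewrite /wnorm (@horner_coef_wide _ (size P) (map_poly _ _)) ?size_poly//.
rewrite horner_coef; elim/big_ind2 : _ => [|x a y b xa yb|i _]; first by rewrite normc0.
  by apply: le_trans (normcD _ _) _; exact: lerD.
by rewrite coef_normc normcM normcX.
Qed.

Lemma wnorm_comp s t P Q : 0 <= s -> wnorm s P <= t ->
  wnorm s (Q \Po P) <= wnorm t Q.
Proof.
move=> s0 Pt; have t0 : 0 <= t := le_trans (wnorm_ge0 P s0) Pt.
rewrite comp_polyE {2}/wnorm.
rewrite (@horner_coef_wide _ (size Q) (map_poly _ _)) ?size_poly//.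
elim/big_ind2 : _ => [|x a y b xa yb|i _].
- by rewrite -polyC0 wnormC normc0.
- by apply: le_trans (wnormD _ _ s0) _; exact: lerD.
- rewrite coef_normc -mul_polyC; apply: le_trans (wnormM _ _ s0) _.
  rewrite wnormC ler_wpM2l ?normc_ge0//.
  elim: (nat_of_ord i) => [|k IH]; first by rewrite !expr0 -polyC1 wnormC normc1.
  by rewrite !exprS; apply: le_trans (wnormM _ _ s0) _; rewrite ler_pM ?wnorm_ge0.
Qed.

(** A Schwarz lemma for majorants: without constant term, every surviving [s ^ k] is at most
    [(s / t) t ^ k]. *)
Lemma wnorm_contract s t P : 0 <= s -> s <= t -> 0 < t -> P`_0 = 0 ->
  wnorm s P <= s / t * wnorm t P.
Proof.
move=> s0 st t0 P0; rewrite /wnorm !horner_coef mulr_sumr; apply: ler_sum => -[[|k] i] _ /=.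
  by rewrite coef_normc P0 normc0 !mul0r mulr0.
rewrite mulrCA coef_normc ler_wpM2l ?normc_ge0// !exprS mulrA divfK ?gt_eqF//.
by rewrite ler_wpM2l// lerXn2r// ?nnegrE// ltW.
Qed.

Lemma wnorm_tail s P N (h : C) : 0 < s -> normc h <= s ->
  normc (P.[h] - (take_poly N P).[h]) <= wnorm s P * (normc h / s) ^+ N.
Proof.
move=> s0 hs; rewrite -{1}(poly_take_drop N P) hornerD addrAC subrr add0r.
rewrite hornerM hornerXn normcM normcX expr_div_n mulrCA mulrC.
rewrite ler_wpM2l ?exprn_ge0 ?normc_ge0// ler_pdivlMr ?exprn_gt0//.
apply: (@le_trans _ _ (wnorm s (drop_poly N P) * s ^+ N)).
  by rewrite ler_wpM2r ?exprn_ge0 ?(ltW s0)// wnorm_horner.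
rewrite -wnormMXn; apply: le_horner => [|k]; first exact: ltW.
rewrite !coef_normc coefMXn coef_drop_poly; case: ltnP => kN.
  by rewrite normc0 normc_ge0.
by rewrite subnK.
Qed.

(** Letting [x] tend to 0 kills the constant coefficient; dividing by ['X] then lowers [N] by one
    and keeps a bound of the same form, with [K / |u|] for [K]. *)
Lemma poly_vanish N P (u : C) (K x0 : R) : u != 0 -> 0 < x0 -> 0 <= K ->
  (size P <= N)%N ->
  (forall x, 0 < x -> x < x0 -> normc P.[x%:C * u] <= K * x ^+ N) -> P = 0.
Proof.
move=> u0; elim: N P K x0 => [|N IH] P K x0 x00 K0 sP HP.
  by apply/eqP; rewrite -size_poly_eq0 -leqn0.
pose D := drop_poly 1 P; pose B := wnorm (normc u) D.
have nu : 0 < normc u by rewrite normc_gt0.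
have B0 : 0 <= B by rewrite wnorm_ge0 ?ltW.
have PE : P = (P`_0)%:P + D * 'X.
  rewrite -{1}(poly_take_drop 1 P) expr1; congr (_ + _); apply/polyP => k.
  by rewrite coef_take_poly coefC; case: k.
have PxE x : P.[x%:C * u] = P`_0 + D.[x%:C * u] * (x%:C * u).
  by rewrite {1}PE hornerD hornerC hornerMX.
have P0 : P`_0 = 0.
  apply: eq0_normc; apply/eqP; rewrite eq_le normc_ge0 andbT.
  apply/ler_addgt0Pr => e e0; rewrite add0r.
  pose L := K + B * normc u + 1.
  have L0 : 0 < L by rewrite ltr_wpDl// addr_ge0// mulr_ge0// ltW.
  pose x := Num.min (Num.min 1 (x0 / 2)) (e / L).
  have x_gt0 : 0 < x by rewrite !lt_min ltr01 !divr_gt0.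
  have x1 : x <= 1 by rewrite !ge_min lexx.
  have xx0 : x < x0.
    by apply: (@le_lt_trans _ _ (x0 / 2)); rewrite ?ge_min ?lexx ?orbT//; lra.
  have xe : x * L <= e by rewrite -ler_pdivlMr// ge_min lexx orbT.
  have nxu : normc (x%:C * u) = x * normc u by rewrite normcM normc_real gtr0_norm.
  have -> : P`_0 = P.[x%:C * u] - D.[x%:C * u] * (x%:C * u) by rewrite PxE addrK.
  apply: le_trans (normcB _ _) _; apply: le_trans xe.
  rewrite /L mulrDr mulrDr mulr1.
  have h1 : normc P.[x%:C * u] <= x * K.
    apply: le_trans (HP x x_gt0 xx0) _; rewrite mulrC ler_wpM2r//.
    by rewrite exprS ler_piMr ?exprn_ile1 ?(ltW x_gt0).
  have h2 : normc (D.[x%:C * u] * (x%:C * u)) <= x * (B * normc u).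
    rewrite normcM nxu mulrCA ler_wpM2l ?(ltW x_gt0)// ler_wpM2r ?(ltW nu)//.
    by rewrite wnorm_horner// nxu ler_piMl// ltW.
  by lra.
rewrite PE P0 add0r.
suff -> : D = 0 by rewrite mul0r.
apply: (IH D (K / normc u) x0) => //; first by rewrite divr_ge0// ltW.
  by rewrite size_drop_poly leq_subLR.
move=> x x_gt0 xx0; have := HP x x_gt0 xx0.
rewrite PxE P0 add0r normcM (normcM x%:C) normc_real gtr0_norm// exprS.
have -> : K * (x * x ^+ N) = (K / normc u * x ^+ N) * (x * normc u).
  by field; rewrite gt_eqF.
by rewrite ler_pM2r// mulr_gt0.
Qed.

End weighted_norm.

(** * Analytic functions through polynomial approximation; identity theorem along segments *)

Section analytic.
Context {R : realType}.
Local Notation C := R[i].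
Local Notation law := (probability (measurableTypeR R) R).
Implicit Types (f g : C -> C) (z : C).

(* Convergence of the power series of [f] at [z0], phrased through polynomial
   approximations with bounded weighted norm, so that no coefficient sequence
   has to be named; this form is stable under composition. *)
Definition approximable f z0 (s K : R) := forall N, exists P : {poly C},
  wnorm s P <= K /\
  forall h, normc h <= s -> normc (f (z0 + h) - P.[h]) <= K * (normc h / s) ^+ N.

Definition analytic_at f z0 := exists s K, [/\ 0 < s, 0 < K & approximable f z0 s K].

Lemma approximable_le f z0 (s s' K K' : R) : 0 < s' -> s' <= s -> 0 < K -> K <= K' ->
  approximable f z0 s K -> approximable f z0 s' K'.
Proof.
move=> s0 ss K0 KK fa N; have [P [PK Pf]] := fa N; exists P; split.
  by rewrite (le_trans _ KK)// (le_trans _ PK)// wnorm_le// ltW.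
move=> h hs; apply: le_trans (Pf h (le_trans hs ss)) _.
have s0' : 0 < s by exact: lt_le_trans ss.
apply: ler_pM => //; [exact: ltW|by rewrite exprn_ge0 ?divr_ge0 ?normc_ge0 ?ltW|].
apply: lerX2; first by rewrite divr_ge0 ?normc_ge0// ltW.
by rewrite ler_wpM2l ?normc_ge0// lef_pV2.
Qed.

Lemma analyticD f g z0 : analytic_at f z0 -> analytic_at g z0 ->
  analytic_at (fun z => f z + g z) z0.
Proof.
move=> [s [K [s0 K0 fa]]] [t [L [t0 L0 ga]]].
have m0 : 0 < Num.min s t by rewrite lt_min s0.
have {}fa : approximable f z0 (Num.min s t) K.
  by apply: approximable_le fa; rewrite ?ge_min ?lexx.
have {}ga : approximable g z0 (Num.min s t) L.
  by apply: approximable_le ga; rewrite ?ge_min ?lexx ?orbT.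
exists (Num.min s t), (K + L); split=> //; first exact: addr_gt0.
move=> N; have [P [PK Pf]] := fa N; have [Q [QK Qg]] := ga N.
exists (P + Q); split; first by apply: le_trans (wnormD _ _ (ltW m0)) _; exact: lerD.
move=> h hs; rewrite hornerD opprD addrACA mulrDl.
by apply: le_trans (normcD _ _) _; apply: lerD; [exact: Pf|exact: Qg].
Qed.

Lemma analyticZ f z0 (c : C) : analytic_at f z0 -> analytic_at (fun z => c * f z) z0.
Proof.
move=> [s [K [s0 K0 fa]]]; exists s, ((normc c + 1) * K); split=> //.
  by rewrite mulr_gt0// ltr_wpDl ?normc_ge0.
move=> N; have [P [PK Pf]] := fa N; exists (c%:P * P); split.
  apply: le_trans (wnormM _ _ (ltW s0)) _; rewrite wnormC ler_pM ?normc_ge0//.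
    exact/wnorm_ge0/ltW.
  by rewrite lerDl.
move=> h hs; rewrite hornerM hornerC -mulrBr normcM -mulrA ler_pM ?normc_ge0//.
  by rewrite lerDl.
exact: Pf.
Qed.

Lemma analytic_id z0 : analytic_at (fun z => z) z0.
Proof.
have k0 : 0 < normc z0 + 1 by rewrite ltr_wpDl ?normc_ge0.
exists 1, (normc z0 + 1); split=> // N; exists (z0%:P + 'X); split.
  apply: le_trans (wnormD _ _ ler01) _; rewrite wnormC lerD2l.
  have -> : ('X : {poly C}) = 1%:P * 'X^1 by rewrite polyC1 mul1r expr1.
  by rewrite wnormMXn wnormC normc1 mul1r expr1.
move=> h _; rewrite hornerD hornerC hornerX subrr normc0.
by rewrite mulr_ge0 ?(ltW k0)// exprn_ge0// divr_ge0 ?normc_ge0.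
Qed.

Lemma analyticB f g z0 : analytic_at f z0 -> analytic_at g z0 ->
  analytic_at (fun z => f z - g z) z0.
Proof.
move=> fa ga; have := analyticD fa (analyticZ (-1) ga).
by congr (analytic_at _ z0); apply/funext => z; rewrite mulN1r.
Qed.

(** On the half disc the mean value bound carries the factor [m / 2 ^ (m - 1)], which is at most 1
    for every [m]. Multiplying by [t] avoids the exponent [m - 1]. *)
Lemma normc_subX (d d' : C) (t : R) m : 0 < t -> normc d <= t / 2 -> normc d' <= t / 2 ->
  normc (d ^+ m - d' ^+ m) * t <= normc (d - d') * t ^+ m.
Proof.
move=> t0 dt d't; have nd := normc_ge0 d; have nd' := normc_ge0 d'.
have ndd := normc_ge0 (d - d').
case: m => [|m]; first by rewrite !expr0 subrr normc0 mul0r mulr1.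
elim: m => [|m IH]; first by rewrite !expr1.
have -> : d ^+ m.+2 - d' ^+ m.+2 = d * (d ^+ m.+1 - d' ^+ m.+1) + (d - d') * d' ^+ m.+1.
  by rewrite ![_ ^+ m.+2]exprS; ring.
have tm : 0 <= t ^+ m.+1 by rewrite exprn_ge0 ?ltW.
have h3 : normc d' ^+ m.+1 <= t ^+ m.+1 / 2.
  rewrite exprS (exprS t) mulrAC; apply: ler_pM; rewrite ?exprn_ge0//.
  by apply: lerX2 => //; lra.
apply: (@le_trans _ _ ((normc d * normc (d ^+ m.+1 - d' ^+ m.+1) +
    normc (d - d') * normc d' ^+ m.+1) * t)).
  by rewrite ler_wpM2r ?(ltW t0)// -normcX -!normcM normcD.
rewrite mulrDl (exprS t m.+1).
have h1 : normc d * normc (d ^+ m.+1 - d' ^+ m.+1) * t <=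
    t / 2 * (normc (d - d') * t ^+ m.+1).
  rewrite -mulrA; apply: ler_pM => //; rewrite mulr_ge0 ?normc_ge0 ?ltW//.
have h2 : normc (d - d') * normc d' ^+ m.+1 * t <= normc (d - d') * (t ^+ m.+1 / 2) * t.
  by rewrite ler_wpM2r ?(ltW t0)// ler_wpM2l.
apply: le_trans (lerD h1 h2) _.
by rewrite le_eqVlt; apply/orP; left; apply/eqP; field.
Qed.

(** The Lipschitz constant on the half disc involves only [wnorm t Q], not the degree, so it is
    uniform over the approximants of an analytic function. *)
Lemma horner_lip (Q : {poly C}) (d d' : C) (t : R) : 0 < t ->
  normc d <= t / 2 -> normc d' <= t / 2 ->
  normc (Q.[d] - Q.[d']) <= normc (d - d') * (wnorm t Q / t).
Proof.
move=> t0 dt d't; rewrite mulrA ler_pdivlMr// !horner_coef -sumrB /wnorm.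
rewrite (@horner_coef_wide _ (size Q) (map_poly _ _)) ?size_poly// mulr_sumr.
apply: (@le_trans _ _ (\sum_(i < size Q) normc (Q`_i * d ^+ i - Q`_i * d' ^+ i) * t)).
  rewrite -mulr_suml ler_wpM2r ?(ltW t0)//.
  elim/big_ind2 : _ => [|x a y b xa yb|//]; first by rewrite normc0.
  by apply: le_trans (normcD _ _) _; exact: lerD.
apply: ler_sum => i _; rewrite -mulrBr normcM coef_normc mulrCA -mulrA.
by rewrite ler_wpM2l ?normc_ge0// normc_subX.
Qed.

(** The approximant is [Q] composed with [P] minus its constant term. The error splits into that of
    [Q] at the true point and the effect on [Q] of the error of [P], handled by [horner_lip]. *)
Lemma analytic_comp (phi f : C -> C) z0 : analytic_at f z0 -> analytic_at phi (f z0) ->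
  analytic_at (fun z => phi (f z)) z0.
Proof.
move=> [s [K [s0 K0 fa]]] [t [L [t0 L0 pa]]].
(* Shrinking the radius by [l] brings [wnorm r P1] below [t / 4] and the displacement [d] of [f]
   below [t / 2], the half disc required by [horner_lip]. *)
pose l := Num.min 1 (t / (4 * K)).
have l0 : 0 < l by rewrite lt_min ltr01 divr_gt0// mulr_gt0.
have l1 : l <= 1 by rewrite ge_min lexx.
have lK : l * (4 * K) <= t by rewrite -ler_pdivlMr ?mulr_gt0// ge_min lexx orbT.
pose r := s * l; have r0 : 0 < r by rewrite mulr_gt0.
have rs : r <= s by rewrite ler_piMr// ltW.
pose M := L + K * (L / t).
have KLt : 0 < K * (L / t) by rewrite mulr_gt0// divr_gt0.
exists r, M; split=> //; first by rewrite addr_gt0.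
(* Order [N.+1] for [f], since order 0 would say too little: at [h = 0] the error must vanish to
   give [P(0) = f z0], and the error must be at most [K q] even when [N = 0]. *)
move=> N; have [P [PK Pf]] := fa N.+1; have [Q [QL Qp]] := pa N.
have P0 : P`_0 = f z0.
  have := Pf 0; rewrite normc0 addr0 horner_coef0 mul0r expr0n mulr0 => /(_ (ltW s0)) h.
  apply/eqP; rewrite eq_sym -subr_eq0; apply/eqP/eq0_normc/eqP.
  by rewrite eq_le h normc_ge0.
pose P1 := P - (f z0)%:P.
have P10 : P1`_0 = 0 by rewrite coefB coefC P0 subrr.
have P1K : wnorm s P1 <= K.
  apply: le_trans PK; apply: le_horner => [|k]; first exact: ltW.
  rewrite !coef_normc coefB coefC; case: k => [|k]; last by rewrite subr0.
  by rewrite P0 subrr normc0 normc_ge0.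
have P1r (q : R) : 0 <= q -> q <= s -> wnorm q P1 <= q / s * K.
  move=> q0 qs; apply: le_trans (wnorm_contract q0 qs s0 P10) _.
  by rewrite ler_wpM2l// divr_ge0// ltW.
have rsl : r / s = l by rewrite /r; field; rewrite gt_eqF.
have P1t : wnorm r P1 <= t / 4.
  by apply: le_trans (P1r _ (ltW r0) rs) _; rewrite rsl; lra.
exists (Q \Po P1); split.
  apply: le_trans (wnorm_comp Q (ltW r0) (_ : _ <= t)) _; first by lra.
  by rewrite (le_trans QL)// lerDl ltW.
move=> h hr; have hs := le_trans hr rs; have nh := normc_ge0 h.
pose d := f (z0 + h) - f z0; pose d' := P1.[h].
pose q := normc h / s.
have q0 : 0 <= q by rewrite divr_ge0// ltW.
have ql : q <= l by rewrite /q ler_pdivrMr// mulrC.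
have qN : q ^+ N <= 1 by rewrite exprn_ile1// (le_trans ql).
have dd' : normc (d - d') <= K * q ^+ N.+1.
  have -> : d - d' = f (z0 + h) - P.[h].
    by rewrite /d /d' hornerD hornerN hornerC; ring.
  exact: Pf.
have dd'q : normc (d - d') <= K * q.
  by apply: le_trans dd' _; rewrite ler_wpM2l ?(ltW K0)// exprS ler_piMr.
have d'q : normc d' <= K * q.
  by apply: le_trans (wnorm_horner _ (lexx _)) _; rewrite mulrC P1r.
have Kq : K * q <= t / 4.
  by have := ler_wpM2l (ltW K0) ql; lra.
have dq : normc d <= 2 * (K * q).
  by have := normcD (d - d') d'; rewrite subrK; lra.
have dr : normc d / t <= normc h / r.
  rewrite ler_pdivrMr//; apply: le_trans dq _.
  have -> : normc h / r * t = q * (t / l) by rewrite /q /r; field; rewrite !gt_eqF.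
  have -> : 2 * (K * q) = q * (2 * K) by ring.
  rewrite ler_wpM2l//.
  by rewrite ler_pdivlMr//; have := mulr_gt0 l0 K0; lra.
have qr : q <= normc h / r by rewrite ler_wpM2l// lef_pV2.
have hr0 : 0 <= normc h / r by rewrite divr_ge0// ltW.
have -> : phi (f (z0 + h)) - (Q \Po P1).[h] =
    (phi (f z0 + d) - Q.[d]) + (Q.[d] - Q.[d']).
  by rewrite horner_comp /d [f z0 + _]addrC subrK; ring.
apply: le_trans (normcD _ _) _; rewrite /M mulrDl; apply: lerD.
  apply: le_trans (Qp d _) _; first lra.
  rewrite ler_wpM2l ?(ltW L0)//; apply: lerX2 => //.
  by rewrite divr_ge0 ?normc_ge0// ltW.
apply: le_trans (horner_lip Q t0 _ _) _; [lra|lra|].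
apply: (@le_trans _ _ ((K * q ^+ N) * (L / t))).
  apply: ler_pM; rewrite ?normc_ge0 ?divr_ge0 ?wnorm_ge0 ?(ltW t0)//.
    apply: le_trans dd' _; rewrite ler_wpM2l ?(ltW K0)// exprSr ler_piMr ?exprn_ge0//.
    exact: le_trans ql l1.
  by rewrite ler_wpM2r// invr_ge0 ltW.
rewrite mulrAC ler_wpM2l ?(ltW KLt)//.
exact: lerX2.
Qed.

Lemma expr_small (q e : R) : 0 <= q -> q < 1 -> 0 < e -> exists N, q ^+ N < e.
Proof.
move=> q0 q1 e0; have : GRing.exp q @ \oo --> (0 : R).
  by apply: cvg_expr; rewrite ger0_norm.
move=> /cvgrPdist_lt/(_ _ e0)[N _ /(_ N (leqnn N))] /=.
by rewrite sub0r normrN ger0_norm ?exprn_ge0// => ?; exists N.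
Qed.

(* If [f] vanishes on a ray issued from [z0], every truncated Taylor polynomial
   is zero. *)
Lemma analytic_vanish f z0 : analytic_at f z0 -> exists2 s, 0 < s &
  forall u x0, u != 0 -> 0 < x0 ->
  (forall x, 0 < x -> x < x0 -> f (z0 + x%:C * u) = 0) ->
  forall h, normc h < s -> f (z0 + h) = 0.
Proof.
move=> [s [K [s0 K0 fa]]]; exists s => // u x0 u0 x00 fu h hs.
have nu : 0 < normc u by rewrite normc_gt0.
pose q := normc h / s.
have q0 : 0 <= q by rewrite divr_ge0 ?normc_ge0// ltW.
have q1 : q < 1 by rewrite /q ltr_pdivrMr// mul1r.
(* One [K] accounts for the approximation error, the other for the coefficients of degree at least
   [N]. *)
have bound N : normc (f (z0 + h)) <= 2 * K * q ^+ N.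
  have [P [PK Pf]] := fa N.
  have tail h' : normc h' <= s ->
      normc (f (z0 + h') - (take_poly N P).[h']) <= 2 * K * (normc h' / s) ^+ N.
    move=> h's; rewrite -[f _](subrK P.[h']) -addrA.
    apply: le_trans (normcD _ _) _; rewrite (_ : 2 * K = K + K); last by ring.
    rewrite mulrDl; apply: lerD; first exact: Pf.
    apply: le_trans (wnorm_tail _ _ s0 h's) _; rewrite ler_wpM2r//.
    by rewrite exprn_ge0// divr_ge0 ?normc_ge0// ltW.
  have take0 : take_poly N P = 0.
    apply: (@poly_vanish _ N _ u (2 * K * (normc u / s) ^+ N) (Num.min x0 (s / normc u))).
    - by [].
    - by rewrite lt_min x00 divr_gt0.
    - by rewrite mulr_ge0 ?exprn_ge0 ?divr_ge0 ?mulr_ge0 ?ltW.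
    - exact: size_take_poly.
    - move=> x x_gt0; rewrite lt_min => /andP[xx0 xs].
      have nxu : normc (x%:C * u) = x * normc u by rewrite normcM normc_real gtr0_norm.
      have := tail (x%:C * u); rewrite fu// sub0r normcN nxu => /(_ _) h1.
      rewrite -[leRHS]mulrA -exprMn (mulrC (normc u / s)) mulrA; apply: h1.
      by rewrite -ler_pdivlMr// ltW.
  by have := tail h (ltW hs); rewrite take0 horner0 subr0.
apply: eq0_normc; apply/eqP; rewrite eq_le normc_ge0 andbT.
apply/ler_addgt0Pr => e e0; rewrite add0r.
have [|N qN] := @expr_small q (e / (2 * K)) q0 q1; first by rewrite divr_gt0// mulr_gt0.
apply: le_trans (bound N) _; rewrite mulrC -ler_pdivlMr ?mulr_gt0//; exact: ltW.
Qed.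

Lemma upper_segment (w1 w0 : C) (t : R) : 0 < complex.Im w1 -> 0 < complex.Im w0 ->
  0 <= t -> t <= 1 -> 0 < complex.Im (w1 + t%:C * (w0 - w1)).
Proof.
move=> h1 h0 t0 t1; rewrite !ReImE /= mul0r addr0.
by have [|] := leP (complex.Im w1) (complex.Im w0); nra.
Qed.

(** Let [T] be the supremum of the parameters up to which [f] vanishes on the segment. Seen from the
    point at [T], [f] vanishes on a short ray in the backward direction [w1 - w0], hence on a disc
    around that point, and so beyond [T] unless the end of the segment is reached. *)
Lemma analytic_continuation f (w1 w0 : C) (x0 : R) :
  (forall z, 0 < complex.Im z -> analytic_at f z) ->
  0 < complex.Im w1 -> 0 < complex.Im w0 -> 0 < x0 ->
  (forall t, 0 <= t -> t < x0 -> f (w1 + t%:C * (w0 - w1)) = 0) -> f w0 = 0.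
Proof.
move=> fa w1p w0p x00 f0.
have [->|w10] := eqVneq w0 w1.
  by have := f0 0 (lexx _) x00; rewrite mul0r addr0.
have nw : 0 < normc (w0 - w1) by rewrite normc_gt0 subr_eq0.
pose g t := w1 + t%:C * (w0 - w1).
pose E := [set t : R | 0 <= t <= 1 /\ forall s, 0 <= s -> s <= t -> f (g s) = 0].
have Eub : ubound E 1 by move=> t [/andP[]].
pose x1 := Num.min 1 (x0 / 2).
have x10 : 0 < x1 by rewrite lt_min ltr01 divr_gt0.
have Ex1 : E x1.
  split; first by rewrite ltW//= ge_min lexx.
  move=> s s0 sx; apply: f0 => //; apply: le_lt_trans sx _.
  by apply: (@le_lt_trans _ _ (x0 / 2)); [rewrite ge_min lexx orbT|lra].
have hsE : has_sup E by split; [exists x1|exists 1].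
pose T := sup E.
have T0 : 0 < T by apply: lt_le_trans x10 _; exact: ub_le_sup hsE.2 _ Ex1.
have T1 : T <= 1 by exact: ge_sup hsE.1 Eub.
have fT s : 0 <= s -> s < T -> f (g s) = 0.
  move=> s0 sT; have [|t Et] := @sup_adherent _ E (T - s) _ hsE; first by rewrite subr_gt0.
  rewrite opprB addrCA subrr addr0 => st; case: Et => _; apply => //; exact: ltW.
have [s s0 Hs] := analytic_vanish (fa _ (upper_segment w1p w0p (ltW T0) T1)).
have fnear t : normc (g t - g T) < s -> f (g t) = 0.
  move=> h; rewrite -[g t](subrK (g T)) addrC.
  apply: (Hs (w1 - w0) T) => //; first by rewrite subr_eq0 eq_sym.
  move=> x x_gt0 xT; rewrite -[RHS](fT (T - x)); last by lra.
    by congr f; rewrite /g rmorphB /=; ring.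
  by lra.
have gsub t : normc (g t - g T) = `|t - T| * normc (w0 - w1).
  have -> : g t - g T = (t - T)%:C * (w0 - w1) by rewrite /g rmorphB /=; ring.
  by rewrite normcM normc_real.
pose d := s / normc (w0 - w1).
have d0 : 0 < d by rewrite divr_gt0.
have fE t : 0 <= t -> t < T + d -> f (g t) = 0.
  move=> t0 tTd; have [tT|Tt] := ltP t T; first exact: fT.
  by apply: fnear; rewrite gsub -ltr_pdivlMr// -/d ger0_norm ?subr_ge0//; lra.
have [Td|dT] := leP (T + d / 2) 1.
  have : E (T + d / 2).
    split; first by apply/andP; split=> //; lra.
    by move=> t t0 tT; apply: fE => //; lra.
  by move=> /(ub_le_sup hsE.2); rewrite -/T => TdT; exfalso; lra.
have g1 : g 1 = w0 by rewrite /g rmorph1 mul1r addrC subrK.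
by rewrite -g1; apply: fE => //; lra.
Qed.

End analytic.

(** * Analyticity of Cauchy transforms in the upper half-plane *)

Section cauchy_analytic.
Context {R : realType}.
Local Notation C := R[i].
Local Notation law := (probability (measurableTypeR R) R).
Implicit Types (mu : law) (z : C).

Let cintegrable_pow mu z (w : C) k : 0 < complex.Im z -> 0 < complex.Im w ->
  cintegrable mu (fun x => (z - x%:C)^-1 ^+ k * (w - x%:C)^-1).
Proof.
move=> z0 w0; apply: (@bounded_cintegrable _ _ _ ((complex.Im z)^-1 ^+ k * (complex.Im w)^-1)).
  by apply: cmeasurableM; [apply: cmeasurableX|]; exact: cmeasurable_resolvent.
move=> x; rewrite normcM normcX ler_pM ?exprn_ge0 ?normc_ge0 ?resolvent_le//.
by apply: lerX2; rewrite ?normc_ge0// resolvent_le.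
Qed.

Let taylor mu z N : {poly C} :=
  \poly_(k < N) ((-1) ^+ k * cint mu (fun x => (z - x%:C)^-1 ^+ k * (z - x%:C)^-1)).

(** Iterates the resolvent identity [1 / (z + h - x) = 1 / (z - x) - h / ((z - x) (z + h - x))],
    which leaves an exact remainder. *)
Let taylorE mu z h N : 0 < complex.Im z -> 0 < complex.Im (z + h) ->
  cauchy_transform mu (z + h) = (taylor mu z N).[h] +
  (- h) ^+ N * cint mu (fun x => (z - x%:C)^-1 ^+ N * (z + h - x%:C)^-1).
Proof.
move=> z0 zh0; elim: N => [|N IH].
  rewrite horner_poly big_ord0 add0r expr0 mul1r cauchyE.
  by apply: eq_cint => x; rewrite expr0 mul1r.
rewrite IH !horner_poly big_ord_recr /= -addrA; congr (_ + _).
have -> : cint mu (fun x => (z - x%:C)^-1 ^+ N * (z + h - x%:C)^-1) =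
    cint mu (fun x => (z - x%:C)^-1 ^+ N * (z - x%:C)^-1) -
    h * cint mu (fun x => (z - x%:C)^-1 ^+ N.+1 * (z + h - x%:C)^-1).
  rewrite -(cintZ h (cintegrable_pow mu N.+1 z0 zh0)) -cintB; last 2 first.
  - exact: cintegrable_pow.
  - exact/cintegrableZ/cintegrable_pow.
  apply: eq_cint => x; rewrite exprSr.
  have a0 := upper_sub_neq0 x z0; have b0 := upper_sub_neq0 x zh0.
  have : (z + h - x%:C)^-1 = (z - x%:C)^-1 - h * ((z - x%:C)^-1 * (z + h - x%:C)^-1).
    by field; rewrite a0 b0.
  move: ((z - x%:C)^-1) ((z + h - x%:C)^-1) => a b ab; rewrite {1}ab; ring.
by rewrite exprS (exprNn h N); ring.
Qed.

Lemma analytic_cauchy mu z : 0 < complex.Im z -> analytic_at (cauchy_transform mu) z.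
Proof.
move=> z0; set v := complex.Im z in z0 *.
have v1 : 0 < v^-1 by rewrite invr_gt0.
(* The coefficients are at most [2 / v ^ (k + 1)]; at radius [v / 2] they sum to at most [4 / v].
   The remainder obeys the same constant because [Im (z + h) >= v / 2]. *)
exists (v / 2), (4 * v^-1); split; [by rewrite divr_gt0|by rewrite mulr_gt0|].
move=> N; exists (taylor mu z N); split.
  apply: (@le_trans _ _ (\poly_(k < N) (2 * (v^-1 ^+ k * v^-1))).[v / 2]).
    apply: le_horner => [|k]; first by rewrite divr_ge0 ?ltW.
    rewrite coef_normc !coef_poly; case: ifP => _; last by rewrite normc0.
    rewrite normcM normcX normcN normc1 expr1n mul1r.
    apply: le_trans (normc_cint_le (h := cst (v^-1 ^+ k * v^-1)) _ _ _) _.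
    - exact: cintegrable_pow.
    - exact: integrable_cst.
    - move=> x; rewrite normcM normcX ler_pM ?exprn_ge0 ?normc_ge0 ?resolvent_le//.
      by apply: lerX2; rewrite ?normc_ge0// resolvent_le.
    - by rewrite Rintegral_probability_cst.
  rewrite horner_poly.
  have -> : \sum_(i < N) 2 * (v^-1 ^+ i * v^-1) * (v / 2) ^+ i =
      2 / v * \sum_(i < N) (1 / 2) ^+ i.
    rewrite mulr_sumr; apply: eq_bigr => i _.
    have -> : (v / 2) ^+ i = v ^+ i * (1 / 2) ^+ i by rewrite -exprMn mul1r.
    have : v^-1 ^+ i * v ^+ i = 1 by rewrite -exprMn mulVf ?gt_eqF// expr1n.
    by move: (v^-1 ^+ i) (v ^+ i) ((1 / 2) ^+ i) => a b c ab; rewrite -[in RHS](mulr1 (2 / v)) -ab; ring.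
  have -> : \sum_(i < N) (1 / 2 : R) ^+ i = 2 - 2 * (1 / 2) ^+ N.
    elim: {v z z0 v1} N => [|N IH]; first by rewrite big_ord0; ring.
    by rewrite big_ord_recr /= IH exprS; field.
  rewrite -mulrA mulrCA mulrC -mulrA -subr_ge0.
  have : 0 <= (1 / 2 : R) ^+ N by rewrite exprn_ge0// divr_ge0.
  by move: ((1 / 2) ^+ N) => p p0; nra.
move=> h hv; have nh := normc_ge0 h.
have zh : v / 2 <= complex.Im (z + h).
  have /ler_normlP[h1 _] := le_trans (normc_Im h) hv.
  by rewrite cImD -/v; lra.
have v2 : 0 < v / 2 by rewrite divr_gt0.
have zh0 : 0 < complex.Im (z + h) by exact: lt_le_trans zh.
rewrite (taylorE mu N z0 zh0) addrAC subrr add0r normcM normcX normcN.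
apply: (@le_trans _ _ (normc h ^+ N * (2 * (v^-1 ^+ N * (v / 2)^-1)))).
  rewrite ler_wpM2l ?exprn_ge0//.
  apply: le_trans (normc_cint_le (h := cst (v^-1 ^+ N * (v / 2)^-1)) _ _ _) _.
  - exact: cintegrable_pow.
  - exact: integrable_cst.
  - move=> x; rewrite normcM normcX ler_pM ?exprn_ge0 ?normc_ge0//.
      by apply: lerX2; rewrite ?normc_ge0// resolvent_le.
    by apply: le_trans (resolvent_le _ zh0) _; rewrite lef_pV2.
  - by rewrite Rintegral_probability_cst.
rewrite expr_div_n [leRHS]mulrCA ler_wpM2l ?exprn_ge0//.
have -> : 2 * (v^-1 ^+ N * (v / 2)^-1) = 4 * v^-1 * v^-1 ^+ N by field; rewrite gt_eqF.
rewrite ler_wpM2l ?mulr_ge0 ?(ltW v1)// -exprVn.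
apply: lerX2; first exact: ltW.
by rewrite lef_pV2 ?posrE//; lra.
Qed.

(** Presents inversion as a Cauchy transform, so that its analyticity is an instance of
    [analytic_cauchy]. *)
Lemma cauchy_dirac0 z : 0 < complex.Im z ->
  cauchy_transform (dirac (0 : measurableTypeR R) : law) z = z^-1.
Proof.
move=> z0; apply: complex_eq; rewrite /cauchy_transform /=.
  rewrite /Rintegral integral_dirac//=.
    by rewrite indicT mul1r rmorph0 subr0.
  by apply/measurable_EFinP; have [] := cmeasurable_resolvent z.
rewrite /Rintegral integral_dirac//=.
  by rewrite indicT mul1r rmorph0 subr0.
by apply/measurable_EFinP; have [] := cmeasurable_resolvent z.
Qed.

End cauchy_analytic.

(** * Subordination on the whole upper half-plane *)

Section subordination.
Context {R : realType}.
Local Notation C := R[i].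
Local Notation law := (probability (measurableTypeR R) R).
Implicit Types (mu rho : law) (z w : C).

Lemma Im_resolvent z (x : R) : complex.Im (z - x%:C)^-1 =
  - complex.Im z / normc (z - x%:C) ^+ 2.
Proof. by rewrite cImV upper_sub_real. Qed.

(* Tangent line of the convex function [t |-> 1 / (normc w ^+ 2 + t)] at [t = 1]. *)
Lemma Im_cauchy_le mu w : 0 < complex.Im w ->
  mu.-integrable setT (fun x => (x ^+ 2)%:E) -> \int[mu]_x x ^+ 2 = 1 ->
  complex.Im w / (2 * (normc w ^+ 2 + 1)) <= - complex.Im (cauchy_transform mu w).
Proof.
move=> w0 i2 m2; set v := complex.Im w; pose a := normc w ^+ 2.
have a0 : 0 <= a by rewrite exprn_ge0 ?normc_ge0.
have a1 : 0 < a + 1 by rewrite ltr_wpDl.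
have [_ iI] := cintegrable_resolvent mu w0.
pose c := v / (2 * (a + 1) ^+ 2).
have i2c := integrable_scale c i2.
have ic : mu.-integrable setT (fun x => (v / (2 * (a + 1)) + c - c * x ^+ 2)%:E).
  by apply: integrable_sub => //; exact: integrable_cst.
have -> : v / (2 * (a + 1)) = \int[mu]_x (v / (2 * (a + 1)) + c - c * x ^+ 2).
  rewrite RintegralB//; last exact: integrable_cst.
  rewrite Rintegral_probability_cst (RintegralZl _ measurableT i2) m2; ring.
have -> : - complex.Im (cauchy_transform mu w) = \int[mu]_x (-1 * complex.Im (w - x%:C)^-1).
  by rewrite (RintegralZl _ measurableT iI) mulN1r.
apply: le_Rintegral => //; first exact: (integrable_scale (-1) iI).
move=> x _; rewrite Im_resolvent mulN1r mulNr opprK -/v.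
have d0 : 0 < normc (w - x%:C) ^+ 2 by rewrite exprn_gt0// normc_gt0 upper_sub_neq0.
have d1 : normc (w - x%:C) ^+ 2 <= 2 * (a + x ^+ 2).
  rewrite /a !normc_sqr !ReImE /= subr0.
  by have := sqr_ge0 (complex.Re w + x); have := sqr_ge0 (complex.Im w); nra.
have ax : 0 < a + x ^+ 2 by nra.
apply: (@le_trans _ _ (v / (2 * (a + x ^+ 2)))); last first.
  apply: ler_wpM2l; first exact: ltW.
  by rewrite lef_pV2 ?posrE// mulr_gt0.
have -> : v / (2 * (a + 1)) + c - c * x ^+ 2 =
    v / 2 * ((2 * (a + 1) - (a + x ^+ 2)) / (a + 1) ^+ 2).
  by rewrite /c; field; rewrite gt_eqF.
have -> : v / (2 * (a + x ^+ 2)) = v / 2 * (a + x ^+ 2)^-1 by field; rewrite gt_eqF.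
apply: ler_wpM2l; first by rewrite divr_ge0// ltW.
rewrite ler_pdivrMr ?exprn_gt0// ler_pdivlMl//.
by have := sqr_ge0 (a + 1 - (a + x ^+ 2)); nra.
Qed.

Lemma Im_cauchy_lt0 mu w : 0 < complex.Im w ->
  mu.-integrable setT (fun x => (x ^+ 2)%:E) -> \int[mu]_x x ^+ 2 = 1 ->
  complex.Im (cauchy_transform mu w) < 0.
Proof.
move=> w0 i2 m2; rewrite -oppr_gt0; apply: lt_le_trans (Im_cauchy_le w0 i2 m2).
by rewrite divr_gt0// mulr_gt0// ltr_wpDl// exprn_ge0 ?normc_ge0.
Qed.

Lemma cauchy_neq0 mu w : 0 < complex.Im w ->
  mu.-integrable setT (fun x => (x ^+ 2)%:E) -> \int[mu]_x x ^+ 2 = 1 ->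
  cauchy_transform mu w != 0.
Proof.
move=> w0 i2 m2; apply: contraTneq (Im_cauchy_lt0 w0 i2 m2) => -> /=.
by rewrite ltxx.
Qed.

(* Cauchy-Schwarz: [normc (G w) ^+ 2 <= \int normc (w - x) ^- 2 = - Im (G w) / Im w]. *)
Lemma Im_F_ge mu w : 0 < complex.Im w ->
  mu.-integrable setT (fun x => (x ^+ 2)%:E) -> \int[mu]_x x ^+ 2 = 1 ->
  complex.Im w <= complex.Im (F_transform mu w).
Proof.
move=> w0 i2 m2; set v := complex.Im w.
rewrite /F_transform cImV ler_pdivlMr; last first.
  by rewrite exprn_gt0// normc_gt0 cauchy_neq0.
have [iR iI] := cintegrable_resolvent mu w0.
set G := cauchy_transform mu w; rewrite normc_sqr.
pose a := complex.Re G; pose b := complex.Im G; rewrite -/a -/b.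
have iRa := integrable_scale (2 * v * a) iR; have iIb := integrable_scale (2 * v * b) iI.
have iab := integrable_add iRa iIb.
have -> : v * (a ^+ 2 + b ^+ 2) = \int[mu]_x
    (2 * v * a * complex.Re (w - x%:C)^-1 + 2 * v * b * complex.Im (w - x%:C)^-1
     - v * (a ^+ 2 + b ^+ 2)).
  rewrite RintegralB//; last exact: integrable_cst.
  rewrite RintegralD// (RintegralZl _ measurableT iR) (RintegralZl _ measurableT iI).
  rewrite (_ : \int[mu]_x complex.Re (w - x%:C)^-1 = a)//.
  rewrite (_ : \int[mu]_x complex.Im (w - x%:C)^-1 = b)//.
  by rewrite Rintegral_probability_cst; ring.
have -> : - b = \int[mu]_x (-1 * complex.Im (w - x%:C)^-1).
  by rewrite (RintegralZl _ measurableT iI) mulN1r.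
apply: le_Rintegral => //.
- by apply: integrable_sub => //; exact: integrable_cst.
- exact: (integrable_scale (-1) iI).
move=> x _; set r := (w - x%:C)^-1.
have rI : - complex.Im r = v * (complex.Re r ^+ 2 + complex.Im r ^+ 2).
  rewrite -normc_sqr /r Im_resolvent normcV exprVn -/v; field.
  by rewrite gt_eqF// normc_gt0 upper_sub_neq0.
rewrite mulN1r rI -subr_ge0.
have -> : v * (complex.Re r ^+ 2 + complex.Im r ^+ 2) -
    (2 * v * a * complex.Re r + 2 * v * b * complex.Im r - v * (a ^+ 2 + b ^+ 2)) =
    v * ((complex.Re r - a) ^+ 2 + (complex.Im r - b) ^+ 2) by ring.
by rewrite mulr_ge0 ?(ltW w0)// addr_ge0// sqr_ge0.
Qed.

Lemma subordination mu rho n Y : (0 < n)%N ->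
  mu.-integrable setT (fun x => (x ^+ 2)%:E) -> \int[mu]_x x ^+ 2 = 1 ->
  (forall y, Y < y -> let w := 0 +i* y in let z := F_transform mu w in
    cauchy_transform rho (z + n%:R^-1 * (w - z)) = cauchy_transform mu w) ->
  forall w, 0 < complex.Im w -> let z := F_transform mu w in
    let om := z + n%:R^-1 * (w - z) in
    complex.Im w <= complex.Im om /\ cauchy_transform rho om = cauchy_transform mu w.
Proof.
move=> n0 i2 m2 ray.
have n1 : 0 < n%:R^-1 :> R by rewrite invr_gt0 ltr0n.
have n1' : n%:R^-1 <= 1 :> R by rewrite invf_le1 ?ler1n ?ltr0n.
have nE : n%:R^-1 = (n%:R^-1 : R)%:C by rewrite fmorphV rmorph_nat.
have Im_om w z : 0 < complex.Im w -> complex.Im w <= complex.Im z ->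
    complex.Im w <= complex.Im (z + n%:R^-1 * (w - z)).
  move=> w0 wz; rewrite nE !ReImE /= mul0r addr0.
  by move: n1'; move: n%:R^-1 => q q1; nra.
(* Agrees with [F_transform mu] on the upper half-plane. The two signs are there because
   [cauchy_transform mu] takes values in the lower half-plane, while [cauchy_dirac0] applies in the
   upper one. *)
pose F w := -1 * cauchy_transform (dirac (0 : measurableTypeR R) : law)
              (-1 * cauchy_transform mu w).
have FE w : 0 < complex.Im w -> F w = F_transform mu w.
  move=> w0; rewrite /F cauchy_dirac0; last first.
    by rewrite mulN1r cImN oppr_gt0 Im_cauchy_lt0.
  by rewrite !mulN1r invrN opprK.
pose om w := F w + n%:R^-1 * (w - F w).
pose f w := cauchy_transform rho (om w) - cauchy_transform mu w.
have om_up w : 0 < complex.Im w -> 0 < complex.Im (om w).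
  move=> w0; apply: (lt_le_trans w0); rewrite /om FE//.
  by apply: Im_om => //; exact: Im_F_ge.
have fa w : 0 < complex.Im w -> analytic_at f w.
  move=> w0; have Fa : analytic_at F w.
    apply: analyticZ; apply: (@analytic_comp _ _ (fun w => -1 * cauchy_transform mu w)).
      exact/analyticZ/analytic_cauchy.
    by apply: analytic_cauchy; rewrite mulN1r cImN oppr_gt0 Im_cauchy_lt0.
  apply: analyticB; last exact: analytic_cauchy.
  apply: (@analytic_comp _ _ om); last exact/analytic_cauchy/om_up.
  apply: analyticD => //; apply: analyticZ; apply: analyticB => //.
  exact: analytic_id.
pose y1 := Num.max Y 0 + 1.
have y10 : 0 < y1 by rewrite ltr_wpDl// le_max lexx orbT.
have Yy1 : Y < y1 by rewrite ltr_pwDr// le_max lexx.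
pose w1 : C := 0 +i* y1.
have w10 : 0 < complex.Im w1 by [].
have f0 y : Y < y -> 0 < y -> f (0 +i* y) = 0.
  move=> Yy y0; rewrite /f /om FE//.
  by have := ray y Yy => /= ->; rewrite subrr.
(* The known zeros lie on a vertical ray only. Spreading them to a disc around [w1] gives zeros at
   the start of every segment issued from [w1], whatever its direction. *)
have [s s0 Hs] := analytic_vanish (fa w1 w10).
have fdisc h : normc h < s -> f (w1 + h) = 0.
  apply: (Hs 'i 1) => //; first by rewrite -normc_gt0 /= expr0n expr1n add0r sqrtr1.
  move=> x x0 _; rewrite -[RHS](f0 (y1 + x)); [|lra|lra].
  by congr f; apply: complex_eq; rewrite !ReImE /=; ring.
move=> w w0 z om'; split; first by apply: Im_om => //; exact: Im_F_ge.
have nw : 0 < normc (w - w1) + 1 by rewrite ltr_wpDl ?normc_ge0.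
have : f w = 0.
  apply: (@analytic_continuation _ f w1 w (s / (normc (w - w1) + 1))) => //.
    by rewrite divr_gt0.
  move=> t t0; rewrite ltr_pdivlMr// => ts; apply: fdisc.
  rewrite normcM normc_real ger0_norm//; apply: le_lt_trans ts.
  by rewrite ler_wpM2l// lerDl.
by rewrite /f /om FE// => /eqP; rewrite subr_eq0 => /eqP.
Qed.

End subordination.

(** * Limits of complex sequences *)

Section complex_sequences.
Context {R : realType}.
Local Notation C := R[i].
Implicit Types (u v : nat -> C) (a b : C).

Definition ccvg u a :=
  ((fun k => complex.Re (u k)) @ \oo --> complex.Re a) /\
  ((fun k => complex.Im (u k)) @ \oo --> complex.Im a).

Lemma ccvg_cst a : ccvg (fun=> a) a.
Proof. by split; exact: cvg_cst. Qed.

Lemma ccvgD u v a b : ccvg u a -> ccvg v b -> ccvg (fun k => u k + v k) (a + b).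
Proof.
move=> [ua ua'] [vb vb']; split.
  by under eq_fun do rewrite cReD; rewrite cReD; exact: cvgD.
by under eq_fun do rewrite cImD; rewrite cImD; exact: cvgD.
Qed.

Lemma ccvgM u v a b : ccvg u a -> ccvg v b -> ccvg (fun k => u k * v k) (a * b).
Proof.
move=> [ua ua'] [vb vb']; split.
  by under eq_fun do rewrite cReM; rewrite cReM; apply: cvgB; exact: cvgM.
by under eq_fun do rewrite cImM; rewrite cImM; apply: cvgD; exact: cvgM.
Qed.

Lemma ccvgZ (c : C) u a : ccvg u a -> ccvg (fun k => c * u k) (c * a).
Proof. by apply: ccvgM; exact: ccvg_cst. Qed.

Lemma ccvgB u v a b : ccvg u a -> ccvg v b -> ccvg (fun k => u k - v k) (a - b).
Proof.
move=> ua vb; have := ccvgD ua (ccvgZ (-1) vb).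
by rewrite mulN1r; under [in X in X -> _]eq_fun do rewrite mulN1r.
Qed.

Lemma cvg_normc_sqr u a : ccvg u a ->
  (fun k => normc (u k) ^+ 2) @ \oo --> normc a ^+ 2.
Proof.
move=> [ua ua']; rewrite normc_sqr; under eq_fun do rewrite normc_sqr.
by rewrite !expr2; apply: cvgD; apply: cvgM.
Qed.

Lemma ccvgV u a : a != 0 -> ccvg u a -> ccvg (fun k => (u k)^-1) a^-1.
Proof.
move=> a0 ua; have [ur ui] := ua.
have n0 : normc a ^+ 2 != 0 by rewrite expf_neq0// gt_eqF// normc_gt0.
have nV : (fun k => (normc (u k) ^+ 2)^-1) @ \oo --> (normc a ^+ 2)^-1.
  by apply: cvgV => //; exact: cvg_normc_sqr.
split.
  by under eq_fun do rewrite cReV; rewrite cReV; apply: cvgM.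
by under eq_fun do rewrite cImV; rewrite cImV; apply: cvgM => //; exact: cvgN.
Qed.

Lemma ccvgP u a : (forall e, 0 < e -> \forall k \near \oo, normc (u k - a) < e) ->
  ccvg u a.
Proof.
move=> h; split; apply/cvgrPdist_lt => e e0; near=> k.
- rewrite distrC -cReN -cReD; apply: le_lt_trans (normc_Re _) _.
  by near: k; exact: h.
- rewrite distrC -cImN -cImD; apply: le_lt_trans (normc_Im _) _.
  by near: k; exact: h.
Unshelve. all: by end_near. Qed.

Lemma ccvg_dist u a e : ccvg u a -> 0 < e -> \forall k \near \oo, normc (u k - a) < e.
Proof.
move=> [ur ui] e0; have e2 : 0 < e / 2 by rewrite divr_gt0.
near=> k; apply: le_lt_trans (normc_ReIm _) _; rewrite !ReImE.
rewrite (splitr e) ltrD//.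
  by rewrite distrC; near: k; move/cvgrPdist_lt: ur; exact.
by rewrite distrC; near: k; move/cvgrPdist_lt: ui; exact.
Unshelve. all: by end_near. Qed.

Lemma ccvg_unique u a b : ccvg u a -> ccvg u b -> a = b.
Proof.
by move=> [ua ua'] [ub ub']; apply: complex_eq;
  [exact: (cvg_unique _ ua ub)|exact: (cvg_unique _ ua' ub')].
Qed.

Lemma ccvgV_infty u : (forall K, \forall k \near \oo, K <= normc (u k)) ->
  ccvg (fun k => (u k)^-1) 0.
Proof.
move=> u_oo; apply: ccvgP => e e0; near=> k; rewrite subr0 normcV.
have uk : e^-1 + 1 <= normc (u k) by near: k; exact: u_oo.
have e1 : 0 < e^-1 by rewrite invr_gt0.
by rewrite -[e]invrK ltf_pV2 ?posrE; lra.
Unshelve. all: by end_near. Qed.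

End complex_sequences.

(** * Moments read off the Cauchy transform *)

Section moments.
Context {R : realType}.
Local Notation C := R[i].
Local Notation law := (probability (measurableTypeR R) R).
Implicit Types (mu nu rho : law) (z w : C) (h : R -> R).

Definition cauchy_moment nu h z : C := cint nu (fun x => (h x)%:C * (z / (z - x%:C))).

Lemma cauchy_moment1 nu z : 0 < complex.Im z ->
  cauchy_moment nu (cst 1) z = z * cauchy_transform nu z.
Proof.
move=> z0; rewrite cauchyE -cintZ; last exact: cintegrable_resolvent.
by apply: eq_cint => x; rewrite mul1r.
Qed.

Lemma cauchy_moment_cvg nu h (u : nat -> C) k : 0 < k ->
  nu.-integrable setT (fun x => (h x)%:E) ->
  (\forall j \near \oo, cone k (u j)) ->
  (forall K, \forall j \near \oo, K <= normc (u j)) ->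
  ccvg (fun j => cauchy_moment nu h (u j)) (\int[nu]_x h x)%:C.
Proof.
move=> k0 ih uk u_oo; apply: ccvgP => e e0.
have [K K0 HK] := cone_cvg ih k0 e0.
near=> j; apply: HK; first by near: j.
by near: j; exact: u_oo.
Unshelve. all: by end_near. Qed.

(** From [x z / (z - x) = z (z / (z - x) - 1)]. Only [h] has to be integrable, although [x h]
    appears on the left. *)
Lemma cauchy_moment_step nu h z : 0 < complex.Im z ->
  nu.-integrable setT (fun x => (h x)%:E) ->
  cauchy_moment nu (fun x => x * h x) z = z * (cauchy_moment nu h z - (\int[nu]_x h x)%:C).
Proof.
move=> z0 ih.
have i1 := cintegrable_ratio z0 ih; have i2 := cintegrable_real ih.
rewrite /cauchy_moment -cint_real -cintB// -cintZ; last exact: cintegrableB.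
apply: eq_cint => x; rewrite rmorphM /=; field.
exact: upper_sub_neq0.
Qed.

(** Write [x h z / (z - x) = x h (1 + x / (z - x))] and take imaginary parts. For [h >= 0] the
    integrand is nonnegative with two more powers of [x], so Fatou can raise integrability by two
    degrees. *)
Lemma cauchy_moment_Im nu h z : 0 < complex.Im z ->
  nu.-integrable setT (fun x => (h x)%:E) ->
  nu.-integrable setT (fun x => (x ^+ 2 * h x / normc (z - x%:C) ^+ 2)%:E) /\
  \int[nu]_x (x ^+ 2 * h x / normc (z - x%:C) ^+ 2) =
  - complex.Im (cauchy_moment nu (fun x => x * h x) z) / complex.Im z.
Proof.
move=> z0 ih.
have i1 := cintegrable_ratio z0 ih; have i2 := cintegrable_real ih.
have [_ iI] := cintegrableZ z (cintegrableB i1 i2).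
have E x : x ^+ 2 * h x / normc (z - x%:C) ^+ 2 =
    (- (complex.Im z)^-1) * complex.Im (z * ((h x)%:C * (z / (z - x%:C)) - (h x)%:C)).
  have -> : z * ((h x)%:C * (z / (z - x%:C)) - (h x)%:C) =
      (x * h x)%:C * (1 + x%:C * (z - x%:C)^-1).
    rewrite rmorphM /=; field; exact: upper_sub_neq0.
  have := Im_resolvent z x; move: (z - x%:C)^-1 => r Er.
  rewrite !ReImE Er /=; field.
  by rewrite !gt_eqF// normc_gt0 upper_sub_neq0.
have I : nu.-integrable setT (fun x => (x ^+ 2 * h x / normc (z - x%:C) ^+ 2)%:E).
  by under eq_fun do rewrite E; exact: integrable_scale.
split=> //; under eq_Rintegral do rewrite E.
rewrite (RintegralZl _ measurableT iI) mulNr mulrC mulNr; congr (- (_ / _)).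
rewrite -[LHS](Im_cint nu (fun x => z * ((h x)%:C * (z / (z - x%:C)) - (h x)%:C))).
by rewrite cauchy_moment_step// cintZ ?cintB ?cint_real//; exact: cintegrableB.
Qed.

Lemma cauchy_moment_id nu z : 0 < complex.Im z ->
  cauchy_moment nu (fun x => x) z = z * (z * cauchy_transform nu z - 1).
Proof.
move=> z0; have := cauchy_moment_step z0 (integrable_cst nu 1).
rewrite cauchy_moment1// Rintegral_probability_cst => <-.
by congr cauchy_moment; apply/funext => x; rewrite mulr1.
Qed.

Lemma cauchy_moment_powS nu j z : 0 < complex.Im z ->
  nu.-integrable setT (fun x : R => (x ^+ j)%:E) ->
  cauchy_moment nu (fun x => x ^+ j.+1) z =
  z * (cauchy_moment nu (fun x => x ^+ j) z - (\int[nu]_x x ^+ j)%:C).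
Proof.
move=> z0 ij; rewrite -cauchy_moment_step//.
by congr cauchy_moment; apply/funext => x; rewrite exprS.
Qed.

(** The weight [|u|^2 / |u - x|^2] tends to 1 pointwise, so Fatou's lemma yields finiteness of the
    moment and the bound together. *)
Lemma moment_fatou nu h (u : nat -> C) (L : R) : measurable_fun setT h ->
  (forall x, 0 <= h x) -> (forall k, 0 < complex.Im (u k)) ->
  (forall K, \forall k \near \oo, K <= normc (u k)) ->
  (forall k, nu.-integrable setT (fun x => (h x / normc (u k - x%:C) ^+ 2)%:E)) ->
  (fun k => normc (u k) ^+ 2 * \int[nu]_x (h x / normc (u k - x%:C) ^+ 2)) @ \oo --> L ->
  nu.-integrable setT (fun x => (h x)%:E) /\ \int[nu]_x h x <= L.
Proof.
move=> mh h0 u0 u_oo iu uL.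
pose f k (x : R) := (normc (u k) ^+ 2 * (h x / normc (u k - x%:C) ^+ 2))%:E.
have if_ k : nu.-integrable setT (f k) by exact: integrable_scale.
have f_h x : f ^~ x @ \oo --> (h x)%:E.
  have c0 := ccvgV_infty u_oo.
  have c1 : ccvg (fun k => (1 - x%:C * (u k)^-1)^-1) (1 - x%:C * 0)^-1.
    apply: ccvgV; first by rewrite mulr0 subr0 oner_neq0.
    by apply: ccvgB; [exact: ccvg_cst|exact: ccvgZ].
  have := cvg_normc_sqr c1; rewrite mulr0 subr0 invr1 normc1 expr1n => c2.
  have : (fun k => h x * normc (1 - x%:C * (u k)^-1)^-1 ^+ 2) @ \oo --> h x * 1.
    by apply: cvgM => //; exact: cvg_cst.
  rewrite mulr1 => c3; apply: cvg_EFin; first by near=> k.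
  apply: cvg_trans c3; apply: near_eq_cvg; near=> k.
  rewrite /f /= [RHS]mulrCA; congr (_ * _).
  have un := upper_neq0 (u0 k); have ux := upper_sub_neq0 x (u0 k).
  rewrite -expr_div_n -normcV -normcM; congr (normc _ ^+ 2).
  have -> : 1 - x%:C * (u k)^-1 = (u k - x%:C) / u k by field.
  by rewrite invfM invrK mulrC.
have mf k : measurable_fun setT (f k) by case/integrableP: (if_ k).
have f0 k x : setT x -> (0 <= f k x)%E.
  by move=> _; rewrite lee_fin mulr_ge0 ?exprn_ge0 ?normc_ge0// divr_ge0 ?exprn_ge0 ?normc_ge0.
have := fatou nu measurableT mf f0.
have -> : (\int[nu]_x limn_einf (f ^~ x) = \int[nu]_x (h x)%:E)%E.
  by apply: eq_integral => x _; have [-> _] := cvg_limn_einf_sup (f_h x).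
have -> : limn_einf (fun k => \int[nu]_x f k x)%E = L%:E.
  suff /cvg_limn_einf_sup[] : (fun k => \int[nu]_x f k x)%E @ \oo --> L%:E by [].
  have -> : (fun k => \int[nu]_x f k x)%E =
      EFin \o (fun k => normc (u k) ^+ 2 * \int[nu]_x (h x / normc (u k - x%:C) ^+ 2)).
    apply/funext => k /=; rewrite -(RintegralZl _ measurableT (iu k)) /Rintegral fineK//.
    exact: (integrable_fin_num _ (if_ k)).
  by apply: cvg_EFin; [near=> k|exact: uL].
move=> hL.
have ih : nu.-integrable setT (fun x => (h x)%:E).
  apply/integrableP; split; first exact/measurable_EFinP.
  under eq_integral do rewrite abse_EFin ger0_norm//.
  by apply: le_lt_trans hL _; rewrite ltry.
split=> //; rewrite -lee_fin /Rintegral fineK//.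
exact: integrable_fin_num.
Unshelve. all: by end_near. Qed.

Lemma integrable_le nu h g : measurable_fun setT h ->
  nu.-integrable setT (fun x => (g x)%:E) -> (forall x, `|h x| <= g x) ->
  nu.-integrable setT (fun x => (h x)%:E).
Proof.
move=> mh ig hg; apply: (le_integrable _ _ _ ig) => //=; first exact/measurable_EFinP.
by move=> x _; rewrite lee_fin; apply: le_trans (hg x) (ler_norm _).
Qed.

Lemma integrable_pow1 nu : nu.-integrable setT (fun x : R => (x ^+ 2)%:E) ->
  nu.-integrable setT (fun x : R => x%:E).
Proof.
move=> i2; apply: (integrable_le _ (integrable_add (integrable_cst nu 1) i2)) => //.
by move=> x; rewrite ler_norml; apply/andP; split;
  have := sqr_ge0 (x + 1); have := sqr_ge0 (x - 1); nra.
Qed.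

Lemma integrable_pow3 nu : nu.-integrable setT (fun x : R => (x ^+ 2)%:E) ->
  nu.-integrable setT (fun x : R => (x ^+ 4)%:E) ->
  nu.-integrable setT (fun x : R => (`|x| ^+ 3)%:E).
Proof.
move=> i2 i4; have m3 : measurable_fun setT (fun x : R => `|x| ^+ 3).
  by apply: measurable_funX; exact: normr_measurable.
apply: (integrable_le m3 (integrable_add i2 i4)).
move=> x; rewrite ger0_norm ?exprn_ge0//.
rewrite -(real_normK (num_real x)) (_ : 4 = 2 * 2)%N// (exprM x) -(real_normK (num_real x)).
by have := normr_ge0 x; move: `|x| => a a0; have := sqr_ge0 (a * (a - 1)); nra.
Qed.

End moments.

(** * Moments of the free convolution root *)

Section divisor_moments.
Context {R : realType}.
Local Notation C := R[i].
Local Notation law := (probability (measurableTypeR R) R).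
Variables (mu rho : law) (n : nat).
Hypothesis n0 : (0 < n)%N.
Hypothesis i4 : mu.-integrable setT (fun x : R => (x ^+ 4)%:E).
Hypothesis i2 : mu.-integrable setT (fun x : R => (x ^+ 2)%:E).
Hypothesis m1 : \int[mu]_x x = 0.
Hypothesis m2 : \int[mu]_x x ^+ 2 = 1.
Let om w := F_transform mu w + n%:R^-1 * (w - F_transform mu w).
Hypothesis sub : forall w, 0 < complex.Im w ->
  complex.Im w <= complex.Im (om w) /\ cauchy_transform rho (om w) = cauchy_transform mu w.

Let m3 := \int[mu]_x x ^+ 3.
Let m4 := \int[mu]_x x ^+ 4.
Let c : R := 1 - n%:R^-1.
Let w (k : nat) : C := 0 +i* k.+1%:R.
Let z k := om (w k).
Let A k := w k * cauchy_transform mu (w k) - 1.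
(** The relative displacement of [om]: since [F = w / (1 + A)], one finds [om w = w (1 + d)], as
    [zE] states. *)
Let d k := - (c%:C * A k) / (1 + A k).
Let J2 k := cauchy_moment mu (fun x => x ^+ 2) (w k).
Let J4 k := cauchy_moment mu (fun x => x ^+ 4) (w k).

Let nC : (n%:R^-1 : C) = (n%:R^-1 : R)%:C.
Proof. by rewrite fmorphV rmorph_nat. Qed.

Let w0 k : 0 < complex.Im (w k). Proof. by rewrite /= ltr0n. Qed.
Let wN0 k : w k != 0. Proof. exact: upper_neq0 (w0 k). Qed.
Let nw k : normc (w k) = k.+1%:R.
Proof. by rewrite /= expr0n add0r sqrtr_sqr ger0_norm. Qed.

Let wRe k : complex.Re (w k) = 0. Proof. by []. Qed.
Let wIm k : complex.Im (w k) = k.+1%:R. Proof. by []. Qed.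

Let z0 k : 0 < complex.Im (z k).
Proof. by have [h _] := sub (w0 k); exact: lt_le_trans h. Qed.

Let w_oo (K : R) : \forall k \near \oo, K <= normc (w k).
Proof.
near=> k; rewrite nw; apply: (@le_trans _ _ (k%:R)); last by rewrite ler_nat.
by near: k; exact: nbhs_infty_ger.
Unshelve. all: by end_near. Qed.

Let w_cone k : cone 1 (w k).
Proof. by split=> //; rewrite mul1r nw. Qed.

Let i1 : mu.-integrable setT (fun x : R => x%:E).
Proof. exact: integrable_pow1. Qed.

Let i3 : mu.-integrable setT (fun x : R => (x ^+ 3)%:E).
Proof.
apply: (integrable_le _ (integrable_pow3 i2 i4)); first exact: measurable_funX.
by move=> x; rewrite normrX.
Qed.

Let J2E k : J2 k = w k ^+ 2 * A k.
Proof.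
rewrite /J2 cauchy_moment_powS//; under [in X in _ * (X - _)]eq_fun do rewrite expr1.
by rewrite cauchy_moment_id// (_ : \int[mu]_x x ^+ 1 = 0)// subr0 mulrA.
Qed.

Let J4E k : w k ^+ 2 * (J2 k - 1) = m3%:C * w k + J4 k.
Proof.
by rewrite /J4 cauchy_moment_powS// cauchy_moment_powS// m2 -/(J2 k) -/m3 rmorph1; ring.
Qed.

Let J2_cvg : ccvg J2 1.
Proof.
rewrite -(rmorph1 (real_complex R)) -m2; apply: (cauchy_moment_cvg ltr01) => //.
by near=> k; exact: w_cone.
Unshelve. all: by end_near. Qed.

Let J4_cvg : ccvg J4 m4%:C.
Proof.
apply: (cauchy_moment_cvg ltr01) => //.
by near=> k; exact: w_cone.
Unshelve. all: by end_near. Qed.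

Let wV_cvg : ccvg (fun k => (w k)^-1) 0.
Proof. exact: ccvgV_infty. Qed.

Let A_cvg : ccvg A 0.
Proof.
have -> : A = fun k => J2 k * ((w k)^-1 * (w k)^-1).
  by apply/funext => k; rewrite J2E; field.
by have := ccvgM J2_cvg (ccvgM wV_cvg wV_cvg); rewrite !mulr0.
Qed.

Let AE k : 1 + A k = w k * cauchy_transform mu (w k).
Proof. by rewrite /A addrC subrK. Qed.

Let A1 k : 1 + A k != 0.
Proof. by rewrite AE mulf_neq0// cauchy_neq0. Qed.

Let A1_cvg : ccvg (fun k => (1 + A k)^-1) 1.
Proof.
rewrite -[X in ccvg _ X]invr1; apply: ccvgV; first exact: oner_neq0.
by rewrite -[X in ccvg _ X](addr0 1); apply: ccvgD => //; exact: ccvg_cst.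
Qed.

Let d2_cvg : ccvg (fun k => w k ^+ 2 * d k) (- c%:C).
Proof.
have -> : (fun k => w k ^+ 2 * d k) = fun k => - c%:C * (J2 k * (1 + A k)^-1).
  by apply/funext => k; rewrite J2E /d; ring.
rewrite -[X in ccvg _ X]mulr1 -[X in ccvg _ (_ * X)]mulr1.
by apply: ccvgZ; exact: ccvgM.
Qed.

Let wd_cvg : ccvg (fun k => w k * d k) 0.
Proof.
have -> : (fun k => w k * d k) = fun k => w k ^+ 2 * d k * (w k)^-1.
  by apply/funext => k; field.
by rewrite -[X in ccvg _ X](mulr0 (- c%:C)); exact: ccvgM.
Qed.

Let d_cvg : ccvg d 0.
Proof.
have -> : d = fun k => w k * d k * (w k)^-1 by apply/funext => k; field.
by rewrite -[X in ccvg _ X](mulr0 0); exact: ccvgM.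
Qed.

Let d1_cvg : ccvg (fun k => 1 + d k) 1.
Proof.
by rewrite -[X in ccvg _ X](addr0 1); apply: ccvgD => //; exact: ccvg_cst.
Qed.

Let zE k : z k = w k * (1 + d k).
Proof.
have G0 := cauchy_neq0 (w0 k) i2 m2; have A10 := A1 k.
have FE : F_transform mu (w k) = w k / (1 + A k).
  by rewrite AE /F_transform invfM mulrA mulfV// mul1r.
rewrite /z /om FE /d /c rmorphB rmorph1 /= -nC; field.
by rewrite A10 pnatr_eq0 -lt0n n0.
Qed.

(** [G_rho (z) = G_mu (w) = 1 / F], and [z - F = (w - F) / n]; hence [z / F - 1] is [w / F - 1]
    divided by [n]. All factors [1 / n] in the moments of [rho] come from here. *)
Let A_rho k : z k * cauchy_transform rho (z k) - 1 = n%:R^-1 * A k.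
Proof.
have [_ ->] := sub (w0 k); have G0 := cauchy_neq0 (w0 k) i2 m2.
rewrite -/(z k) /z /om /A /F_transform mulrDl mulVf//.
have -> : n%:R^-1 * (w k - (cauchy_transform mu (w k))^-1) * cauchy_transform mu (w k) =
  n%:R^-1 * (w k * cauchy_transform mu (w k) -
    (cauchy_transform mu (w k))^-1 * cauchy_transform mu (w k)) by ring.
by rewrite mulVf//; ring.
Qed.

Let d_half : \forall k \near \oo, normc (d k) <= 1 / 2.
Proof.
have h : 0 < 1 / 2 :> R by rewrite divr_gt0.
have := ccvg_dist d_cvg h; apply: filterS => k; rewrite subr0; exact: ltW.
Qed.

Let z_lb k : normc (d k) <= 1 / 2 -> normc (w k) / 2 <= normc (z k).
Proof.
move=> dk; rewrite zE normcM ler_wpM2l ?normc_ge0//.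
have := normc_lb 1 (- d k); rewrite normcN opprK normc1; lra.
Qed.

Let z_oo (K : R) : \forall k \near \oo, K <= normc (z k).
Proof.
near=> k; apply: (@le_trans _ _ (normc (w k) / 2)); last first.
  by apply: z_lb; near: k; exact: d_half.
rewrite ler_pdivlMr//; near: k; exact: w_oo.
Unshelve. all: by end_near. Qed.

(** With [|d| <= 1 / 2], [Im z >= |w| / 2] and [|z| <= (3 / 2) |w|], so any aperture up to [1 / 3]
    works. *)
Let z_cone : \forall k \near \oo, cone (1 / 4) (z k).
Proof.
near=> k; have dk : normc (d k) <= 1 / 2 by near: k; exact: d_half.
split; first exact: upper_neq0 (z0 k).
have /ler_normlP[h _] := le_trans (normc_Re (d k)) dk.
have h2 := normcD 1 (d k); rewrite normc1 in h2.
rewrite zE normcM nw cImM wRe wIm mul0r add0r cReD.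
have k0 : 0 < k.+1%:R :> R by rewrite ltr0n.
rewrite mulrCA; apply: ler_wpM2l; first exact: ltW.
by rewrite (_ : complex.Re 1 = 1)//; lra.
Unshelve. all: by end_near. Qed.

(* [w k] is purely imaginary, so [Im ((1 + d) X / w)] is minus a real part. *)
Let ratioE k (X : C) :
  normc (z k) ^+ 2 * (- complex.Im ((1 + d k) * X / w k) / complex.Im (z k)) =
  normc (1 + d k) ^+ 2 * complex.Re ((1 + d k) * X) / complex.Re (1 + d k).
Proof.
have k0 : k.+1%:R != 0 :> R by rewrite pnatr_eq0.
have zI : complex.Im (z k) = k.+1%:R * complex.Re (1 + d k).
  by rewrite zE cImM wRe wIm mul0r add0r.
have dR : complex.Re (1 + d k) != 0.
  have := z0 k; rewrite zI => h; apply: contraTneq h => ->.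
  by rewrite mulr0 ltxx.
have -> : complex.Im ((1 + d k) * X / w k) = - complex.Re ((1 + d k) * X) / k.+1%:R.
  rewrite cImM cReV cImV nw wRe wIm mul0r mulr0 addr0; field.
  by rewrite nat1r.
rewrite zI zE normcM nw; field.
by rewrite nat1r k0 dR.
Qed.

Let ratio_cvg (X : nat -> C) (x : R) :
  (fun k => complex.Re ((1 + d k) * X k)) @ \oo --> x ->
  (fun k => normc (z k) ^+ 2 * (- complex.Im ((1 + d k) * X k / w k) / complex.Im (z k)))
    @ \oo --> x.
Proof.
move=> Xx; under eq_fun do rewrite ratioE.
have [hR _] := d1_cvg.
have := cvg_normc_sqr d1_cvg; rewrite normc1 expr1n => hn.
rewrite (_ : x = 1 * x * 1^-1); last by rewrite invr1 mulr1 mul1r.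
by apply: cvgM; [exact: cvgM|apply: cvgV => //; rewrite oner_neq0].
Qed.

(** The first use of Fatou, starting from [h = 1], the only function known to be integrable for
    [rho] at this point. *)
Let rho_sq : rho.-integrable setT (fun x : R => (x ^+ 2)%:E).
Proof.
have H k := cauchy_moment_Im (z0 k) (integrable_cst rho 1).
have E k : cauchy_moment rho (fun x => x * 1) (z k) = n%:R^-1 * ((1 + d k) * J2 k / w k).
  rewrite (_ : (fun x => x * 1) = id); last by apply/funext => x; rewrite mulr1.
  by rewrite cauchy_moment_id// A_rho J2E zE; field; rewrite wN0 pnatr_eq0 -lt0n.
have := @moment_fatou _ rho (fun x => x ^+ 2) z (n%:R^-1 * 1).
case=> //.
- by move=> x; rewrite sqr_ge0.
- move=> k; have [h _] := H k.
  by under eq_fun do rewrite -[X in (X / _)%:E]mulr1.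
have -> : (fun k => normc (z k) ^+ 2 * \int[rho]_x (x ^+ 2 / normc (z k - x%:C) ^+ 2)) =
  fun k => n%:R^-1 * (normc (z k) ^+ 2 *
    (- complex.Im ((1 + d k) * J2 k / w k) / complex.Im (z k))).
  apply/funext => k; have [_ h] := H k.
  under eq_Rintegral do rewrite -[X in X / _]mulr1.
  by rewrite h E nC cImMr; ring.
apply: cvgM; first exact: cvg_cst.
apply: ratio_cvg; have [h _] := ccvgM d1_cvg J2_cvg.
by rewrite mulr1 in h.
Qed.

Let rho_i1 : rho.-integrable setT (fun x : R => x%:E).
Proof. exact: integrable_pow1. Qed.

Let rho_J1 k : cauchy_moment rho (fun x => x) (z k) = n%:R^-1 * (z k * A k).
Proof. by rewrite cauchy_moment_id// A_rho; ring. Qed.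

(** Once integrability is known, the limit in a cone gives the exact value; the same scheme gives
    the variance. *)
Let rho_mean : \int[rho]_x x = 0.
Proof.
have k0 : 0 < 1 / 4 :> R by rewrite divr_gt0.
have h1 := cauchy_moment_cvg k0 rho_i1 z_cone z_oo.
have h2 : ccvg (fun k => cauchy_moment rho (fun x => x) (z k)) 0.
  have -> : (fun k => cauchy_moment rho (fun x => x) (z k)) =
      fun k => n%:R^-1 * ((1 + d k) * J2 k * (w k)^-1).
    by apply/funext => k; rewrite rho_J1 zE J2E; field; rewrite wN0 pnatr_eq0 -lt0n.
  rewrite -(mulr0 n%:R^-1); apply: ccvgZ.
  rewrite -(mulr0 (1 * 1)); apply: ccvgM => //; exact: ccvgM.
by have [] := ccvg_unique h1 h2.
Qed.

Let rho_J2 k : cauchy_moment rho (fun x => x ^+ 2) (z k) =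
  n%:R^-1 * ((1 + d k) ^+ 2 * J2 k).
Proof.
rewrite cauchy_moment_powS//; under [in X in _ * (X - _)]eq_fun do rewrite expr1.
rewrite rho_J1 (_ : \int[rho]_x x ^+ 1 = 0)// J2E zE subr0.
by field; rewrite pnatr_eq0 -lt0n.
Qed.

Let rho_var : \int[rho]_x x ^+ 2 = n%:R^-1.
Proof.
have k0 : 0 < 1 / 4 :> R by rewrite divr_gt0.
have h1 := cauchy_moment_cvg k0 rho_sq z_cone z_oo.
have h2 : ccvg (fun k => cauchy_moment rho (fun x => x ^+ 2) (z k)) (n%:R^-1)%:C.
  under eq_fun do rewrite rho_J2 expr2.
  rewrite -nC -[X in ccvg _ X]mulr1 -[X in ccvg _ (_ * X)]mulr1 -[X in ccvg _ (_ * (X * _))]mulr1.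
  by apply: ccvgZ; apply: ccvgM => //; exact: ccvgM.
by have [] := ccvg_unique h1 h2.
Qed.

(** The second use of Fatou, now from [h = x ^+ 2]. The correction [- 2 * c] is the limit of
    [J2 w^2 ((1 + d)^2 - 1)], because [J2] tends to 1 and [w^2 d] to [- c]. *)
Let rho_fourth : rho.-integrable setT (fun x : R => (x ^+ 4)%:E) /\
  \int[rho]_x x ^+ 4 <= n%:R^-1 * (m4 - 2 * c).
Proof.
have H k := cauchy_moment_Im (z0 k) rho_sq.
pose E' k := J4 k + J2 k * (w k ^+ 2 * d k * (1 + 1 + d k)).
have E k : cauchy_moment rho (fun x => x * x ^+ 2) (z k) =
    n%:R^-1 * ((1 + d k) * (m3%:C * w k + E' k) / w k).
  rewrite (_ : (fun x => _) = fun x : R => x ^+ 3); last by apply/funext => x; rewrite -exprS.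
  rewrite cauchy_moment_powS// rho_J2 rho_var -nC zE /E' addrA -J4E.
  by field; rewrite wN0 pnatr_eq0 -lt0n.
have E'_cvg : ccvg E' (m4 - 2 * c)%:C.
  have -> : (m4 - 2 * c)%:C = m4%:C + 1 * (- c%:C * (1 + 1 + 0)).
    by rewrite rmorphB rmorphM /= rmorph_nat; ring.
  apply: ccvgD => //; apply: ccvgM => //; apply: ccvgM => //.
  by apply: ccvgD => //; exact: ccvg_cst.
apply: (@moment_fatou _ rho (fun x => x ^+ 4) z) => //.
- by move=> x; rewrite exprn_even_ge0.
- move=> k; have [h _] := H k.
  by under eq_fun do rewrite (_ : 4 = 2 + 2)%N// exprD.
have -> : (fun k => normc (z k) ^+ 2 * \int[rho]_x (x ^+ 4 / normc (z k - x%:C) ^+ 2)) =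
  fun k => n%:R^-1 * (normc (z k) ^+ 2 *
    (- complex.Im ((1 + d k) * (m3%:C * w k + E' k) / w k) / complex.Im (z k))).
  apply/funext => k; have [_ h] := H k.
  under eq_Rintegral do rewrite (_ : 4 = 2 + 2)%N// exprD.
  by rewrite h E nC cImMr; ring.
apply: cvgM; first exact: cvg_cst.
apply: ratio_cvg.
(* The divergent term [m3 w] is purely imaginary and disappears from the real part; of the third
   moment only [m3 w d] remains, and it tends to 0. *)
have -> : (fun k => complex.Re ((1 + d k) * (m3%:C * w k + E' k))) =
    fun k => complex.Re (m3%:C * (w k * d k) + (1 + d k) * E' k).
  apply/funext => k.
  have -> : (1 + d k) * (m3%:C * w k + E' k) =
      m3%:C * w k + (m3%:C * (w k * d k) + (1 + d k) * E' k) by ring.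
  by rewrite cReD (cReM m3%:C (w k)) wRe mulr0 mul0r subr0 add0r.
have [h _] := ccvgD (ccvgZ m3%:C wd_cvg) (ccvgM d1_cvg E'_cvg).
by rewrite mulr0 mul1r add0r in h.
Qed.

(** In the last bound [m4 - 2] is the fourth free cumulant of [mu], and [2 / n] is [n] times twice
    the squared variance of [rho]. *)
Lemma divisor_moments :
  [/\ rho.-integrable setT (fun x : R => (x ^+ 2)%:E),
      rho.-integrable setT (fun x : R => (x ^+ 4)%:E),
      \int[rho]_x x = 0, \int[rho]_x x ^+ 2 = n%:R^-1 &
      n%:R * \int[rho]_x x ^+ 4 <= m4 - 2 + 2 * n%:R^-1].
Proof.
have [j4 b4] := rho_fourth; split=> //.
rewrite -ler_pdivlMl ?ltr0n//; apply: le_trans b4 _.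
by rewrite le_eqVlt; apply/orP; left; apply/eqP; congr (_ * _); rewrite /c; ring.
Qed.

End divisor_moments.

(** * The approximate quadratic equation for [F], with explicit error *)

Section cauchy_limit.
Context {R : realType}.
Local Notation C := R[i].
Local Notation law := (probability (measurableTypeR R) R).

(** The arithmetic-geometric form of Cauchy-Schwarz, from [(a (a - l))^2 >= 0]; the free parameter
    [l] replaces a square root. *)
Lemma third_moment_le (nu : law) (l : R) : 0 < l ->
  nu.-integrable setT (fun x : R => (x ^+ 2)%:E) ->
  nu.-integrable setT (fun x : R => (x ^+ 4)%:E) ->
  \int[nu]_x `|x| ^+ 3 <= l / 2 * \int[nu]_x x ^+ 2 + (2 * l)^-1 * \int[nu]_x x ^+ 4.
Proof.
move=> l0 i2 i4; have i3 := integrable_pow3 i2 i4.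
rewrite -(RintegralZl _ measurableT i2) -(RintegralZl _ measurableT i4).
rewrite -RintegralD//; [|exact: integrable_scale|exact: integrable_scale].
apply: le_Rintegral => //.
  by apply: integrable_add; exact: integrable_scale.
move=> x _; rewrite (_ : 4 = 2 * 2)%N// (exprM x) -(real_normK (num_real x)).
rewrite -subr_ge0; move: `|x| => a.
have -> : l / 2 * a ^+ 2 + (2 * l)^-1 * (a ^+ 2) ^+ 2 - a ^+ 3 =
    (2 * l)^-1 * (a * (a - l)) ^+ 2 by field; rewrite gt_eqF.
by rewrite mulr_ge0 ?sqr_ge0// invr_ge0 mulr_ge0// ltW.
Qed.

Variables (mu rho : law) (n : nat).
Hypothesis n0 : (0 < n)%N.
Hypothesis i4 : mu.-integrable setT (fun x : R => (x ^+ 4)%:E).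
Hypothesis i2 : mu.-integrable setT (fun x : R => (x ^+ 2)%:E).
Hypothesis m1 : \int[mu]_x x = 0.
Hypothesis m2 : \int[mu]_x x ^+ 2 = 1.
Let om w := F_transform mu w + n%:R^-1 * (w - F_transform mu w).
Hypothesis sub : forall w, 0 < complex.Im w ->
  complex.Im w <= complex.Im (om w) /\ cauchy_transform rho (om w) = cauchy_transform mu w.

(* With [A = w / F - 1], the quantity [(om w)^2 A - 1] is a third-moment remainder of
   [rho], and [om w] differs from [F] by [(w - F) / n]. *)
Lemma cauchy_approx_quadratic w (v := complex.Im w) (F := F_transform mu w)
    (D := normc w + 2 * (normc w ^+ 2 + 1) / v) : 0 < v ->
  normc (F * (w - F) - 1) <=
  2 * (n%:R * \int[rho]_x `|x| ^+ 3) / v + 3 * D ^+ 3 / (n%:R * v).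
Proof.
move=> v0; have [r2 r4 rm1 rm2 _] := divisor_moments n0 i4 i2 m1 m2 sub.
have [Im_om G_om] := sub v0.
have r1 := integrable_pow1 r2; have r3 := integrable_pow3 r2 r4.
have G0 := cauchy_neq0 v0 i2 m2.
have F_ge := Im_F_ge v0 i2 m2; rewrite -/F -/v in F_ge.
have G_ge := Im_cauchy_le v0 i2 m2; rewrite -/v in G_ge.
have nR : 0 < n%:R :> R by rewrite ltr0n.
have nC : n%:R != 0 :> C by rewrite pnatr_eq0 -lt0n.
set G := cauchy_transform mu w in G0 G_ge G_om.
have FE : F = G^-1 by [].
have FG : F * G = 1 by rewrite FE mulVf.
set z := om w in Im_om G_om.
have z0 : 0 < complex.Im z by exact: lt_le_trans Im_om.
pose A := w * G - 1.
have zE : z = F + n%:R^-1 * (w - F) by [].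
have A_rho : z * cauchy_transform rho z - 1 = n%:R^-1 * A.
  rewrite G_om zE mulrDl FG /A.
  by rewrite -mulrA mulrBl FG; ring.
have bound1 : normc (z ^+ 2 * A - 1) <= 2 * (n%:R * \int[rho]_x `|x| ^+ 3) / v.
  have E : cauchy_moment rho (fun x => x ^+ 2) z = n%:R^-1 * (z ^+ 2 * A).
    rewrite cauchy_moment_powS// cauchy_moment_id// A_rho.
    by rewrite (_ : \int[rho]_x x ^+ 1 = 0)// subr0; ring.
  have iJ := cintegrable_ratio z0 r2; have iC := cintegrable_real r2.
  have B : normc (cauchy_moment rho (fun x => x ^+ 2) z - (\int[rho]_x x ^+ 2)%:C) <=
      2 * (v^-1 * \int[rho]_x `|x| ^+ 3).
    rewrite -cint_real -cintB// -(RintegralZl _ measurableT r3).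
    apply: normc_cint_le; [exact: cintegrableB|exact: integrable_scale|].
    move=> x; have -> : (x ^+ 2)%:C * (z / (z - x%:C)) - (x ^+ 2)%:C =
        (z - x%:C)^-1 * (x ^+ 3)%:C.
      by rewrite !rmorphXn /=; field; exact: upper_sub_neq0.
    rewrite normcM normc_real normrX ler_wpM2r ?exprn_ge0//.
    by apply: le_trans (resolvent_le x z0) _; rewrite lef_pV2.
  have -> : z ^+ 2 * A - 1 = n%:R * (cauchy_moment rho (fun x => x ^+ 2) z - (\int[rho]_x x ^+ 2)%:C).
    by rewrite E rm2 fmorphV rmorph_nat; field.
  have -> : 2 * (n%:R * \int[rho]_x `|x| ^+ 3) / v =
      n%:R * (2 * (v^-1 * \int[rho]_x `|x| ^+ 3)) by ring.
  have -> : (n%:R : C) = (n%:R : R)%:C by rewrite rmorph_nat.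
  by rewrite normcM normc_real ger0_norm ?(ltW nR)// ler_wpM2l// ltW.
have Fv : v <= normc F.
  by apply: le_trans F_ge _; apply: le_trans (normc_Im _); exact: ler_norm.
have F0 : F != 0 by rewrite FE invr_eq0.
have Fn : 0 < normc F by rewrite normc_gt0.
pose B := 2 * (normc w ^+ 2 + 1) / v.
have w2 : 0 < normc w ^+ 2 + 1 by rewrite ltr_wpDl// exprn_ge0// normc_ge0.
have B0 : 0 < B by rewrite divr_gt0// mulr_gt0.
(* [|F| = 1 / |G|], and [Im_cauchy_le] bounds [|G|] from below through its imaginary part. *)
have FB : normc F <= B.
  rewrite FE normcV -[B]invrK lef_pV2 ?posrE ?invr_gt0// ?normc_gt0//.
  rewrite /B invfM invrK mulrC; apply: le_trans G_ge _.
  by apply: le_trans (normc_Im _); rewrite -normrN; exact: ler_norm.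
have DE : D = normc w + B by [].
have D0 : 0 < D by rewrite DE ltr_wpDl ?normc_ge0.
have wF : normc (w - F) <= D by apply: le_trans (normcB _ _) _; rewrite DE lerD2l.
have FD : normc F <= D by apply: le_trans FB _; rewrite DE lerDr normc_ge0.
have n1 : normc (n%:R^-1 : C) = n%:R^-1.
  have -> : n%:R^-1 = (n%:R^-1 : R)%:C :> C by rewrite fmorphV rmorph_nat.
  by rewrite normc_real ger0_norm// invr_ge0 ltW.
have n1' : n%:R^-1 <= 1 :> R by rewrite invf_le1// ler1n.
(* [F (w - F) = F^2 A], so replacing [F] by [z] costs [(z^2 - F^2) A = (z - F) (F + z) A], with
   [z - F = (w - F) / n] and [A = (w - F) / F]. *)
have -> : F * (w - F) - 1 = (z ^+ 2 * A - 1) - n%:R^-1 * (w - F) * (F + z) * ((w - F) / F).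
  have -> : A = (w - F) / F by rewrite /A mulrBl mulfV// FE invrK.
  by rewrite zE; field; rewrite F0 nC.
apply: le_trans (normcB _ _) _; apply: lerD bound1 _.
have zD : normc (F + z) <= 3 * D.
  rewrite zE addrA; apply: le_trans (normcD _ _) _.
  have h1 := normcD F F.
  have h2 : normc (n%:R^-1 * (w - F)) <= D.
    rewrite normcM n1; apply: le_trans wF; rewrite ler_piMl ?normc_ge0//.
  by lra.
rewrite !normcM (normcV F) n1.
have -> : 3 * D ^+ 3 / (n%:R * v) = n%:R^-1 * D * (3 * D) * (D / v).
  by field; rewrite !gt_eqF.
apply: ler_pM; rewrite ?mulr_ge0 ?normc_ge0 ?invr_ge0 ?(ltW nR) ?(ltW Fn)//.
  apply: ler_pM; rewrite ?mulr_ge0 ?normc_ge0 ?invr_ge0 ?(ltW nR)//.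
  by rewrite ler_wpM2l// invr_ge0 ltW.
by apply: ler_pM; rewrite ?normc_ge0 ?invr_ge0 ?(ltW Fn)// lef_pV2.
Qed.

(* [F * (w - F) - 1 = - (F - q) (F - q^-1)], and [F] stays away from the root [q]
   of negative imaginary part. *)
Lemma cauchy_approx w q (v := complex.Im w)
    (D := normc w + 2 * (normc w ^+ 2 + 1) / v) : 0 < v ->
  q != 0 -> complex.Im q <= 0 -> q + q^-1 = w ->
  normc (cauchy_transform mu w - q) <=
  (2 * (n%:R * \int[rho]_x `|x| ^+ 3) / v + 3 * D ^+ 3 / (n%:R * v)) / v ^+ 3.
Proof.
move=> v0 q0 qI qw; have h := cauchy_approx_quadratic v0.
have F_ge := Im_F_ge v0 i2 m2.
have G0 := cauchy_neq0 v0 i2 m2.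
set F := F_transform mu w in h F_ge.
have F0 : F != 0 by rewrite invr_eq0.
have Fv : v <= normc F.
  by apply: le_trans F_ge _; apply: le_trans (normc_Im _); exact: ler_norm.
have qv : v <= normc q^-1.
  apply: le_trans (normc_Im _); apply: le_trans (ler_norm _).
  by rewrite /v -qw cImD; lra.
have Fq : v <= normc (F - q).
  by apply: le_trans (normc_Im _); apply: le_trans (ler_norm _); rewrite cImD cImN; lra.
(* Each of the three factors of the denominator has modulus at least [v]: for [F - q] and [q^-1]
   this uses [Im q <= 0], which selects the root. *)
have GE : cauchy_transform mu w - q = (F * (w - F) - 1) / ((F - q) * F * q^-1).
  have Fq0 : F - q != 0 by rewrite -normc_gt0; exact: lt_le_trans Fq.
  have -> : cauchy_transform mu w = F^-1 by rewrite /F /F_transform invrK.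
  by rewrite -qw; field; rewrite q0 F0 Fq0.
rewrite GE normcM normcV !normcM; apply: ler_pM; rewrite ?normc_ge0 ?invr_ge0//.
  by rewrite !mulr_ge0 ?normc_ge0.
have v3 : v ^+ 3 = v * v * v by ring.
rewrite lef_pV2 ?posrE ?exprn_gt0//; last first.
  by rewrite !mulr_gt0//; exact: lt_le_trans v0 _.
by rewrite v3 !ler_pM ?mulr_ge0 ?(ltW v0).
Qed.

End cauchy_limit.

(** * Pointwise limit of the Cauchy transforms *)

Section cauchy_limit_sequence.
Context {R : realType}.
Local Notation C := R[i].
Local Notation law := (probability (measurableTypeR R) R).
Variable mu : nat -> law.
Hypothesis mean0 : forall n, (1 <= n)%N -> 'E_(mu n)[idfun : R -> R]%E = 0%E.
Hypothesis var1 : forall n, (1 <= n)%N -> 'V_(mu n)[idfun : R -> R]%E = 1%E.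
Hypothesis div : forall n, (1 <= n)%N -> free_divisible n (mu n).
Hypothesis moment4 : 'E_(mu n)[(fun x : R => x ^+ 4)%R]%E @[n --> \oo] --> 2%:E.

(** The moments in the hypotheses are extended-real integrals; integrability of [x ^+ 2] is deduced
    from the finiteness of the variance. *)
Let mu_i2 n : (1 <= n)%N -> (mu n).-integrable setT (fun x : R => (x ^+ 2)%:E) /\
  \int[mu n]_x x ^+ 2 = 1.
Proof.
move=> n1; have := var1 n1; rewrite /variance unlock mean0//= unlock => V1.
have {}V1 : (\int[mu n]_x (x ^+ 2)%:E = 1)%E.
  rewrite -V1; apply: eq_integral => x _ /=.
  by rewrite -[RHS]/(((x - 0) * (x - 0))%:E) subr0 expr2.
split; last by rewrite /Rintegral V1.
apply/integrableP; split; first exact/measurable_EFinP/measurable_funX.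
under eq_integral do rewrite abse_EFin ger0_norm ?sqr_ge0//.
by rewrite V1 ltry.
Qed.

Let mu_mean n : (1 <= n)%N -> \int[mu n]_x x = 0.
Proof. by move=> n1; have := mean0 n1; rewrite unlock /Rintegral => ->. Qed.

(** Only eventually: finitely many fourth moments may be infinite although the sequence converges to
    2. *)
Let mu_i4 : \forall n \near \oo, (mu n).-integrable setT (fun x : R => (x ^+ 4)%:E).
Proof.
have /fine_cvgP[fin _] := moment4; near=> n.
apply/integrableP; split; first exact/measurable_EFinP/measurable_funX.
under eq_integral do rewrite abse_EFin ger0_norm ?exprn_even_ge0//.
have : 'E_(mu n)[(fun x : R => x ^+ 4)%R]%E \is a fin_num by near: n.
by rewrite unlock fin_numElt => /andP[].
Unshelve. all: by end_near. Qed.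

Let mu_m4 (e : R) : 0 < e -> \forall n \near \oo, \int[mu n]_x x ^+ 4 - 2 < e.
Proof.
move=> e0; have /fine_cvgP[_ /cvgrPdist_lt/(_ _ e0)] := moment4.
apply: filterS => n /=; rewrite unlock distrC; apply: le_lt_trans; exact: ler_norm.
Qed.

Lemma cauchy_transform_cvg w q : 0 < complex.Im w -> q != 0 -> complex.Im q <= 0 ->
  q + q^-1 = w -> ccvg (fun n => cauchy_transform (mu n) w) q.
Proof.
move=> w0 q0 qI qw; apply: ccvgP => e e0.
pose v := complex.Im w.
pose D := normc w + 2 * (normc w ^+ 2 + 1) / v.
have v30 : 0 < v ^+ 3 by rewrite exprn_gt0.
(* Makes the first error [2 l / v] equal to [e v^3 / 4]; the second is kept below [e v^3 / 2], and
   [cauchy_approx] divides the sum by [v^3]. *)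
pose l := e * v ^+ 3 * v / 8.
have l0 : 0 < l by rewrite divr_gt0// !mulr_gt0.
have inv_small (r : R) : 0 < r -> \forall n \near \oo, n%:R^-1 < r.
  move=> r0; near=> n.
  have rn : r^-1 + 1 <= n%:R by near: n; exact: nbhs_infty_ger.
  have r1 : 0 < r^-1 by rewrite invr_gt0.
  by rewrite -[r]invrK ltf_pV2 ?posrE; lra.
pose K := 3 * D ^+ 3 / v.
have D0 : 0 < D.
  by rewrite ltr_wpDl ?normc_ge0// divr_gt0// mulr_gt0// ltr_wpDl ?exprn_ge0 ?normc_ge0.
have K0 : 0 < K by rewrite divr_gt0// mulr_gt0// exprn_gt0.
near=> n.
have n2 : (1 < n)%N by near: n; exact: nbhs_infty_gt.
have n1 : (1 <= n)%N by exact: ltnW.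
have [rho pw] := div n1.
have [i2 m2] := mu_i2 n1; have m1 := mu_mean n1.
have i4 : (mu n).-integrable setT (fun x : R => (x ^+ 4)%:E) by near: n.
have [Y ray] := free_power_ray n2 pw.
have sub := subordination n1 i2 m2 ray.
have [r2 r4 rm1 rm2 rm4] := divisor_moments n1 i4 i2 m1 m2 sub.
have nR : 0 < n%:R :> R by rewrite ltr0n.
have third : n%:R * \int[rho]_x `|x| ^+ 3 <= l.
  have := ler_wpM2l (ltW nR) (third_moment_le l0 r2 r4).
  have -> : n%:R * (l / 2 * \int[rho]_x x ^+ 2 + (2 * l)^-1 * \int[rho]_x x ^+ 4) =
      l / 2 + (2 * l)^-1 * (n%:R * \int[rho]_x x ^+ 4).
    by rewrite rm2; field; rewrite !gt_eqF.
  move=> /le_trans; apply.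
  (* Together with [2 / n < l^2 / 2] this gives [n m4(rho) <= l^2], so that both terms of
     [third_moment_le], scaled by [n], are at most [l / 2]. *)
  have m4 : \int[mu n]_x x ^+ 4 - 2 < l ^+ 2 / 2.
    by near: n; apply: mu_m4; rewrite divr_gt0// exprn_gt0.
  have n4 : n%:R^-1 < l ^+ 2 / 4 by near: n; apply: inv_small; rewrite divr_gt0// exprn_gt0.
  have h : n%:R * \int[rho]_x x ^+ 4 <= l ^+ 2 by lra.
  have : (2 * l)^-1 * (n%:R * \int[rho]_x x ^+ 4) <= (2 * l)^-1 * l ^+ 2.
    by rewrite ler_wpM2l// invr_ge0 mulr_ge0// ltW.
  have -> : (2 * l)^-1 * l ^+ 2 = l / 2 by field; rewrite gt_eqF.
  by lra.
apply: le_lt_trans (cauchy_approx n1 i4 i2 m1 m2 sub w0 q0 qI qw) _.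
rewrite -/v -/D ltr_pdivrMr//.
have nK : n%:R^-1 < e * v ^+ 3 / 2 / K.
  by near: n; apply: inv_small; rewrite divr_gt0// divr_gt0// mulr_gt0.
have -> : 3 * D ^+ 3 / (n%:R * v) = n%:R^-1 * K.
  by rewrite /K; field; rewrite !gt_eqF.
rewrite ltr_pdivlMr// in nK.
have : 2 * (n%:R * \int[rho]_x `|x| ^+ 3) / v <= 2 * l / v.
  by rewrite ler_wpM2r ?invr_ge0 ?(ltW w0)// ler_wpM2l.
have -> : 2 * l / v = e * v ^+ 3 / 4 by rewrite /l; field; rewrite gt_eqF.
have := mulr_gt0 e0 v30; lra.
Unshelve. all: by end_near. Qed.

End cauchy_limit_sequence.

(** * Poisson smoothing and Tonelli *)

Section poisson_smoothing.
Context {R : realType}.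
Local Notation C := R[i].
Local Notation law := (probability (measurableTypeR R) R).
Local Notation leb := (@lebesgue_measure R).
Implicit Types (mu : law) (f : R -> R) (e x t : R).

(** [semicircle_prob] is defined by its values on sets; the density is recovered as the
    Radon-Nikodym derivative, which agrees almost everywhere with [semicircle_pdf]. *)
Lemma integral_semicircle f : measurable_fun setT f -> (forall x, 0 <= f x) ->
  (\int[semicircle_prob (R:=R)]_x (f x)%:E = \int[leb]_x (f x * semicircle_pdf x)%:E)%E.
Proof.
move=> mf f0; pose S : {finite_measure set _ -> \bar R} := semicircle_prob (R:=R).
have mpdf : measurable_fun setT (fun x : R => (semicircle_pdf x)%:E).
  by apply/measurable_EFinP; exact: measurable_semicircle_pdf.
have dom : S `<< leb.
  apply/null_content_dominatesP => A mA A0.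
  by rewrite /S /= /semicircle_prob null_set_integral//; exact: measurable_funTS.
have ae : ae_eq leb setT (Radon_Nikodym_SigmaFinite.f S leb)
    (fun x => (semicircle_pdf x)%:E).
  apply: integral_ae_eq => //; first exact: Radon_Nikodym_SigmaFinite.f_integrable.
  by move=> E _ mE; rewrite -Radon_Nikodym_SigmaFinite.f_integral.
have mRN : measurable_fun setT (Radon_Nikodym_SigmaFinite.f S leb).
  exact: measurable_int (Radon_Nikodym_SigmaFinite.f_integrable dom).
have mfE : measurable_fun setT (fun x => (f x)%:E) by exact/measurable_EFinP.
rewrite -(Radon_Nikodym_SigmaFinite.change_of_variables dom _ measurableT mfE)//.
apply: ae_eq_integral => //.
- exact: emeasurable_funM.
- by apply/measurable_EFinP/measurable_funM => //; exact: measurable_semicircle_pdf.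
- apply: filterS ae => x + xT => /(_ xT) /= ->.
  by rewrite EFinM.
Qed.

(** Uniform continuity with only one of the two points confined to the segment: the smoothing is
    later centred at an arbitrary real number. *)
Lemma continuous_segment_unif f (a b d : R) : continuous f -> 0 < d ->
  exists2 k, 0 < k & forall s t, a <= s <= b -> `|s - t| < k -> `|f s - f t| < d.
Proof.
move=> cf d0; have d2 : 0 < d / 2 by rewrite divr_gt0.
have /compact_near_coveringP/(_ R (0 : R)^'+ (fun k s => forall t, `|s - t| < k ->
  `|f s - f t| < d) _) := @segment_compact R a b.
have H x : `[a, b]%classic x -> \forall x' \near x & i \near 0^'+,
    forall t, `|x' - t| < i -> `|f x' - f t| < d.
  move=> _; have /cvgrPdist_lt/(_ _ d2) := cf x.
  move=> /nbhs_ballP[r /= r0 Hr].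
  have r2 : 0 < r / 2 by rewrite divr_gt0.
  near=> x' i => /= t xt.
  have x'x : `|x - x'| < r / 2.
    by near: x'; exact: (nbhsx_ballx x _ r2).
  have ir : i < r / 2 by near: i; exact: nbhs_right_lt.
  have xt' : `|x - t| < r by have := ler_distD x' x t; lra.
  have h1 := Hr x' (lt_trans x'x _); have h2 := Hr t xt'.
  have {}h1 : `|f x - f x'| < d / 2 by apply: h1; lra.
  by have := ler_distD (f x) (f x') (f t); rewrite (distrC (f x') (f x)); lra.
move=> /(_ H) h.
near (0 : R)^'+ => k; exists k => // s t sab.
have Hk : `[a, b]%classic `<=` (fun s => forall t, `|s - t| < k -> `|f s - f t| < d).
  by near: k; exact: h.
by apply: Hk; rewrite /= in_itv.
Unshelve. all: by end_near. Qed.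

Definition poisson e x := e / (pi * (x ^+ 2 + e ^+ 2)).

Lemma poisson_ge0 e x : 0 < e -> 0 <= poisson e x.
Proof.
move=> e0; rewrite divr_ge0 ?(ltW e0)// mulr_ge0 ?pi_ge0//.
by rewrite addr_ge0 ?sqr_ge0.
Qed.

Lemma poisson_sqr_gt0 e x : 0 < e -> 0 < x ^+ 2 + e ^+ 2.
Proof. by move=> e0; rewrite ltr_wpDl ?sqr_ge0// exprn_gt0. Qed.

Lemma poisson_resolvent e x t : 0 < e ->
  poisson e (x - t) = - complex.Im (t +i* e - x%:C)^-1 / pi.
Proof.
move=> e0; rewrite Im_resolvent.
have -> : normc (t +i* e - x%:C) ^+ 2 = (x - t) ^+ 2 + e ^+ 2.
  by rewrite normc_sqr !ReImE /= subr0; ring.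
rewrite /poisson -[complex.Im (t +i* e)]/e.
have := poisson_sqr_gt0 (x - t) e0; have := pi_gt0 R; move: (pi : R) => p p0 s0.
by field; rewrite !gt_eqF.
Qed.

Lemma continuous_poisson e x : 0 < e -> continuous (fun t => poisson e (x - t)).
Proof.
move=> e0 t; apply: cvgM; first exact: cvg_cst.
apply: cvgV; first by rewrite gt_eqF// mulr_gt0 ?pi_gt0// poisson_sqr_gt0.
apply: cvgM; first exact: cvg_cst.
apply: cvgD; last exact: cvg_cst.
rewrite expr2; under eq_fun do rewrite expr2.
by apply: cvgM; (apply: cvgB; [exact: cvg_cst|exact: cvg_id]).
Qed.

Lemma measurable_poisson e x : 0 < e -> measurable_fun setT (fun t => poisson e (x - t)).
Proof. by move=> e0; apply: continuous_measurable_fun; exact: continuous_poisson. Qed.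

(** The primitive [atan ((t - x) / e) / pi] takes its values in an interval of length 1. *)
Lemma poisson_mass_le1 e x (a b : R) : 0 < e -> a < b ->
  (\int[leb]_(t in `[a, b]) (poisson e (x - t))%:E <= 1)%E.
Proof.
move=> e0 ab; pose F t := pi^-1 * atan ((t - x) / e).
have p0 := pi_gt0 R.
have dF t : is_derive t 1 F (poisson e (x - t)).
  apply: is_derive_eq; rewrite /poisson /GRing.scale /=.
  have x0 := poisson_sqr_gt0 (x - t) e0.
  field; rewrite !gt_eqF//.
  by have := sqr_ge0 (t - x); have := exprn_gt0 2 e0; nra.
have cF : continuous F.
  by move=> t; apply: differentiable_continuous; apply/derivable1_diffP; have [] := dF t.
rewrite (@continuous_FTC2 _ _ F)//.
- rewrite -EFinB lee_fin /F -mulrBr ler_pdivrMl// mulr1.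
  by have := atan_ltpi2 ((b - x) / e); have := atan_gtNpi2 ((a - x) / e); lra.
- by apply: continuous_subspaceT; exact: continuous_poisson.
- split; first by move=> t _; have [] := dF t.
    exact/cvg_at_right_filter/cF.
  exact/cvg_at_left_filter/cF.
- by move=> t _; rewrite derive1E derive_val.
Qed.

(** Within distance [k] of [x], [f t] exceeds [f x] by less than [d / 2]; farther away the kernel is
    at most [e / (pi k^2)]. An upper bound only: for [x] outside [-2, 2] most of the kernel's mass
    is cut off. *)
Lemma poisson_smoothing_le f (M d : R) : continuous f -> (forall x, 0 <= f x) ->
  (forall x, f x <= M) -> 0 < d -> exists2 e0, 0 < e0 & forall e, 0 < e -> e < e0 ->
  forall x, (\int[leb]_(t in `[(-2)%R, 2%R]) (f t * poisson e (x - t))%:E <= (f x + d)%:E)%E.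
Proof.
move=> cf f0 fM d0; have d2 : 0 < d / 2 by rewrite divr_gt0.
have M0 : 0 <= M by apply: le_trans (f0 0) (fM 0).
have [k k0 Hk] := continuous_segment_unif (-2) 2 cf d2.
have p0 := pi_gt0 R.
pose L e := M * (e / (pi * k ^+ 2)).
have pk0 : 0 < pi * k ^+ 2 :> R by rewrite mulr_gt0// exprn_gt0.
(* Below this [e] the far part, at most [L e] on an interval of length 4, contributes no more than
   [d / 2]; [M + 1] guards against [M = 0]. *)
exists (d * (pi * k ^+ 2) / (8 * (M + 1))) => [|e e_gt0 ee0 x].
  by rewrite divr_gt0 ?mulr_gt0//; lra.
have mf : measurable_fun setT f by exact: continuous_measurable_fun.
have mP := measurable_poisson x e_gt0.
have L0 : 0 <= L e by rewrite mulr_ge0// divr_ge0 ?(ltW pk0) ?(ltW e_gt0).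
have L4 : L e * 4 <= d / 2.
  rewrite /L mulrA mulrAC ler_pdivrMr//.
  have M1 : 0 < 8 * (M + 1) by lra.
  move: ee0; rewrite ltr_pdivlMr// => h; nra.
have fx0 : 0 <= f x + d / 2 by have := f0 x; lra.
apply: (@le_trans _ _ (\int[leb]_(t in `[(-2)%R, 2%R])
   ((f x + d / 2)%:E * (poisson e (x - t))%:E + (L e)%:E))%E).
  apply: ge0_le_integral => //.
  - by move=> t _; rewrite lee_fin mulr_ge0// poisson_ge0.
  - by apply/measurable_funTS/measurable_EFinP/measurable_funM.
  - apply/measurable_funTS; under eq_fun do rewrite -EFinM -EFinD.
    by apply/measurable_EFinP/measurable_funD => //; exact: measurable_funM.
  move=> t; rewrite /= in_itv /= => t2; rewrite -EFinM -EFinD lee_fin.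
  have P0 := poisson_ge0 (x - t) e_gt0.
  have [tx|tx] := ltP `|t - x| k.
    have /ltr_normlW h := Hk t x t2 tx.
    have : f t * poisson e (x - t) <= (f x + d / 2) * poisson e (x - t).
      by rewrite ler_wpM2r//; lra.
    lra.
  have h1 : poisson e (x - t) <= e / (pi * k ^+ 2).
    rewrite ler_wpM2l ?(ltW e_gt0)// lef_pV2 ?posrE//; last first.
      by rewrite mulr_gt0// poisson_sqr_gt0.
    rewrite ler_wpM2l ?(ltW p0)//.
    have : k ^+ 2 <= `|t - x| ^+ 2 by apply: lerX2 => //; exact: ltW.
    rewrite real_normK ?num_real//.
    by have := sqr_ge0 e; nra.
  have h2 : f t * poisson e (x - t) <= L e by rewrite ler_pM.
  have : 0 <= (f x + d / 2) * poisson e (x - t) by rewrite mulr_ge0.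
  lra.
rewrite ge0_integralD//; last 2 first.
- by move=> t _; rewrite -EFinM lee_fin mulr_ge0// poisson_ge0.
- by apply/measurable_funTS; under eq_fun do rewrite -EFinM;
    apply/measurable_EFinP/measurable_funM.
rewrite ge0_integralZl//; last 2 first.
- exact/measurable_funTS/measurable_EFinP.
- by move=> t _; rewrite lee_fin poisson_ge0.
rewrite integral_cst//= lebesgue_measure_itv/= lte_fin ifT; last by lra.
apply: (@le_trans _ _ ((f x + d / 2)%:E * 1 + (L e)%:E * (2%:E - (-2)%:E)))%E.
  apply: leeD => //; apply: lee_wpmul2l; first by rewrite lee_fin.
  by apply: poisson_mass_le1 => //; lra.
by rewrite mule1 -EFinB -EFinM -EFinD lee_fin opprK; lra.
Qed.

Let cut f t := f t * \1_`[(-2 : R), 2]%classic t.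

Definition smoothed_density f mu e t : R :=
  cut f t * (- complex.Im (cauchy_transform mu (t +i* e)) / pi).

Let kernel f e (p : measurableTypeR R * measurableTypeR R) : \bar R :=
  (cut f p.2 * poisson e (p.1 - p.2))%:E.

Let measurable_cut f : measurable_fun setT f -> measurable_fun setT (cut f).
Proof. by move=> mf; apply: measurable_funM => //; exact: measurable_indic. Qed.

Let measurable_kernel f e : measurable_fun setT f -> measurable_fun setT (kernel f e).
Proof.
move=> mf; apply/measurable_EFinP; apply: measurable_funM.
  by apply: (measurableT_comp (measurable_cut mf)); exact: measurable_snd.
apply: measurable_funM; first exact: measurable_cst.
apply: (measurableT_comp measurable_invr).
apply: measurable_funM; first exact: measurable_cst.
apply: measurable_funD; last exact: measurable_cst.
apply: measurable_funX; apply: measurable_funB; first exact: measurable_fst.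
exact: measurable_snd.
Qed.

Let kernel_ge0 f e p : (forall x, 0 <= f x) -> 0 < e -> (0 <= kernel f e p)%E.
Proof.
by move=> f0 e0; rewrite lee_fin mulr_ge0 ?poisson_ge0// mulr_ge0// indicE ler0n.
Qed.

Let kernel_density f mu e t : 0 < e ->
  (\int[mu]_x kernel f e (x, t) = (smoothed_density f mu e t)%:E)%E.
Proof.
move=> e0; have [_ iI] := cintegrable_resolvent mu (e0 : 0 < complex.Im (t +i* e)).
have E x : cut f t * poisson e (x - t) =
    - (cut f t / pi) * complex.Im (t +i* e - x%:C)^-1.
  by rewrite poisson_resolvent//; ring.
rewrite /kernel /=; under eq_integral do rewrite E.
transitivity (\int[mu]_x (- (cut f t / pi) * complex.Im (t +i* e - x%:C)^-1))%:E.
  by rewrite /Rintegral fineK//; apply: integrable_fin_num => //; exact: integrable_scale.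
by rewrite (RintegralZl _ measurableT iI) /smoothed_density; congr EFin; rewrite Im_cint; ring.
Qed.

Lemma measurable_smoothed_density f mu e : measurable_fun setT f ->
  (forall x, 0 <= f x) -> 0 < e -> measurable_fun setT (smoothed_density f mu e).
Proof.
move=> mf f0 e0; apply/measurable_EFinP.
have := @measurable_fun_fubini_tonelli_G _ _ _ _ R mu _ (measurable_kernel e mf)
  (fun p => kernel_ge0 p f0 e0).
by congr measurable_fun; apply/funext => t; exact: kernel_density.
Qed.

Let integral_kernel f e x :
  (\int[leb]_t kernel f e (x, t) =
   \int[leb]_(t in `[(-2)%R, 2%R]) (f t * poisson e (x - t))%:E)%E.
Proof.
rewrite [RHS]integral_mkcond.
apply: eq_integral => t _; rewrite /kernel /cut /= patchE mem_setE indicE mem_setE.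
by case: ifP => _; rewrite ?mulr1// mulr0 mul0r.
Qed.

Lemma measurable_poisson_smoothing f e : measurable_fun setT f ->
  (forall x, 0 <= f x) -> 0 < e -> measurable_fun setT
    (fun x => \int[leb]_(t in `[(-2)%R, 2%R]) (f t * poisson e (x - t))%:E)%E.
Proof.
move=> mf f0 e0.
have := @measurable_fun_fubini_tonelli_F _ _ (measurableTypeR R) (measurableTypeR R) R leb _
  (measurable_kernel e mf) (fun p => kernel_ge0 p f0 e0).
by congr measurable_fun; apply/funext => x; exact: integral_kernel.
Qed.

(** Tonelli transfers the smoothing from [mu] to [f], so that a bound on smoothed test functions
    becomes one on smoothed measures. *)
Lemma integral_smoothed_density f mu e : measurable_fun setT f ->
  (forall x, 0 <= f x) -> 0 < e ->
  (\int[leb]_t (smoothed_density f mu e t)%:E =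
   \int[mu]_x \int[leb]_(t in `[(-2)%R, 2%R]) (f t * poisson e (x - t))%:E)%E.
Proof.
move=> mf f0 e0.
have := @fubini_tonelli _ _ (measurableTypeR R) (measurableTypeR R) R mu leb _
  (measurable_kernel e mf) (fun p => kernel_ge0 p f0 e0).
under [in RHS]eq_integral do rewrite kernel_density//.
by move=> <-; apply: eq_integral => x _; exact: integral_kernel.
Qed.

Lemma Im_cauchy_bound mu z : 0 < complex.Im z ->
  `|complex.Im (cauchy_transform mu z)| <= (complex.Im z)^-1.
Proof.
move=> z0; have [_ iI] := cintegrable_resolvent mu z0.
apply: le_trans (le_normr_Rintegral measurableT iI) _.
rewrite -[leRHS](Rintegral_probability_cst mu).
apply: le_Rintegral => //; [exact: integrable_norm|exact: integrable_cst|].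
by move=> x _; apply: le_trans (normc_Im _) _; exact: resolvent_le.
Qed.

Lemma smoothed_density_bound f mu e (M : R) t : (forall x, 0 <= f x) ->
  (forall x, f x <= M) -> 0 < e ->
  `|smoothed_density f mu e t| <= M / (e * pi) * \1_`[(-2 : R), 2]%classic t.
Proof.
move=> f0 fM e0; rewrite /smoothed_density /cut !normrM normrN.
have i0 : 0 <= \1_`[(-2 : R), 2]%classic t :> R by rewrite indicE ler0n.
have p0 := pi_gt0 R.
rewrite (ger0_norm (f0 t)) (ger0_norm i0) (gtr0_norm (_ : 0 < pi^-1)) ?invr_gt0//.
have h : f t * `|complex.Im (cauchy_transform mu (t +i* e))| <= M * e^-1.
  by rewrite ler_pM// Im_cauchy_bound.
rewrite mulrAC invfM !mulrA; do 2 (apply: ler_wpM2r; first by rewrite ?invr_ge0 ?(ltW p0)).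
by [].
Qed.

End poisson_smoothing.

(** * The semicircle root and its boundary values *)

Section semicircle_boundary.
Context {R : realType}.
Local Notation C := R[i].
Implicit Types (w q : C) (e t : R).

(** The two roots are inverse to each other, and inversion reverses the sign of the imaginary
    part. *)
Lemma semicircle_root w : 0 < complex.Im w ->
  exists q, [/\ q != 0, complex.Im q <= 0 & q + q^-1 = w].
Proof.
move=> w0; pose s := sqrtc (w ^+ 2 - 4).
have s2 : s ^+ 2 = w ^+ 2 - 4 by rewrite sqr_sqrtc.
pose r := (w + s) / 2.
have two : (2 : C) != 0 by rewrite pnatr_eq0.
have E : r * (w - r) = 1.
  have -> : r * (w - r) = (w ^+ 2 - s ^+ 2) / 4 by rewrite /r; field.
  by rewrite s2; field.
have r0 : r != 0 by apply: contra_eq_neq E => ->; rewrite mul0r eq_sym oner_neq0.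
have rV : r^-1 = w - r by rewrite -[RHS](mulKf r0) E mulr1.
have [rI|rI] := leP (complex.Im r) 0.
  by exists r; split=> //; rewrite rV addrC subrK.
exists r^-1; split; [by rewrite invr_eq0| |by rewrite invrK rV subrK].
by rewrite cImV mulNr oppr_le0 divr_ge0 ?(ltW rI)// exprn_ge0// normc_ge0.
Qed.

(** The imaginary part of the equation is [Im q (1 - 1 / |q|^2) = e > 0], impossible for [Im q <= 0]
    and [|q| > 1]. *)
Lemma semicircle_root_bound t e q : 0 < e -> q != 0 -> complex.Im q <= 0 ->
  q + q^-1 = t +i* e -> normc q <= 1.
Proof.
move=> e0 q0 qI qE; have n0 : 0 < normc q ^+ 2 by rewrite exprn_gt0// normc_gt0.
have := congr1 (@complex.Im R) qE; rewrite cImD cImV /= => h.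
have h2 : - complex.Im q * (1 - normc q ^+ 2) = e * normc q ^+ 2.
  by rewrite -h; field; rewrite gt_eqF// normc_gt0.
rewrite leNgt; apply/negP => n1.
have : 1 < normc q ^+ 2 by rewrite exprn_egt1.
have := mulr_gt0 e0 n0; nra.
Qed.

(* With [s = sqrt (4 - t^2)] and [q0 = (t - i s) / 2], one has
   [(q - q0) (q - conj q0) = i e q], whose modulus is at most [e], and both factors
   are at least [|- Im q - s / 2|]. *)
Lemma semicircle_root_cvg t e q : - 2 <= t -> t <= 2 -> 0 < e -> q != 0 ->
  complex.Im q <= 0 -> q + q^-1 = t +i* e ->
  (- complex.Im q - Num.sqrt (4 - t ^+ 2) / 2) ^+ 2 <= e.
Proof.
move=> t2 t2' e0 q0 qI qE; set s := Num.sqrt _.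
have s0 : 0 <= s by exact: sqrtr_ge0.
have s2 : s ^+ 2 = 4 - t ^+ 2 by rewrite sqr_sqrtr//; nra.
have n1 := semicircle_root_bound e0 q0 qI qE.
pose q1 : C := (t / 2) -i* (s / 2); pose q2 : C := (t / 2) +i* (s / 2).
have P1 : q1 * q2 = 1.
  by apply: complex_eq; rewrite !ReImE /=; [field: s2|field].
have P2 : q1 + q2 = t%:C by apply: complex_eq; rewrite !ReImE /=; field.
have E : (q - q1) * (q - q2) = (0 +i* e) * q.
  have -> : (0 +i* e) = q + q^-1 - t%:C by rewrite qE; apply: complex_eq; rewrite !ReImE /=; ring.
  have -> : (q - q1) * (q - q2) = q ^+ 2 - (q1 + q2) * q + q1 * q2 by ring.
  by rewrite P1 P2; field.
have nE : normc (q - q1) * normc (q - q2) <= e.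
  rewrite -normcM E normcM (_ : normc (0 +i* e) = e); last first.
    by rewrite /= expr0n add0r sqrtr_sqr gtr0_norm.
  by rewrite ler_piMr// ltW.
have h1 := normc_Im (q - q1); have h2 := normc_Im (q - q2).
rewrite !cImD !cImN /= in h1 h2.
have a1 : `|- complex.Im q - s / 2| <= normc (q - q1).
  by rewrite -normrN; apply: le_trans h1; rewrite le_eqVlt; apply/orP; left; apply/eqP; congr `|_|; ring.
have a2 : `|- complex.Im q - s / 2| <= normc (q - q2).
  apply: le_trans h2; rewrite distrC opprK (@ler0_norm _ (complex.Im q - s / 2)); last by lra.
  by rewrite ler_norml; apply/andP; split; lra.
rewrite -real_normK ?num_real// expr2; apply: le_trans nE.
by rewrite ler_pM.
Qed.

End semicircle_boundary.

(** * From Cauchy transforms to weak convergence *)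

Section weak_convergence.
Context {R : realType}.
Local Notation C := R[i].
Local Notation law := (probability (measurableTypeR R) R).
Local Notation leb := (@lebesgue_measure R).
Variable mu : nat -> law.
Hypothesis mu_cvg : forall w q : C, 0 < complex.Im w -> q != 0 -> complex.Im q <= 0 ->
  q + q^-1 = w -> ccvg (fun n => cauchy_transform (mu n) w) q.

Let eps (k : nat) : R := k.+1%:R^-1.
Let eps_gt0 k : 0 < eps k. Proof. by rewrite invr_gt0. Qed.

Lemma bounded_integrable (nu : law) (f : R -> R) (M : R) : measurable_fun setT f ->
  (forall x, `|f x| <= M) -> nu.-integrable setT (fun x => (f x)%:E).
Proof. by move=> mf fM; exact: integrable_le mf (integrable_cst nu M) fM. Qed.

Lemma integrable_bump (c : R) :
  leb.-integrable setT (fun t => (c * \1_`[(-2 : R), 2]%classic t)%:E).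
Proof.
under eq_fun do rewrite EFinM; apply: integrableZl => //.
exact: (integrable_indic_itv (-2) 2 true false).
Qed.

(** Two dominated limits: [n] to infinity at a fixed height [eps k], with a bound depending on [k],
    then [k] to infinity, where [|q| <= 1] gives the bound [M / pi] on [-2, 2] for all [k]. These
    and the smoothing error each cost [d / 3]. *)
Lemma liminf_integral_ge (f : R -> R) (M d : R) : continuous f -> (forall x, 0 <= f x) ->
  (forall x, f x <= M) -> 0 < d ->
  \forall n \near \oo,
    \int[semicircle_prob (R:=R)]_x f x - d < \int[mu n]_x f x.
Proof.
move=> cf f0 fM d0; have d3 : 0 < d / 3 by rewrite divr_gt0.
have mf : measurable_fun setT f by exact: continuous_measurable_fun.
have M0 : 0 <= M by apply: le_trans (f0 0) (fM 0).
have p0 := pi_gt0 R.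
have [e0 e00 He0] := poisson_smoothing_le cf f0 fM d3.
have [q Hq] : exists q : C -> C, forall w, 0 < complex.Im w ->
    [/\ q w != 0, complex.Im (q w) <= 0 & q w + (q w)^-1 = w].
  have H (w : C) : exists q : C, 0 < complex.Im w -> [/\ q != 0, complex.Im q <= 0 & q + q^-1 = w].
    have [w0|w0] := ltP 0 (complex.Im w); last by exists 0.
    by have [q hq] := semicircle_root w0; exists q.
  by have [q hq] := choice H; exists q.
pose ind (t : R) : R := \1_`[(-2 : R), 2]%classic t.
have ind0 t : 0 <= ind t by rewrite /ind indicE ler0n.
pose h k t := f t * ind t * (- complex.Im (q (t +i* eps k)) / pi).
have dens_h k t : (fun n => smoothed_density f (mu n) (eps k) t) @ \oo --> h k t.
  apply: cvgM; first exact: cvg_cst.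
  apply: cvgM; last exact: cvg_cst.
  have w0 : 0 < complex.Im (t +i* eps k) by exact: eps_gt0.
  have [q0 qI qE] := Hq _ w0.
  by apply: cvgN; have [] := mu_cvg w0 q0 qI qE.
have dens_hE k t : (fun n => (smoothed_density f (mu n) (eps k) t)%:E) @ \oo --> (h k t)%:E.
  by apply: cvg_EFin; [near=> n|exact: dens_h].
(* [q] comes from [choice] with no regularity, so measurability of [h k] is obtained from its being
   a pointwise limit. *)
have mh k : measurable_fun setT (fun t => (h k t)%:E).
  apply: (emeasurable_fun_cvg (fun n t => (smoothed_density f (mu n) (eps k) t)%:E)).
    by move=> n; apply/measurable_EFinP; exact: measurable_smoothed_density.
  by move=> t _; exact: dens_hE.
have int_dens k : (fun n => \int[leb]_t (smoothed_density f (mu n) (eps k) t)%:E)%E @ \oo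
    --> (\int[leb]_t (h k t)%:E)%E.
  have mdens n : measurable_fun setT (fun t => (smoothed_density f (mu n) (eps k) t)%:E).
    by apply/measurable_EFinP; exact: measurable_smoothed_density.
  have ae_h : {ae leb, forall t, setT t ->
      (fun n => (smoothed_density f (mu n) (eps k) t)%:E) @ \oo --> (h k t)%:E}.
    by apply: aeW => t _; exact: dens_hE.
  have dom : {ae leb, forall t n, setT t ->
      (`|(smoothed_density f (mu n) (eps k) t)%:E| <= (M / (eps k * pi) * ind t)%:E)%E}.
    by apply: aeW => t n _; rewrite lee_fin; exact: smoothed_density_bound.
  by have [] := @dominated_convergence _ (measurableTypeR R) R leb _ measurableT _ _ _ mdens
    (mh k) ae_h (integrable_bump _) dom.
(* Closed and open interval agree here because the square root vanishes at the endpoints. *)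
have sc_pdf t : f t * ind t * (Num.sqrt (4 - t ^+ 2) / 2 / pi) = f t * semicircle_pdf t.
  rewrite /ind /semicircle_pdf !indicE !mem_setE !in_itv /=.
  have [t2|t2] := boolP (-2 < t < 2).
    have -> : -2 <= t <= 2 by case/andP: t2 => ? ?; rewrite !ltW.
    by rewrite !mulr1 invfM; ring.
  rewrite mulr0; have [t2'|_] := boolP (-2 <= t <= 2); last by rewrite !mulr0 mul0r.
  rewrite ler0_sqrtr ?mul0r ?mulr0//.
  by move: t2 t2'; rewrite negb_and -!leNgt => /orP[] ? /andP[? ?]; nra.
have h_sc t : (fun k => h k t) @ \oo --> f t * semicircle_pdf t.
  rewrite -sc_pdf; have [t2|t2] := boolP (t \in `[(-2)%R, 2%R]); last first.
    have -> : (fun k => h k t) = fun=> f t * ind t * (Num.sqrt (4 - t ^+ 2) / 2 / pi).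
      by apply/funext => k; rewrite /h /ind indicE mem_setE (negbTE t2) !mulr0 !mul0r.
    exact: cvg_cst.
  apply: cvgM; first exact: cvg_cst.
  apply: cvgM; last exact: cvg_cst.
  apply/cvgrPdist_lt => e e_gt0; near=> k.
  have w0 : 0 < complex.Im (t +i* eps k) by exact: eps_gt0.
  have [q0 qI qE] := Hq _ w0.
  move: t2; rewrite in_itv /= => /andP[t2 t2'].
  have := semicircle_root_cvg t2 t2' (eps_gt0 k) q0 qI qE.
  rewrite -real_normK ?num_real// distrC => hk.
  have ek : eps k < e ^+ 2.
    near: k; have := @cvg_harmonic R; move/cvgrPdist_lt/(_ _ (exprn_gt0 2 e_gt0)).
    by apply: filterS => k /=; rewrite sub0r normrN ger0_norm// invr_ge0.
  rewrite ltNge; apply/negP => he.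
  have := lerX2 2 (ltW e_gt0) he; lra.
have h_scE t : (fun k => (h k t)%:E) @ \oo --> (f t * semicircle_pdf t)%:E.
  by apply: cvg_EFin; [near=> n|exact: h_sc].
have msc : measurable_fun setT (fun t => (f t * semicircle_pdf t)%:E).
  by apply/measurable_EFinP/measurable_funM => //; exact: measurable_semicircle_pdf.
have int_h : (fun k => \int[leb]_t (h k t)%:E)%E @ \oo
    --> (\int[leb]_t (f t * semicircle_pdf t)%:E)%E.
  have ae_sc : {ae leb, forall t, setT t ->
      (fun k => (h k t)%:E) @ \oo --> (f t * semicircle_pdf t)%:E}.
    by apply: aeW => t _; exact: h_scE.
  have dom : {ae leb, forall t k, setT t ->
      (`|(h k t)%:E| <= (M / pi * ind t)%:E)%E}.
    apply: aeW => t k _; rewrite lee_fin /h.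
    have w0 : 0 < complex.Im (t +i* eps k) by exact: eps_gt0.
    have [q0 qI qE] := Hq _ w0.
    have n1 := semicircle_root_bound (eps_gt0 k) q0 qI qE.
    have I1 := le_trans (normc_Im _) n1.
    rewrite !normrM normrN (ger0_norm (f0 t)) (ger0_norm (ind0 t)).
    rewrite (gtr0_norm (_ : 0 < pi^-1)) ?invr_gt0//.
    rewrite mulrAC ler_wpM2r// mulrA ler_wpM2r ?invr_ge0 ?(ltW p0)//.
    by rewrite -[M]mulr1 ler_pM.
  by have [] := @dominated_convergence _ (measurableTypeR R) R leb _ measurableT _ _ _ mh msc
    ae_sc (integrable_bump _) dom.
rewrite -integral_semicircle// in int_h.
have fn x : `|f x| <= M by rewrite ger0_norm.
have imu n := bounded_integrable (mu n) mf fn.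
have isc := bounded_integrable (semicircle_prob (R:=R)) mf fn.
rewrite -[X in _ --> X]fineK in int_h; last exact: integrable_fin_num.
have /fine_cvgP[hfin /cvgrPdist_lt/(_ _ d3) hd] := int_h.
(* The height is fixed before [n], since convergence in [n] is available only for a given [k]. *)
have [k [kfin kd ke]] : exists k, [/\ (\int[leb]_t (h k t)%:E)%E \is a fin_num,
    `|\int[semicircle_prob (R:=R)]_x f x - \int[leb]_t h k t| < d / 3 & eps k < e0].
  near \oo => k; exists k; split; [by near: k|by near: k|near: k].
  have := @cvg_harmonic R; move/cvgrPdist_lt/(_ _ e00).
  by apply: filterS => k /=; rewrite sub0r normrN ger0_norm// invr_ge0.
have arith (a b c g : R) : a - b < d / 3 -> b - c < d / 3 -> c <= g + d / 3 -> a - d < g.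
  by lra.
have := int_dens k; rewrite -(fineK kfin) => /fine_cvgP[nfin /cvgrPdist_lt/(_ _ d3) nd].
near=> n.
have nd' : `|\int[leb]_t h k t - \int[leb]_t smoothed_density f (mu n) (eps k) t| < d / 3.
  by near: n.
have fin_n : (\int[leb]_t (smoothed_density f (mu n) (eps k) t)%:E)%E \is a fin_num.
  by near: n.
have le_n : \int[leb]_t smoothed_density f (mu n) (eps k) t <= \int[mu n]_x f x + d / 3.
  rewrite -[X in _ <= _ + X](Rintegral_probability_cst (mu n)) -RintegralD//;
    [|exact: imu|exact: integrable_cst].
  rewrite -lee_fin /Rintegral fineK// fineK; last first.
    by apply: integrable_fin_num => //; apply: integrable_add => //; exact: integrable_cst.
  rewrite integral_smoothed_density//.
  apply: ge0_le_integral => //.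
  - move=> x _; apply: integral_ge0 => t _.
    by rewrite lee_fin mulr_ge0// poisson_ge0.
  - exact: measurable_poisson_smoothing.
  - by apply/measurable_EFinP/measurable_funD.
  - by move=> x _; exact: He0.
move: kd nd' le_n; rewrite !ltr_norml => /andP[_ h1] /andP[_ h2] h3.
exact: arith h1 h2 h3.
Unshelve. all: by end_near. Qed.

Lemma weak_cvg_semicircle : weak_cvg mu (semicircle_prob (R:=R)).
Proof.
(* [bounded_fun] guarantees the bound only for constants strictly above [M0]. *)
move=> f cf [M0 [_ HM]]; pose M := M0 + 1.
have fM x : `|f x| <= M by apply: HM => //; rewrite /M ltrDl.
have mf : measurable_fun setT f by exact: continuous_measurable_fun.
have isc := bounded_integrable (semicircle_prob (R:=R)) mf fM.
have imu n := bounded_integrable (mu n) mf fM.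
have fin_mu n : (\int[mu n]_x (f x)%:E)%E \is a fin_num.
  by apply: integrable_fin_num; [|exact: imu].
rewrite -[X in _ --> X]fineK; last exact: integrable_fin_num.
apply/fine_cvgP; split; first exact: nearW fin_mu.
apply/cvgrPdist_lt => d d0.
have lo x : 0 <= M + f x by have := fM x; rewrite ler_norml => /andP[]; lra.
have hi x : 0 <= M - f x by have := fM x; rewrite ler_norml => /andP[]; lra.
have cD : continuous (fun x => M + f x).
  by move=> x; apply: cvgD; [exact: cvg_cst|exact: cf].
have cB : continuous (fun x => M - f x).
  by move=> x; apply: cvgB; [exact: cvg_cst|exact: cf].
have := liminf_integral_ge cD lo (M := 2 * M) _ d0.
have := liminf_integral_ge cB hi (M := 2 * M) _ d0.
move=> HB HD.
(* Every law has total mass 1, so the constant [M] appears on both sides of the two lower bounds and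
   cancels. *)
have arith (a b : R) : M - a - d < M - b -> M + a - d < M + b -> -d < a - b < d.
  by move=> h1 h2; apply/andP; split; lra.
near=> n.
have intD (nu : law) : nu.-integrable setT (fun x => (f x)%:E) ->
    \int[nu]_x (M + f x) = M + \int[nu]_x f x.
  move=> inu; rewrite RintegralD ?Rintegral_probability_cst//.
  exact: integrable_cst.
have intB (nu : law) : nu.-integrable setT (fun x => (f x)%:E) ->
    \int[nu]_x (M - f x) = M - \int[nu]_x f x.
  move=> inu; rewrite RintegralB ?Rintegral_probability_cst//.
  exact: integrable_cst.
have : \int[semicircle_prob (R:=R)]_x (M - f x) - d < \int[mu n]_x (M - f x).
  near: n; apply: HB => x; have := lo x; lra.
have : \int[semicircle_prob (R:=R)]_x (M + f x) - d < \int[mu n]_x (M + f x).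
  near: n; apply: HD => x; have := hi x; lra.
rewrite !intD// !intB// => h1 h2; rewrite ltr_norml.
exact: arith h2 h1.
Unshelve. all: by end_near. Qed.

End weak_convergence.

Local Close Scope complex_scope.

Theorem theorem1p8 (R : realType)
  (mu : nat -> probability (measurableTypeR R) R)
  (mean0 : forall n, (1 <= n)%N -> 'E_(mu n)[idfun : R -> R]%E = 0%E)
  (var1 : forall n, (1 <= n)%N -> 'V_(mu n)[idfun : R -> R]%E = 1%E)
  (div : forall n, (1 <= n)%N -> free_divisible n (mu n))
  (moment4 : 'E_(mu n)[(fun x : R => x ^+ 4)%R]%E @[n --> \oo] --> 2%:E) :
  weak_cvg mu (semicircle_prob (R:=R)).
Proof.
apply: weak_cvg_semicircle => w q w0 q0 qI qE.
exact: cauchy_transform_cvg mean0 var1 div moment4 _ _ w0 q0 qI qE.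
Qed.
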